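(* Let $f$ be a meromorphic function on $\mathbb{C}$ such that, if $f$ extends to a rational function on $\mathbb{P}^1$, then this rational function has degree $>1$ and either $f$ is a polynomial or the Fatou set $F(f)$ (defined in the context) coincides with the usual Fatou set in $\mathbb{P}^1$ of the extended $f$. Let $a\in\mathbb{C}$ be a fixed point of $f^p$ for some $p\in\mathbb{N}=\{1,2,\ldots\}$ having the multiplier $\lambda:=(f^p)'(a)\in(\mathbb{D}\setminus\{0\})\cup\{1\}$, where $\mathbb{D}=\{z\in\mathbb{C}:|z|<1\}$. Let $\Omega\subset\mathbb{C}$ be the attracting basin (if $\lambda\in\mathbb{D}\setminus\{0\}$) or parabolic basin (if $\lambda=1$) of $f$ associated to the orbit of $a$, and let the holomorphic surjection $\Phi:\Omega\to\mathbb{C}$ be a solution of the Schröder equation (if $\lambda\in\mathbb{D}\setminus\{0\}$) or of the Abel equation (if $\lambda=1$) for $f$ associated to the orbit of $a$. Then for every $t\in\mathbb{N}\setminus\{1\}$, $$\frac{(f^n)^{(t)}}{(f^n)'}=\frac{\Phi^{(t)}}{\Phi'}+\begin{cases}O\bigl(|\lambda|^{n/p}\bigr)&\text{if }\lambda\in\mathbb{D}\setminus\{0\},\\ O\bigl(\tfrac1n\bigr)&\text{if }\lambda=1\end{cases}\qquad\text{as }n\to+\infty$$ locally uniformly on $\Omega\setminus\{\Phi'=0\}$, where $(\cdot)^{(t)}$ denotes the $t$-th order derivative with respect to $z$.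
   Context: $f^n$ denotes the $n$-th iterate of $f$, and $\mathbb{P}^1=\mathbb{C}\cup\{\infty\}$. Fatou set: for a meromorphic function $f$ on $\mathbb{C}$, $F(f)$ is the region of normality (the largest open set on which the iterates form a normal family) for the restriction $f:\mathbb{C}\setminus\overline{\bigcup_{n\in\mathbb{N}}f^{-n}(\infty)}\to\mathbb{C}\setminus\overline{\bigcup_{n\in\mathbb{N}}f^{-n}(\infty)}$. In particular all iterates $f^n$ are holomorphic on $F(f)$. Basin: the attracting basin (when $\lambda\in\mathbb{D}\setminus\{0\}$) or parabolic basin (when $\lambda=1$) of $f$ associated to (the orbit under $f$ of the periodic point) $a$ is $$\Omega:=\Bigl\{z\in F(f):\lim_{n\to+\infty}f^{pn+j}(z)=a\ \text{ for some }j\in\mathbb{N}\cup\{0\}\Bigr\},$$ which is completely invariant under $f$. Schröder and Abel equations: a $p$-th root $\lambda^{1/p}$ of $\lambda$ is fixed, with $\lambda^{1/p}=1$ when $\lambda=1$. A holomorphic surjection $\Phi:\Omega\to\mathbb{C}$ is a solution of the Schröder (resp. Abel) equation for $f$ associated to the orbit of $a$ if - (Schröder, case $\lambda\in\mathbb{D}\setminus\{0\}$) $\Phi\circ f=\lambda^{1/p}\cdot\Phi$ on $\Omega$ and $\Phi'(f^j(a))\neq0$ for every $j\in\{0,\ldots,p-1\}$; - (Abel, case $\lambda=1$) $\Phi\circ f=\Phi+\frac1p$ on $\Omega$ and $\Phi$ is injective on $P$, for any attracting petal $P$ of $f^p$ associated to one of the (finitely many) attracting directions towards the multiple fixed point $f^j(a)$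 of $f^p$, for some $j\in\{0,\ldots,p-1\}$. Such a $\Phi$ exists by the Koenigs–Schröder–Poincaré theorem, respectively the Leau–Fatou flower theorem. Here an attracting petal of $f^p$ at a multiple fixed point $b$ for an attracting direction $\boldsymbol{v}$ is meant in the usual sense of the Leau–Fatou theory (e.g. as in Milnor's book): an open set $P$, contained in a neighborhood of $b$ on which $f^p$ is univalent, with $f^p(P)\subset P$, such that an orbit under $f^p$ is eventually absorbed by $P$ if and only if it converges to $b$ from the direction $\boldsymbol{v}$. *)

(* Defs.v *)
From HB Require Import structures.
From mathcomp Require Import all_boot all_order all_algebra complex.
From mathcomp Require Import boolp classical_sets functions reals.
From mathcomp Require Import topology normedtype derive.

Set Implicit Arguments.
Unset Strict Implicit.
Unset Printing Implicit Defensive.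

Import Order.TTheory GRing.Theory Num.Theory numFieldNormedType.Exports.

Local Open Scope ring_scope.
Local Open Scope complex_scope.
Local Open Scope classical_set_scope.

(* The complex plane is R[i] for a realType R, normed over itself, so that
   [derivable g z 1] and [derive1 g z] are complex differentiability and the
   complex derivative.  Norms, radii and error terms below take (real) values
   in R[i]. *)
HB.instance Definition _ (R : realType) := NormedModule.copy R[i] R[i]^o.

(* P^1, with [None] the point at infinity *)
Notation sphere R := (one_point_compactification R[i]).

Section Dynamics.
Context {R : realType}.
Local Notation C := R[i].

Definition finval (x : sphere R) : C := odflt 0 x.

Definition holomorphic_on (U : set C) (g : C -> C) : Prop :=
  forall z, U z -> derivable g z 1.

(* At every point f is either finite and holomorphic nearby, or has a pole.
   Constants are allowed; the function constantly equal to infinity is not. *)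
Definition meromorphic (f : C -> sphere R) : Prop :=
  forall z,
    (\forall w \near z, f w <> None /\ derivable (finval \o f) w 1) \/
    [/\ f z = None,
        \forall w \near z^', f w <> None /\ derivable (finval \o f) w 1 &
        forall M : R, \forall w \near z^', M%:C < `|finval (f w)| ].

(* n-th iterate of f : C -> P^1 as a partial map of C: it takes the value
   [None] as soon as the orbit meets a pole. *)
Definition fiter (f : C -> sphere R) (n : nat) (z : C) : sphere R :=
  iter n (obind f) (Some z).

(* the same iterate as a complex function (meaningful where it is finite) *)
Definition fiterc (f : C -> sphere R) (n : nat) (z : C) : C :=
  finval (fiter f n z).

Definition chordal (x y : sphere R) : C :=
  match x, y with
  | Some z, Some w =>
      2 * `|z - w| / (sqrtC (1 + `|z| ^+ 2) * sqrtC (1 + `|w| ^+ 2))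
  | Some z, None | None, Some z => 2 / sqrtC (1 + `|z| ^+ 2)
  | None, None => 0
  end.

Definition loc_unif_cvg (X : topologicalType) (U : set X)
    (g : nat -> X -> sphere R) (h : X -> sphere R) : Prop :=
  forall x, U x -> exists2 V, nbhs x V &
    forall e : C, 0 < e -> \forall n \near \oo,
      forall y, (U `&` V) y -> chordal (g n y) (h y) < e.

Definition normal_family (X : topologicalType) (U : set X)
    (F : set (X -> sphere R)) : Prop :=
  forall g : nat -> X -> sphere R, (forall n, F (g n)) ->
    exists (s : nat -> nat) (h : X -> sphere R),
      (forall m n, (m < n)%N -> (s m < s n)%N) /\
      loc_unif_cvg U (g \o s) h.

(* the union of the f^{-n}(infinity), n >= 1 *)
Definition prepoles (f : C -> sphere R) : set C :=
  [set z | exists n, fiter f n z = None].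

Definition fatou (f : C -> sphere R) : set C :=
  [set z | exists U : set C, [/\ open U, U z,
     U `<=` ~` closure (prepoles f) & normal_family U (range (fiter f))]].

Definition sphere_fatou (F : sphere R -> sphere R) : set (sphere R) :=
  [set x | exists U : set (sphere R), [/\ open U, U x &
     normal_family U (range (fun n => iter n F))]].

(* The self-map of P^1 induced by P / Q, for P and Q coprime, Q <> 0. *)
Definition rational_map (P Q : {poly C}) (x : sphere R) : sphere R :=
  match x with
  | Some z => if Q.[z] == 0 then None else Some (P.[z] / Q.[z])
  | None => if (size Q < size P)%N then None
            else Some (P`_(size Q).-1 / lead_coef Q)
  end.

Definition rational_degree (P Q : {poly C}) : nat :=
  maxn (size P).-1 (size Q).-1.

Definition admissible (f : C -> sphere R) : Prop :=
  forall P Q : {poly C}, Q != 0 -> coprimep P Q ->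
    (forall z, f z = rational_map P Q (Some z)) ->
    (1 < rational_degree P Q)%N /\
    ((exists p : {poly C}, forall z, f z = Some p.[z]) \/
     Some @` fatou f = sphere_fatou (rational_map P Q)).

Definition basin (f : C -> sphere R) (p : nat) (a : C) : set C :=
  [set z | fatou f z /\
     exists j : nat, fiterc f (p * n + j)%N z @[n --> \oo] --> a].

(* g(z) = z + c (z - b)^(k+1) + o((z - b)^(k+1)) with c <> 0 and k >= 1, and v
   is one of the k attraction vectors k c v^k = -1 of Leau-Fatou theory. *)
Definition attraction_vector (g : C -> C) (b : C) (k : nat) (v : C) : Prop :=
  (0 < k)%N /\
  exists2 c : C, (g z - z) / (z - b) ^+ k.+1 @[z --> b^'] --> c &
                 k%:R * c * v ^+ k = -1.

(* z is an orbit of f^p; in particular it never meets infinity *)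
Definition orbit_seq (f : C -> sphere R) (p : nat) (z : nat -> C) : Prop :=
  forall n, fiter f p (z n) = Some (z n.+1).

(* the orbit z converges to b from the direction v: z_n - b ~ v / n^(1/k) *)
Definition cvg_from_direction (z : nat -> C) (b : C) (k : nat) (v : C) : Prop :=
  k.-root (n%:R : C) * (z n - b) @[n --> \oo] --> v.

Definition univalent_on (f : C -> sphere R) (p : nat) (N : set C) : Prop :=
  [/\ forall z, N z -> fiter f p z <> None,
      holomorphic_on N (fiterc f p) &
      forall z w, N z -> N w -> fiterc f p z = fiterc f p w -> z = w].

Definition attracting_petal (f : C -> sphere R) (p : nat) (b v : C)
    (P : set C) : Prop :=
  exists2 k : nat, attraction_vector (fiterc f p) b k v &
  [/\ open P,
      exists N : set C, [/\ open N, N b, P `<=` N & univalent_on f p N],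
      forall z, P z -> exists2 w, fiter f p z = Some w & P w &
      forall z : nat -> C, orbit_seq f p z ->
        (\forall n \near \oo, P (z n)) <-> cvg_from_direction z b k v].

(* mu is the chosen p-th root of the multiplier *)
Definition schroder_solution (f : C -> sphere R) (p : nat) (a mu : C)
    (Phi : C -> C) : Prop :=
  (forall z, basin f p a z -> Phi (finval (f z)) = mu * Phi z) /\
  (forall j, (j < p)%N -> derive1 Phi (fiterc f j a) != 0).

Definition abel_solution (f : C -> sphere R) (p : nat) (a : C)
    (Phi : C -> C) : Prop :=
  (forall z, basin f p a z -> Phi (finval (f z)) = Phi z + p%:R^-1) /\
  (forall j v P, (j < p)%N -> attracting_petal f p (fiterc f j a) v P ->
     forall z w, P z -> P w -> Phi z = Phi w -> z = w).

(* e_n = O(r_n) as n -> oo, locally uniformly on the open set D: around each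
   point of D one constant and one rank serve for a whole neighbourhood. *)
Definition loc_unif_bigO (D : set C) (e : nat -> C -> C) (r : nat -> C) : Prop :=
  forall z0, D z0 -> exists M : R,
    \forall z \near z0 & n \near \oo, D z -> `|e n z| <= M%:C * r n.

End Dynamics.

(* Main.v *)
(** Differentiating the functional equation of Phi on the basin gives
    (f^n)' = Phi' * V_n(f^n) with V_n = mu^n / Phi': in the time coordinate Phi,
    f^n moves along the vector field V_n.  Hence (f^n)^(t) is a combination of
    the V_n[j](f^n), where V[0] = V and V[j+1] = V[j]' V, with coefficients
    depending on Phi only; the term j = 0 contributes exactly
    (Phi^(t) / Phi') (f^n)'.  If |V_n| <= B on the disc of radius rho about
    f^n(z), Cauchy's estimates bound the other terms, relative to (f^n)', by a
    multiple of B / rho.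

    When |lambda| < 1, Phi' does not vanish on the orbit of a, so rho can be
    fixed and B is of order |mu|^n.  When lambda = 1, let m + 1 be the order of
    f^p - id at the limit point b.  Orbits enter an explicit attracting petal on
    which Phi is injective; Bloch's theorem, combined with the injectivity and
    with Phi o f^p = Phi + 1, gives |Phi'(w)| = O(|w - b|^(-m-1)), and Cauchy's
    estimate for Phi'' turns 1 = Phi(f^p w) - Phi(w) into the converse bound.
    So B = O(|w - b|^(m+1)) with rho comparable to |w - b|, and B / rho is of
    order |f^n(z) - b|^m, that is 1 / n. *)
From HB Require Import structures.
From mathcomp Require Import all_boot all_order all_algebra complex.
From mathcomp Require Import boolp classical_sets functions reals.
From mathcomp Require Import topology normedtype derive.
From mathcomp Require Import trigo constructive_ereal measure lebesgue_measure lebesgue_integral ftc.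
From mathcomp Require Import zify ring lra.
(* Imported last: [fatou] is the Fatou set here, not the lemma of the measure library. *)
Require Import Defs.

Import Order.TTheory GRing.Theory Num.Theory numFieldNormedType.Exports.
Import ComplexField.Normc.

Local Open Scope ring_scope.
Local Open Scope complex_scope.
Local Open Scope classical_set_scope.

Set Implicit Arguments.
Unset Strict Implicit.
Unset Printing Implicit Defensive.

(** The constants must not depend on n although f^n itself is uncontrolled: in the flow estimate n
    enters only through V_n on a disc about f^n(z), so the constants come from Phi, the base point
    and t alone. Injectivity of Phi is given only on attracting petals in the exact sense of the
    definition, so the explicit petal must be shown to absorb precisely the orbits converging from
    its direction. Two nested petals occur: the smaller catches the orbit, and discs of radius
    proportional to |w - b| about its points stay in the larger, where Phi is injective. To place
    petals in the basin one needs normality on them; to iterate inside the basin one needs forward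
    invariance of the Fatou set, which rests on the open mapping theorem, [admissible] supplying
    that f is not constant. As an orbit approaches a whole cycle, n is split as p l + k and each
    residue class k is followed to its own limit point. Function theory is built on primitives along
    segments, with compactness of [0, 1] entering as a bisection principle. *)

Local Notation Re := complex.Re.
Local Notation Im := complex.Im.

(** * The real-valued modulus on the complex numbers *)

Section Modulus.
Context {R : realType}.
Implicit Types (x y z w : R[i]) (r e : R).

Lemma normC_normc z : `|z| = (normc z)%:C.
Proof. by case: z. Qed.

Lemma normc_ge0 z : 0 <= normc z.
Proof. by case: z => a b; exact: sqrtr_ge0. Qed.

Lemma normc_eq0 z : (normc z == 0) = (z == 0).
Proof. by apply/eqP/eqP => [/eq0_normc//|->]; exact: normc0. Qed.

Lemma normc_gt0 z : (0 < normc z) = (z != 0).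
Proof. by rewrite lt_def normc_ge0 andbT normc_eq0. Qed.

Lemma normcB z w : normc (z - w) = normc (w - z).
Proof. by rewrite -normcN opprB. Qed.

Lemma normcD_le z w : normc (z + w) <= normc z + normc w.
Proof. exact: le_normcD. Qed.

Lemma normcB_le z w : normc (z - w) <= normc z + normc w.
Proof. by rewrite -(normcN w); exact: le_normcD. Qed.

Lemma normc_dist x y z : normc (x - z) <= normc (x - y) + normc (y - z).
Proof. by have := normcD_le (x - y) (y - z); rewrite addrA subrK. Qed.

Lemma normc_rev z w : normc z - normc w <= normc (z - w).
Proof. by have := normcD_le (z - w) w; rewrite subrK; lra. Qed.

Lemma normc_real r : normc r%:C = `|r|.
Proof. by rewrite /= expr0n /= addr0 sqrtr_sqr. Qed.

Lemma normc_nat n : normc (n%:R : R[i]) = n%:R.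
Proof. by rewrite -(rmorph_nat (real_complex R)) normc_real normr_nat. Qed.

Lemma normcX z n : normc (z ^+ n) = normc z ^+ n.
Proof.
elim: n => [|n IH]; first by rewrite !expr0 normc1.
by rewrite !exprS normcM IH.
Qed.

Lemma normc_div z w : normc (z / w) = normc z / normc w.
Proof. by rewrite normcM normcV. Qed.

Lemma normc_Re z : `|Re z| <= normc z.
Proof.
case: z => a b /=; rewrite -sqrtr_sqr ler_wsqrtr // lerDl; exact: sqr_ge0.
Qed.

Lemma normc_Im z : `|Im z| <= normc z.
Proof.
case: z => a b /=; rewrite -sqrtr_sqr ler_wsqrtr // lerDr; exact: sqr_ge0.
Qed.

Lemma normc_i : normc 'i%C = 1 :> R.
Proof. by rewrite /= expr0n /= add0r expr1n sqrtr1. Qed.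

Lemma normc_ReIm z : normc z <= `|Re z| + `|Im z|.
Proof.
rewrite [z in normc z]complexE; apply: le_trans (normcD_le _ _) _.
by rewrite normcM !normc_real normc_i mul1r.
Qed.

Lemma normc_sqr z : normc z ^+ 2 = Re z ^+ 2 + Im z ^+ 2.
Proof. by case: z => a b; rewrite sqr_sqrtr // addr_ge0 ?sqr_ge0. Qed.

Lemma ReD z w : Re (z + w) = Re z + Re w. Proof. by case: z; case: w. Qed.
Lemma ImD z w : Im (z + w) = Im z + Im w. Proof. by case: z; case: w. Qed.
Lemma ReN z : Re (- z) = - Re z. Proof. by case: z. Qed.
Lemma ImN z : Im (- z) = - Im z. Proof. by case: z. Qed.
Lemma Re_realM r z : Re (r%:C * z) = r * Re z.
Proof. by case: z => a b /=; rewrite mul0r subr0. Qed.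
Lemma Im_realM r z : Im (r%:C * z) = r * Im z.
Proof. by case: z => a b /=; rewrite mul0r addr0. Qed.

Lemma eqc0_le z : (forall e, 0 < e -> normc z <= e) -> z = 0.
Proof.
move=> h; apply: eq0_normc; apply/eqP; rewrite eq_le normc_ge0 andbT.
by apply/ler_addgt0Pr => e e0; rewrite add0r; exact: h.
Qed.

Lemma normc_le_eps z r : (forall e, 0 < e -> normc z <= r + e) -> normc z <= r.
Proof. by move=> h; apply/ler_addgt0Pr. Qed.

Lemma nbhs_normcP (z : R[i]) (P : set R[i]) :
  nbhs z P <-> exists2 r : R, 0 < r & forall w, normc (w - z) < r -> P w.
Proof.
split.
  move=> /nbhs_ballP[e /= e0 he]; exists (Re e).
    by move: e0; rewrite ltcE => /andP[].
  move=> w hw; apply: he; rewrite /ball /= normC_normc normcB.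
  move: e0; rewrite ltcE /= => /andP[/eqP ei _].
  by rewrite ltcE /= ei eqxx.
move=> [r r0 h]; apply/nbhs_ballP; exists r%:C => /=; first by rewrite ltcR.
by move=> w; rewrite /ball /= normC_normc ltcR normcB; exact: h.
Qed.

Lemma dnbhs_normcP (z : R[i]) (P : set R[i]) :
  nbhs (z^') P <->
  exists2 r : R, 0 < r & forall w, w != z -> normc (w - z) < r -> P w.
Proof.
have -> : nbhs (z^') P <-> nbhs z [set w | w != z -> P w].
  by rewrite /dnbhs /within.
rewrite nbhs_normcP; split => -[r r0 h]; exists r => // w.
  by move=> h1 h2; exact: h.
by move=> h2 h1; exact: h.
Qed.

Lemma cvg_normcP (T : Type) (F : set_system T) (FF : Filter F) (f : T -> R[i])
    (l : R[i]) :
  f @ F --> l <-> forall e, 0 < e -> \forall x \near F, normc (f x - l) < e.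
Proof.
split.
  move=> h e e0; apply: (h (fun y => normc (y - l) < e)).
  by apply/nbhs_normcP; exists e.
move=> h P /nbhs_normcP[r r0 hr]; rewrite /fmap /=.
by apply: filterS (h r r0) => x; exact: hr.
Qed.

End Modulus.

(** * Derivatives relative to a subset of the plane *)

Section DerivativeWithin.
Context {R : realType}.
Implicit Types (S T : set R[i]) (f g : R[i] -> R[i]) (z w l k : R[i]).

(** The division-free form of the derivative. With S the whole plane it is the complex derivative;
    with S a segment it covers parametrized curves and primitives along segments, so one calculus
    serves all three. *)
Definition dwithin S f z l := forall e : R, 0 < e -> exists2 d : R, 0 < d &
  forall w, S w -> normc (w - z) < d ->
    normc (f w - f z - (w - z) * l) <= e * normc (w - z).

Lemma dwithin_sub S T f z l : S `<=` T -> dwithin T f z l -> dwithin S f z l.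
Proof.
move=> ST h e e0; have [d d0 hd] := h e e0.
by exists d => // w Sw; apply: hd; exact: ST.
Qed.

Lemma dwithin_near S f g z l (r : R) : 0 < r ->
  (forall w, S w -> normc (w - z) < r -> f w = g w) -> f z = g z ->
  dwithin S f z l -> dwithin S g z l.
Proof.
move=> r0 fg fgz h e e0; have [d d0 hd] := h e e0.
exists (Num.min d r); first by rewrite lt_min d0.
by move=> w Sw; rewrite lt_min => /andP[wd wr]; rewrite -fg // -fgz; exact: hd.
Qed.

Lemma dwithin_lip S f z l : dwithin S f z l -> exists2 d : R, 0 < d &
  forall w, S w -> normc (w - z) < d ->
    normc (f w - f z) <= (normc l + 1) * normc (w - z).
Proof.
move=> h; have [d d0 hd] := h 1 ltr01; exists d => // w Sw wd.
have := hd w Sw wd; have := normcD_le (f w - f z - (w - z) * l) ((w - z) * l).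
by rewrite subrK normcM; lra.
Qed.

Lemma dwithin_cont S f z l : dwithin S f z l -> forall e : R, 0 < e ->
  exists2 d : R, 0 < d &
  forall w, S w -> normc (w - z) < d -> normc (f w - f z) < e.
Proof.
move=> /dwithin_lip[d d0 h] e e0.
have l0 : 0 < normc l + 1 by have := normc_ge0 l; lra.
exists (Num.min d (e / (normc l + 1))).
  by rewrite lt_min d0 divr_gt0.
move=> w Sw; rewrite lt_min => /andP[wd we].
apply: le_lt_trans (h w Sw wd) _.
by rewrite mulrC -ltr_pdivlMr.
Qed.

Lemma dwithin_cst S c z : dwithin S (fun=> c) z 0.
Proof.
move=> e e0; exists 1 => // w _ _.
by rewrite subrr mulr0 subr0 normc0 mulr_ge0 // ?normc_ge0 // ltW.
Qed.

Lemma dwithin_id S z : dwithin S (fun w => w) z 1.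
Proof.
move=> e e0; exists 1 => // w _ _.
by rewrite mulr1 subrr normc0 mulr_ge0 // ?normc_ge0 // ltW.
Qed.

Lemma dwithinD S f g z l k : dwithin S f z l -> dwithin S g z k ->
  dwithin S (fun w => f w + g w) z (l + k).
Proof.
move=> hf hg e e0.
have e2 : 0 < e / 2 by lra.
have [d d0 hd] := hf _ e2; have [d' d'0 hd'] := hg _ e2.
exists (Num.min d d'); first by rewrite lt_min d0.
move=> w Sw; rewrite lt_min => /andP[w1 w2].
have := hd w Sw w1; have := hd' w Sw w2.
have -> : f w + g w - (f z + g z) - (w - z) * (l + k) =
  (f w - f z - (w - z) * l) + (g w - g z - (w - z) * k) by ring.
have := normcD_le (f w - f z - (w - z) * l) (g w - g z - (w - z) * k).
lra.
Qed.

Lemma dwithinM S f g z l k : dwithin S f z l -> dwithin S g z k ->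
  dwithin S (fun w => f w * g w) z (l * g z + f z * k).
Proof.
move=> hf hg e e0.
(* [K] adds up the coefficients of the three error terms below, so that at precision [e / K] they
   sum to e; the product of increments is small because |w - z| < e / K. *)
pose K := normc (g z) + normc (f z) + (normc l + 1) * (normc k + 1).
have l1 : 0 < normc l + 1 by have := normc_ge0 l; lra.
have k1 : 0 < normc k + 1 by have := normc_ge0 k; lra.
have K0 : 0 < K.
  have := mulr_gt0 l1 k1; have := normc_ge0 (f z); have := normc_ge0 (g z).
  by rewrite /K; lra.
have e1 : 0 < e / K by rewrite divr_gt0.
have [d1 d10 h1] := hf _ e1; have [d2 d20 h2] := hg _ e1.
have [d3 d30 h3] := dwithin_lip hf; have [d4 d40 h4] := dwithin_lip hg.
exists (Num.min (Num.min d1 d2) (Num.min (Num.min d3 d4) (e / K))).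
  by rewrite !lt_min d10 d20 d30 d40.
move=> w Sw; rewrite !lt_min => /andP[/andP[w1 w2] /andP[/andP[w3 w4] w5]].
have {}h1 := h1 w Sw w1; have {}h2 := h2 w Sw w2.
have {}h3 := h3 w Sw w3; have {}h4 := h4 w Sw w4.
have -> : f w * g w - f z * g z - (w - z) * (l * g z + f z * k) =
  (f w - f z - (w - z) * l) * g z + f z * (g w - g z - (w - z) * k)
  + (f w - f z) * (g w - g z) by ring.
apply: le_trans (normcD_le _ _) _.
apply: le_trans (lerD (normcD_le _ _) (lexx _)) _.
rewrite !normcM; set h := normc (w - z) in h1 h2 h3 h4 w5 *.
have -> : e * h = e / K * h * K by field; rewrite gt_eqF.
have h0 : 0 <= h by exact: normc_ge0.
have -> : e / K * h * K = e / K * h * normc (g z) + normc (f z) * (e / K * h) +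
  (normc l + 1) * h * ((normc k + 1) * (e / K)) by rewrite /K; ring.
apply: lerD; first apply: lerD.
- by apply: ler_wpM2r => //; exact: normc_ge0.
- by apply: ler_wpM2l => //; exact: normc_ge0.
- apply: ler_pM => //; try exact: normc_ge0.
  apply: le_trans h4 _; apply: ler_wpM2l; [exact: ltW|exact: ltW].
Qed.

Lemma dwithin_comp S T f g z l k : dwithin S f z l -> dwithin T g (f z) k ->
  (forall w, S w -> T (f w)) -> dwithin S (fun w => g (f w)) z (k * l).
Proof.
move=> hf hg ST e e0.
have l1 : 0 <= normc l by exact: normc_ge0.
have k1 : 0 <= normc k by exact: normc_ge0.
pose K := normc l + 1 + normc k.
have K0 : 0 < K by rewrite /K; lra.
have e1 : 0 < e / K by rewrite divr_gt0.
have [d1 d10 h1] := hf _ e1; have [d2 d20 h2] := hg _ e1.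
have [d3 d30 h3] := dwithin_lip hf; have [d4 d40 h4] := dwithin_cont hf d20.
exists (Num.min d1 (Num.min d3 d4)); first by rewrite !lt_min d10 d30 d40.
move=> w Sw; rewrite !lt_min => /andP[w1 /andP[w3 w4]].
have {}h1 := h1 w Sw w1; have {}h3 := h3 w Sw w3.
have {}h2 := h2 _ (ST _ Sw) (h4 w Sw w4).
have -> : g (f w) - g (f z) - (w - z) * (k * l) =
  (g (f w) - g (f z) - (f w - f z) * k) + k * (f w - f z - (w - z) * l) by ring.
apply: le_trans (normcD_le _ _) _; rewrite normcM.
have -> : e * normc (w - z) = e / K * ((normc l + 1) * normc (w - z)) +
   normc k * (e / K * normc (w - z)) by rewrite /K; field; rewrite gt_eqF.
apply: lerD; last exact: ler_wpM2l.
by apply: le_trans h2 _; apply: ler_wpM2l => //; exact: ltW.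
Qed.

Lemma dwithin_inv z : z != 0 -> dwithin setT (fun w => w^-1) z (- z^-2).
Proof.
move=> z0 e e0.
have n0 : 0 < normc z by rewrite normc_gt0.
exists (Num.min (normc z / 2) (e * normc z ^+ 3 / 2)).
  by rewrite lt_min !divr_gt0 // mulr_gt0 // exprn_gt0.
move=> w _; rewrite lt_min => /andP[w1 w2].
have w3 : normc z / 2 <= normc w.
  by have := normc_rev z w; rewrite normcB; lra.
have w0 : w != 0 by rewrite -normc_gt0; lra.
have -> : w^-1 - z^-1 - (w - z) * - z^-2 = (w - z) * ((w - z) / (w * z ^+ 2)).
  by field; rewrite w0 z0.
rewrite normcM mulrC; apply: ler_wpM2r; first exact: normc_ge0.
rewrite normc_div normcM normcX ler_pdivrMr; last first.
  by rewrite mulr_gt0 ?exprn_gt0 // normc_gt0.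
apply: le_trans (ltW w2) _.
have -> : e * normc z ^+ 3 / 2 = e * (normc z / 2 * normc z ^+ 2) by field.
apply: ler_wpM2l; first exact: ltW.
by apply: ler_wpM2r => //; rewrite exprn_ge0 // ltW.
Qed.

Lemma dwithinV S f z l : f z != 0 -> dwithin S f z l ->
  dwithin S (fun w => (f w)^-1) z (- (f z)^-2 * l).
Proof.
by move=> fz h; apply: (@dwithin_comp _ setT f (fun w => w^-1) _ _ _ h (dwithin_inv fz)).
Qed.

Lemma dwithinZ S c f z l : dwithin S f z l -> dwithin S (fun w => c * f w) z (c * l).
Proof.
by move=> h; have := dwithinM (dwithin_cst S c z) h; rewrite mul0r add0r.
Qed.

Lemma dwithinN S f z l : dwithin S f z l -> dwithin S (fun w => - f w) z (- l).
Proof.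
move=> h e e0; have [d d0 hd] := h e e0; exists d => // w Sw wd.
have := hd w Sw wd; rewrite -normcN; congr (normc _ <= _); ring.
Qed.

Lemma dwithinB S f g z l k : dwithin S f z l -> dwithin S g z k ->
  dwithin S (fun w => f w - g w) z (l - k).
Proof. by move=> hf hg; apply: dwithinD => //; exact: dwithinN. Qed.

Lemma dwithin_subc S c z : dwithin S (fun w => w - c) z 1.
Proof. by rewrite -[1]subr0; apply: dwithinB; [exact: dwithin_id|exact: dwithin_cst]. Qed.

Lemma dwithin_invB S c z : z - c != 0 ->
  dwithin S (fun w => (w - c)^-1) z (- (z - c)^-2).
Proof.
by move=> zc; rewrite -[X in dwithin _ _ _ X]mulr1; apply: (@dwithinV S (fun w => w - c)) => //; exact: dwithin_subc.
Qed.

Lemma dwithinX S f z l n : dwithin S f z l ->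
  dwithin S (fun w => f w ^+ n) z (n%:R * f z ^+ n.-1 * l).
Proof.
move=> h; elim: n => [|n IH].
  by rewrite !mul0r; exact: dwithin_cst.
have := dwithinM h IH.
rewrite [X in dwithin _ X](_ : _ = fun w => f w ^+ n.+1); last first.
  by apply: funext => w; rewrite exprS.
congr (dwithin _ _ _ _).
case: n {IH} => [|n] /=; first by rewrite !expr0; ring.
by rewrite [f z ^+ n.+1]exprS -!(natr1 n.+1); ring.
Qed.

Lemma dwithin_derive f z l : dwithin setT f z l ->
  derivable f z 1 /\ derive1 f z = l.
Proof.
move=> h.
have cv : h^-1 *: (f (h + z) - f z) @[h --> (0:R[i])^'] --> l.
  apply/cvg_normcP => e e0.
  have e2 : 0 < e / 2 by lra.
  have [d d0 hd] := h _ e2.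
  apply/dnbhs_normcP; exists d => // y y0; rewrite subr0 => yd.
  have := hd (y + z) I; rewrite addrK => /(_ yd) hy.
  have y1 : 0 < normc y by rewrite normc_gt0.
  have -> : y^-1 *: (f (y + z) - f z) - l = (f (y + z) - f z - y * l) / y.
    by rewrite -[_ *: _]/(_ * _); field.
  rewrite normc_div ltr_pdivrMr //.
  apply: le_lt_trans hy _; rewrite ltr_pM2r //; lra.
split.
  rewrite /derivable; apply/cvg_ex; exists l.
  rewrite (_ : (fun h => _) = (fun h => h^-1 *: (f (h + z) - f z))) //.
  by apply: funext => y /=; rewrite -[y *: 1]/(y * 1) mulr1.
exact: cvg_lim cv.
Qed.

Lemma derive_dwithin f z : derivable f z 1 -> dwithin setT f z (derive1 f z).
Proof.
move=> df e e0.
have : h^-1 *: (f (h + z) - f z) @[h --> (0:R[i])^'] --> derive1 f z.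
  rewrite derive1E; have := df; rewrite /derivable /derive.
  rewrite (_ : (fun h => _) = (fun h => h^-1 *: (f (h + z) - f z))) //.
  by apply: funext => y /=; rewrite -[y *: 1]/(y * 1) mulr1.
move=> /cvg_normcP/(_ e e0)/dnbhs_normcP[d d0 hd].
exists d => // w _ wd.
have [->|wz] := eqVneq w z; first by rewrite !subrr mul0r subr0 normc0 mulr0.
have wz0 : w - z != 0 by rewrite subr_eq0.
have := hd (w - z) wz0; rewrite subr0 subrK => /(_ wd).
have -> : (w - z)^-1 *: (f w - f z) - derive1 f z =
  (f w - f z - (w - z) * derive1 f z) / (w - z).
  by rewrite -[_ *: _]/(_ * _); field.
by rewrite normc_div ltr_pdivrMr ?normc_gt0 // => /ltW.
Qed.

End DerivativeWithin.

(** * Completeness and bisection *)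

Section Completeness.
Context {R : realType}.

(** The intervals of centre x n and radius 2 D / 2^n meet pairwise, so the supremum of their left
    ends lies in all of them. *)
Lemma real_geom_cvg (x : nat -> R) (D : R) :
  (forall n, `|x n.+1 - x n| <= D / 2 ^+ n) ->
  exists l, forall n, `|l - x n| <= 2 * D / 2 ^+ n.
Proof.
move=> hx.
have D0 : 0 <= D by have := hx 0%N; rewrite expr0 divr1; apply: le_trans.
have p2 n : 0 < (2:R) ^+ n by rewrite exprn_gt0.
have step n k : x (n + k)%N <= x n + 2 * D / 2 ^+ n - 2 * D / 2 ^+ (n + k)
    /\ x n - 2 * D / 2 ^+ n + 2 * D / 2 ^+ (n + k) <= x (n + k)%N.
  elim: k => [|k [IH1 IH2]]; first by rewrite addn0; split; lra.
  have := hx (n + k)%N; rewrite addnS ler_norml => /andP[h1 h2].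
  have -> : 2 * D / 2 ^+ (n + k).+1 = D / 2 ^+ (n + k).
    by rewrite exprS; field; rewrite gt_eqF.
  have : 2 * D / 2 ^+ (n + k) = D / 2 ^+ (n + k) + D / 2 ^+ (n + k) by field; rewrite gt_eqF.
  by move=> E; rewrite E in IH1 IH2; split; lra.
have pos n : 0 <= 2 * D / 2 ^+ n by rewrite divr_ge0 // ?mulr_ge0 // ltW.
have cross m n : x n - 2 * D / 2 ^+ n <= x m + 2 * D / 2 ^+ m.
  have [mn|/ltnW nm] := leqP m n.
    have [h _] := step m (n - m)%N; rewrite subnKC // in h.
    have := pos n; have := pos m; lra.
  have [_ h] := step n (m - n)%N; rewrite subnKC // in h.
  have := pos n; have := pos m; lra.
pose A := [set x n - 2 * D / 2 ^+ n | n in setT].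
have hA : has_sup A.
  split; first by exists (x 0%N - 2 * D / 2 ^+ 0), 0%N.
  by exists (x 0%N + 2 * D / 2 ^+ 0) => _ [n _ <-]; exact: cross.
exists (sup A) => n; rewrite ler_norml; apply/andP; split.
  have : x n - 2 * D / 2 ^+ n <= sup A by apply: sup_upper_bound => //; exists n.
  lra.
have : sup A <= x n + 2 * D / 2 ^+ n.
  by apply: ge_sup => //; [exact: hA.1|move=> _ [k _ <-]; exact: cross].
lra.
Qed.

Lemma geom_cvg (x : nat -> R[i]) (D : R) :
  (forall n, normc (x n.+1 - x n) <= D / 2 ^+ n) ->
  exists l, forall n, normc (l - x n) <= 4 * D / 2 ^+ n.
Proof.
move=> hx.
have [|a ha] := @real_geom_cvg (fun n => Re (x n)) D.
  by move=> n; apply: le_trans (hx n); rewrite -ReN -ReD; exact: normc_Re.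
have [|b hb] := @real_geom_cvg (fun n => Im (x n)) D.
  by move=> n; apply: le_trans (hx n); rewrite -ImN -ImD; exact: normc_Im.
exists (a +i* b) => n; apply: le_trans (normc_ReIm _) _.
rewrite ReD ImD ReN ImN /=.
have -> : 4 * D / 2 ^+ n = 2 * D / 2 ^+ n + 2 * D / 2 ^+ n.
  by ring.
exact: lerD.
Qed.

Lemma half_lt (D e : R) : 0 < e -> exists n, D / 2 ^+ n < e.
Proof.
move=> e0; pose n := Num.bound `|D / e|.
have h : D / e < n%:R by apply: le_lt_trans (ler_norm _) (archi_boundP (normr_ge0 _)).
exists n; rewrite ltr_pdivrMr ?exprn_gt0 // mulrC -ltr_pdivrMr //.
apply: lt_le_trans h _; elim: (n) => [|k IH]; first by rewrite ler01.
rewrite exprS -natr1; have : 1 <= (2:R) ^+ k by apply: exprn_ege1; lra.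
lra.
Qed.

(** The form in which compactness of [0, 1] is used. If the additive property Q failed on [0, 1],
    bisection would give intervals where it fails, shrinking to a point x, against the local
    hypothesis at x. *)
Lemma cousin (Q : R -> R -> Prop) :
  (forall s m t, s <= m -> m <= t -> Q s m -> Q m t -> Q s t) ->
  (forall x, 0 <= x <= 1 -> exists2 d : R, 0 < d & forall s t,
     0 <= s -> t <= 1 -> s <= x -> x <= t -> t - s < d -> Q s t) ->
  Q 0 1.
Proof.
move=> hadd hloc; apply: contrapT => nQ.
(* The failing interval moves to its right half exactly when the left half is good. *)
pose nxt n (s : R) := if pselect (Q s (s + (2 ^+ n.+1)^-1)) then
   s + (2 ^+ n.+1)^-1 else s.
pose x := fix x n := if n is m.+1 then nxt m (x m) else 0.
have p2 n : 0 < ((2:R) ^+ n)^-1 by rewrite invr_gt0 exprn_gt0.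
have hh n : ((2:R) ^+ n)^-1 = (2 ^+ n.+1)^-1 + (2 ^+ n.+1)^-1.
  by rewrite exprS; field; rewrite expf_neq0 // pnatr_eq0.
have inv n : [/\ 0 <= x n, x n + (2 ^+ n)^-1 <= 1 & ~ Q (x n) (x n + (2 ^+ n)^-1)].
  elim: n => [|n [h1 h2 h3]]; first by rewrite /= expr0 invr1 add0r.
  have := p2 n.+1; have := hh n.
  rewrite /= /nxt; case: pselect => [q|q] /= E p; split => //; try lra.
  move=> q'; apply: h3; apply: hadd q _; try lra.
  by rewrite E addrA.
have [|l hl] := @real_geom_cvg x 1.
  move=> n; have := p2 n; have := p2 n.+1; have := hh n.
  rewrite /= /nxt; case: pselect => _ /= E p1 p0; rewrite ?subrr ?normr0.
    by rewrite addrAC subrr add0r gtr0_norm; lra.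
  by lra.
have mon n k : x n <= x (n + k)%N /\ x (n + k)%N <= x n + (2 ^+ n)^-1 - (2 ^+ (n + k))^-1.
  elim: k => [|k [I1 I2]]; first by rewrite addn0; split; lra.
  have := p2 (n + k).+1; have := hh (n + k)%N.
  by rewrite addnS /= /nxt; case: pselect => _ /= E p1; split; lra.
have lx n : x n <= l <= x n + (2 ^+ n)^-1.
  apply/andP; split; apply/ler_addgt0Pr => e e0;
    have [k] := half_lt (2 * 1) e0.
    have [m1 m2] := mon n k; move=> hk.
    have := hl (n + k)%N; rewrite ler_norml => /andP[].
    have : 2 * 1 / (2:R) ^+ (n + k) <= 2 * 1 / 2 ^+ k.
      by rewrite ler_pM2l ?mulr_gt0 // lef_pV2 ?posrE ?exprn_gt0 // ler_weXn2l ?ler1n // leq_addl.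
    lra.
  have [m1 m2] := mon n k; move=> hk.
  have := hl (n + k)%N; rewrite ler_norml => /andP[].
  have : 2 * 1 / (2:R) ^+ (n + k) <= 2 * 1 / 2 ^+ k.
    by rewrite ler_pM2l ?mulr_gt0 // lef_pV2 ?posrE ?exprn_gt0 // ler_weXn2l ?ler1n // leq_addl.
  have := p2 (n + k)%N; lra.
have l01 : 0 <= l <= 1.
  by have := lx 0%N; rewrite /= expr0 invr1 add0r.
have [d d0 hd] := hloc l l01.
have [n hn] := half_lt 1 d0; rewrite div1r in hn.
have [i1 i2 i3] := inv n; apply: i3; have /andP[? ?] := lx n.
by apply: hd => //; rewrite addrAC subrr add0r.
Qed.

End Completeness.

(** * Mean value inequality along segments *)

Section MeanValue.
Context {R : realType}.
Implicit Types (a b z w : R[i]) (f g : R[i] -> R[i]).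

Definition seg a b : set R[i] :=
  [set w | exists2 t : R, 0 <= t <= 1 & w = a + t%:C * (b - a)].

Lemma seg_l a b : seg a b a.
Proof. by exists 0; rewrite ?lexx ?ler01 // rmorph0 mul0r addr0. Qed.

Lemma seg_r a b : seg a b b.
Proof. by exists 1; rewrite ?lexx ?ler01 // rmorph1 mul1r addrC subrK. Qed.

Lemma segC a b : seg a b = seg b a.
Proof.
suff h x y : seg x y `<=` seg y x by apply/seteqP; split.
move=> _ [t /andP[t0 t1] ->]; exists (1 - t); first by lra.
by rewrite rmorphB rmorph1; ring.
Qed.

Lemma seg_sub a b c d : seg a b c -> seg a b d -> seg c d `<=` seg a b.
Proof.
move=> [s /andP[s0 s1] ->] [t /andP[t0 t1] ->] _ [u /andP[u0 u1] ->].
exists (s + u * (t - s)).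
  apply/andP; split; last first.
    have : 0 <= (1 - u) * (1 - s) by apply: mulr_ge0; lra.
    have : 0 <= u * (1 - t) by apply: mulr_ge0; lra.
    lra.
  have : 0 <= (1 - u) * s by apply: mulr_ge0; lra.
  have : 0 <= u * t by apply: mulr_ge0; lra.
  lra.
by rewrite rmorphD rmorphM rmorphB; ring.
Qed.

Lemma seg_ball a b c (r : R) w : normc (a - c) <= r -> normc (b - c) <= r ->
  seg a b w -> normc (w - c) <= r.
Proof.
move=> ha hb [t /andP[t0 t1] ->].
have -> : a + t%:C * (b - a) - c = (1 - t)%:C * (a - c) + t%:C * (b - c).
  by rewrite rmorphB rmorph1; ring.
apply: le_trans (normcD_le _ _) _; rewrite !normcM !normc_real.
rewrite !ger0_norm; try lra.
have : (1 - t) * normc (a - c) <= (1 - t) * r by apply: ler_wpM2l => //; lra.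
have : t * normc (b - c) <= t * r by apply: ler_wpM2l.
lra.
Qed.

(** The inequality with slope M + e1 is additive in the interval, so [cousin] propagates it. Locally
    both ends are compared with x; as x lies between them, the two errors add up to e1 times the
    length. *)
Lemma mvi a b f g (M : R) :
  (forall w, seg a b w -> dwithin (seg a b) f w (g w)) ->
  (forall w, seg a b w -> normc (g w) <= M) ->
  normc (f b - f a) <= M * normc (b - a).
Proof.
move=> hf hM.
have [->|ab] := eqVneq a b; first by rewrite !subrr normc0 mulr0.
have n0 : 0 < normc (b - a) by rewrite normc_gt0 subr_eq0 eq_sym.
apply: normc_le_eps => e e0.
pose p (t : R) := a + t%:C * (b - a).
pose e1 := e / normc (b - a).
have e10 : 0 < e1 by rewrite divr_gt0.
have pd s t : p t - p s = (t - s)%:C * (b - a) by rewrite /p rmorphB; ring.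
have pn s t : normc (p t - p s) = `|t - s| * normc (b - a).
  by rewrite pd normcM normc_real.
pose Q s t := normc (f (p t) - f (p s)) <= (M + e1) * ((t - s) * normc (b - a)).
suff : Q 0 1.
  rewrite /Q /p rmorph0 mul0r addr0 rmorph1 mul1r [a + _]addrC subrK subr0 mul1r.
  by congr (_ <= _); rewrite /e1; field; rewrite gt_eqF.
apply: (@cousin _ Q).
  move=> s m t sm mt; rewrite /Q => h1 h2.
  have := normc_dist (f (p t)) (f (p m)) (f (p s)); lra.
move=> x x01; have px : seg a b (p x) by exists x.
have [d d0 hd] := hf _ px e1 e10.
exists (d / normc (b - a)); first by rewrite divr_gt0.
move=> s t s0 t1 sx xt ts; rewrite ltr_pdivlMr // in ts.
have B y : 0 <= y <= 1 -> s <= y <= t ->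
    normc (f (p y) - f (p x) - (p y - p x) * g (p x)) <= e1 * normc (p y - p x).
  move=> y01 /andP[sy yt]; apply: hd; first by exists y.
  rewrite pn; apply: le_lt_trans ts; rewrite ler_pM2r //.
  by rewrite ler_norml; apply/andP; split; lra.
have /andP[x0 x1] := x01.
have h1 : normc (f (p s) - f (p x) - (p s - p x) * g (p x)) <= e1 * normc (p s - p x).
  by apply: B; apply/andP; split; lra.
have h2 : normc (f (p t) - f (p x) - (p t - p x) * g (p x)) <= e1 * normc (p t - p x).
  by apply: B; apply/andP; split; lra.
rewrite /Q.
have -> : f (p t) - f (p s) = (f (p t) - f (p x) - (p t - p x) * g (p x))
  - (f (p s) - f (p x) - (p s - p x) * g (p x)) + (p t - p s) * g (p x) by ring.
apply: le_trans (normcD_le _ _) _.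
apply: le_trans (lerD (normcB_le _ _) (lexx _)) _.
rewrite !pn in h1 h2; rewrite normcM pn.
have -> : `|t - s| = t - s by rewrite ger0_norm // subr_ge0; lra.
rewrite (ger0_norm (_ : 0 <= t - x)) in h2; last by lra.
rewrite (ler0_norm (_ : s - x <= 0)) in h1; last by lra.
have : (t - s) * normc (b - a) * normc (g (p x)) <= (t - s) * normc (b - a) * M.
  apply: ler_wpM2l; last exact: hM.
  by apply: mulr_ge0; lra.
lra.
Qed.

Lemma dwithin_eq0_cst a b f : (forall w, seg a b w -> dwithin (seg a b) f w 0) ->
  f b = f a.
Proof.
move=> h; apply/eqP; rewrite -subr_eq0; apply/eqP; apply: eq0_normc.
apply/eqP; rewrite eq_le normc_ge0 andbT.
have := @mvi a b f (fun=> 0) 0 h; rewrite mul0r; apply => w _.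
by rewrite normc0.
Qed.

End MeanValue.

(** * Primitives of continuous real functions *)

Section RealPrimitive.
Context {R : realType}.

Definition rcont (p : R -> R) := forall x e, 0 < e -> exists2 d : R, 0 < d &
  forall y, `|y - x| < d -> `|p y - p x| < e.

Lemma real_derive_eps (P : R -> R) (x l : R) :
  derivable P x 1 -> derive1 P x = l -> forall e, 0 < e ->
  exists2 d : R, 0 < d &
  forall y, `|y - x| < d -> `|P y - P x - (y - x) * l| <= e * `|y - x|.
Proof.
move=> dP PE e e0.
have : h^-1 *: (P (h + x) - P x) @[h --> (0:R)^'] --> l.
  rewrite -PE derive1E; have := dP; rewrite /derivable /derive.
  rewrite (_ : (fun h => _) = (fun h => h^-1 *: (P (h + x) - P x))) //.
  by apply: funext => y /=; rewrite -[y *: 1]/(y * 1) mulr1.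
move=> /cvgrPdist_lt/(_ e e0)/nbhs_ballP[d /= d0 hd].
exists d => // y yd.
have [->|yx] := eqVneq y x; first by rewrite !subrr mul0r subr0 normr0 mulr0.
have yx0 : y - x != 0 by rewrite subr_eq0.
have := hd (y - x); rewrite /ball /= sub0r normrN => /(_ yd yx0).
rewrite subrK -[_ *: _]/(_ * _).
have -> : l - (y - x)^-1 * (P y - P x) =
  - ((P y - P x - (y - x) * l) / (y - x)) by field.
by rewrite normrN normf_div ltr_pdivrMr ?normr_gt0 // => /ltW.
Qed.

(** The Lebesgue integral enters only here; afterwards integrals are increments of primitives.
    Integrating from -1, with integrability up to 3, keeps [0, 1] in the interior, so that the
    derivative is two-sided at 0 and 1. *)
Lemma real_primitive (p : R -> R) : rcont p -> exists P : R -> R,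
  forall x, 0 <= x <= 1 -> forall e, 0 < e -> exists2 d : R, 0 < d &
  forall y, `|y - x| < d -> `|P y - P x - (y - x) * p x| <= e * `|y - x|.
Proof.
move=> hp.
have cp : continuous p.
  move=> x; apply/cvgrPdist_lt => e e0; have [d d0 hd] := hp x e e0.
  apply/nbhs_ballP; exists d => //= y; rewrite /ball /= distrC => /hd.
  by rewrite distrC.
pose P (y : R) := (\int[@lebesgue_measure R]_(t in [set` `[(-1 : R), y]%R]) p t)%R.
exists P => x /andP[x0 x1] e e0.
have x3 : (x < 3)%R by lra.
have xN : (-1 < x)%R by lra.
have ip : (@lebesgue_measure R).-integrable `[(-1 : R), 3] (EFin \o p).
  apply: continuous_compact_integrable; first exact: segment_compact.
  exact: continuous_subspaceT.
have [dP PE] := continuous_FTC1_closed x3 ip xN (cp x).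
exact: real_derive_eps dP PE e e0.
Qed.

End RealPrimitive.

(** * Integrals along segments *)

Section SegmentIntegral.
Context {R : realType}.
Implicit Types (a b c z w : R[i]) (f g h : R[i] -> R[i]).

Definition scont (S : set R[i]) f := forall w, S w -> forall e : R, 0 < e ->
  exists2 d : R, 0 < d & forall y, S y -> normc (y - w) < d ->
  normc (f y - f w) < e.

Definition sprim a b f (G : R[i] -> R[i]) :=
  forall w, seg a b w -> dwithin (seg a b) G w (f w).

(** The increment of any primitive along the segment, well defined because primitives differ by a
    constant there. The default 0 occurs only if no primitive exists, which continuity rules out;
    linearity, splitting and reversal then follow from uniqueness. *)
Definition sint f a b : R[i] :=
  xget 0 [set v | exists2 G, sprim a b f G & v = G b - G a].

Lemma sintE f a b G : sprim a b f G -> sint f a b = G b - G a.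
Proof.
move=> hG; rewrite /sint; case: xgetP => [v _ [G' hG' ->]|/(_ (G b - G a))]; last first.
  by case; exists G.
have := @dwithin_eq0_cst R a b (fun w => G' w - G w).
have H w : seg a b w -> dwithin (seg a b) (fun w => G' w - G w) w 0.
  by move=> hw; rewrite -(subrr (f w)); apply: dwithinB; [exact: hG'|exact: hG].
move=> /(_ H) E.
have -> : G' b - G' a = (G' b - G b) - (G' a - G a) + (G b - G a) by ring.
by rewrite E subrr add0r.
Qed.

Lemma sprim_ex a b f : scont (seg a b) f -> exists G, sprim a b f G.
Proof.
move=> cf; have [<-|ab] := eqVneq a b.
  exists (fun=> 0) => w [s _ ->] e e0; exists 1 => // y [t _ ->] _.
  by rewrite !subrr !mulr0 !addr0 !subrr mul0r subr0 normc0 mulr0.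
have ba : b - a != 0 by rewrite subr_eq0 eq_sym.
have n0 : 0 < normc (b - a) by rewrite normc_gt0.
(* Clamping the parameter extends the integrand to a continuous function on the whole line, as
   [real_primitive] requires. *)
pose cl (t : R) := Num.max 0 (Num.min t 1).
have cl01 t : 0 <= cl t <= 1.
  rewrite /cl le_max lexx /= ge_max ler01 ge_min lexx orbT //.
have clE t : 0 <= t <= 1 -> cl t = t.
  by move=> /andP[h0 h1]; rewrite /cl min_l // max_r.
have cllip s t : `|cl s - cl t| <= `|s - t|.
  rewrite /cl !maxEle !minEle; 
  case: (leP s 1) => ?; case: (leP t 1) => ?; rewrite ?ler01;
  case: (leP 0 s) => ?; case: (leP 0 t) => ?;
  rewrite ler_norml; apply/andP; split;
  have := ler_norm (s - t); have := ler_norm (- (s - t)); rewrite normrN; lra.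
pose q (t : R) := a + t%:C * (b - a).
have qn s t : normc (q s - q t) = `|s - t| * normc (b - a).
  rewrite (_ : q s - q t = (s - t)%:C * (b - a)) ?normcM ?normc_real //.
  by rewrite /q rmorphB; ring.
have kc x e : 0 < e -> exists2 d : R, 0 < d & forall y, `|y - x| < d ->
    normc (f (q (cl y)) - f (q (cl x))) < e.
  move=> e0; have sx : seg a b (q (cl x)) by exists (cl x).
  have [d d0 hd] := cf _ sx e e0.
  exists (d / normc (b - a)); first by rewrite divr_gt0.
  move=> y; rewrite ltr_pdivlMr // => hy; apply: hd; first by exists (cl y).
  rewrite qn; apply: le_lt_trans hy; apply: ler_wpM2r => //; exact: ltW.
have [|P1 h1] := @real_primitive R (fun t => Re (f (q (cl t)))).
  move=> x e e0; have [d d0 hd] := kc x e e0; exists d => // y yd.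
  apply: le_lt_trans (hd y yd); rewrite -ReN -ReD; exact: normc_Re.
have [|P2 h2] := @real_primitive R (fun t => Im (f (q (cl t)))).
  move=> x e e0; have [d d0 hd] := kc x e e0; exists d => // y yd.
  apply: le_lt_trans (hd y yd); rewrite -ImN -ImD; exact: normc_Im.
(* [ta] recovers the parameter of a point of the segment, so that the primitive becomes a function
   of the point. *)
pose ta w := Re ((w - a) / (b - a)).
have taE t : ta (q t) = t.
  by rewrite /ta /q addrAC subrr add0r mulfK.
exists (fun w => (b - a) * (P1 (ta w) +i* P2 (ta w))) => w [s s01 ->].
rewrite -/(q s) => e e0.
have e2 : 0 < e / 2 by lra.
have [d1 d10 hd1] := h1 s s01 _ e2; have [d2 d20 hd2] := h2 s s01 _ e2.
exists (Num.min d1 d2 * normc (b - a)); first by rewrite mulr_gt0 // lt_min d10.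
move=> y [t t01 ->]; rewrite -/(q t) qn ltr_pM2r // lt_min => /andP[w1 w2].
have {}hd1 := hd1 t w1; have {}hd2 := hd2 t w2; rewrite clE // in hd1 hd2.
rewrite !taE.
have -> : (b - a) * (P1 t +i* P2 t) - (b - a) * (P1 s +i* P2 s)
   - (q t - q s) * f (q s) =
   (b - a) * ((P1 t +i* P2 t) - (P1 s +i* P2 s) - (t - s)%:C * f (q s)).
  by rewrite /q rmorphB; ring.
rewrite normcM [e * _]mulrA [_ * normc (b - a)]mulrC.
apply: ler_wpM2l; first exact: ltW.
apply: le_trans (normc_ReIm _) _.
rewrite !ReD !ImD !ReN !ImN. rewrite Re_realM Im_realM /=.
have -> : e * `|t - s| = e / 2 * `|t - s| + e / 2 * `|t - s| by field.
exact: lerD.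
Qed.

Lemma sprim_sub a b c d f G : seg a b c -> seg a b d ->
  sprim a b f G -> sprim c d f G.
Proof.
move=> hc hd h w hw; have s := seg_sub hc hd.
by apply: (dwithin_sub s); apply: h; exact: s.
Qed.

Lemma sprimC a b f G : sprim a b f G -> sprim b a f G.
Proof. by rewrite /sprim segC. Qed.

Lemma sintC a b f : scont (seg a b) f -> sint f b a = - sint f a b.
Proof.
move=> /sprim_ex[G hG]; rewrite (sintE hG) (sintE (sprimC hG)); ring.
Qed.

Lemma sint_split a b c f : scont (seg a b) f -> seg a b c ->
  sint f a b = sint f a c + sint f c b.
Proof.
move=> /sprim_ex[G hG] hc; rewrite (sintE hG).
rewrite (sintE (sprim_sub (seg_l a b) hc hG)) (sintE (sprim_sub hc (seg_r a b) hG)).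
ring.
Qed.

Lemma sint_bound a b f (M : R) : scont (seg a b) f ->
  (forall w, seg a b w -> normc (f w) <= M) ->
  normc (sint f a b) <= M * normc (b - a).
Proof. by move=> /sprim_ex[G hG] hM; rewrite (sintE hG); exact: mvi hG hM. Qed.

Lemma sprimB a b f g F G : sprim a b f F -> sprim a b g G ->
  sprim a b (fun w => f w - g w) (fun w => F w - G w).
Proof. by move=> hF hG w hw; apply: dwithinB; [exact: hF|exact: hG]. Qed.

Lemma sintB a b f g : scont (seg a b) f -> scont (seg a b) g ->
  sint (fun w => f w - g w) a b = sint f a b - sint g a b.
Proof.
move=> /sprim_ex[F hF] /sprim_ex[G hG].
rewrite (sintE hF) (sintE hG) (sintE (sprimB hF hG)); ring.
Qed.

Lemma sintZ a b k f : scont (seg a b) f ->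
  sint (fun w => k * f w) a b = k * sint f a b.
Proof.
move=> /sprim_ex[F hF].
rewrite (sintE hF) (@sintE _ _ _ (fun w => k * F w)); first ring.
by move=> w hw; apply: dwithinZ; exact: hF.
Qed.

Lemma scont_sub (S T : set R[i]) f : S `<=` T -> scont T f -> scont S f.
Proof.
move=> ST h w /ST Tw e e0; have [d d0 hd] := h w Tw e e0.
by exists d => // y /ST Ty; exact: hd.
Qed.

Lemma scont_derivable (S : set R[i]) f : (forall w, S w -> derivable f w 1) ->
  scont S f.
Proof.
move=> h w /h/derive_dwithin hw e e0; have [d d0 hd] := dwithin_cont hw e0.
by exists d => // y _; exact: hd.
Qed.

Lemma scontB (S : set R[i]) f g : scont S f -> scont S g ->
  scont S (fun w => f w - g w).
Proof.
move=> hf hg w Sw e e0; have e2 : 0 < e / 2 by lra.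
have [d d0 hd] := hf w Sw _ e2; have [d' d'0 hd'] := hg w Sw _ e2.
exists (Num.min d d'); first by rewrite lt_min d0.
move=> y Sy; rewrite lt_min => /andP[y1 y2].
have -> : f y - g y - (f w - g w) = (f y - f w) - (g y - g w) by ring.
have := hd y Sy y1; have := hd' y Sy y2.
have := normcB_le (f y - f w) (g y - g w); lra.
Qed.

Lemma scont_cst (S : set R[i]) k : scont S (fun=> k).
Proof. by move=> w _ e e0; exists 1 => // y _ _; rewrite subrr normc0. Qed.

Lemma scontM (S : set R[i]) f g : scont S f -> scont S g ->
  scont S (fun w => f w * g w).
Proof.
move=> hf hg w Sw e e0.
pose K := normc (f w) + normc (g w) + 1.
have f0 := normc_ge0 (f w); have g0 := normc_ge0 (g w).
have K0 : 0 < K by rewrite /K; lra.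
pose e1 := Num.min 1 (e / K / 2).
have e10 : 0 < e1 by rewrite lt_min ltr01 !divr_gt0.
have e11 : e1 <= 1 by rewrite ge_min lexx.
have e12 : e1 * K < e.
  apply: (@le_lt_trans _ _ (e / K / 2 * K)).
    by apply: ler_wpM2r; [exact: ltW|rewrite ge_min lexx orbT].
  by rewrite mulrAC divfK ?gt_eqF //; lra.
have [d d0 hd] := hf w Sw _ e10; have [d' d'0 hd'] := hg w Sw _ e10.
exists (Num.min d d'); first by rewrite lt_min d0.
move=> y Sy; rewrite lt_min => /andP[y1 y2].
have {}hd := hd y Sy y1; have {}hd' := hd' y Sy y2.
have -> : f y * g y - f w * g w = (f y - f w) * (g y - g w) + f w * (g y - g w)
  + (f y - f w) * g w by ring.
apply: le_lt_trans (normcD_le _ _) _.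
apply: le_lt_trans (lerD (normcD_le _ _) (lexx _)) _.
rewrite !normcM; apply: le_lt_trans e12.
have -> : e1 * K = e1 * 1 + normc (f w) * e1 + e1 * normc (g w) by rewrite /K; ring.
apply: lerD; first apply: lerD.
- by apply: ler_pM; rewrite ?normc_ge0 //; lra.
- by apply: ler_wpM2l => //; exact: ltW.
- by apply: ler_wpM2r => //; exact: ltW.
Qed.

End SegmentIntegral.

(** * Integrals over triangles *)

Section Goursat.
Context {R : realType}.
Implicit Types (a b c z w : R[i]) (f g h : R[i] -> R[i]).

Definition cball c (r : R) : set R[i] := [set w | normc (w - c) < r].

Lemma seg_cball a b c (r : R) : cball c r a -> cball c r b -> seg a b `<=` cball c r.
Proof.
move=> ha hb w hw; rewrite /cball /=.
apply: (@le_lt_trans _ _ (Num.max (normc (a - c)) (normc (b - c)))).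
  by apply: (seg_ball _ _ hw); rewrite le_max lexx ?orbT.
by rewrite gt_max ha.
Qed.

Definition tri f a b c := sint f a b + sint f b c + sint f c a.

Definition midpt a b := a + (b - a) / 2.

Lemma midpt_seg a b : seg a b (midpt a b).
Proof.
exists 2^-1; first lra.
by rewrite fmorphV rmorph_nat /midpt mulrC.
Qed.

Lemma tri_split f x r a b c : scont (cball x r) f ->
  cball x r a -> cball x r b -> cball x r c ->
  tri f a b c = tri f a (midpt a b) (midpt c a) + tri f (midpt a b) b (midpt b c)
    + tri f (midpt c a) (midpt b c) c + tri f (midpt a b) (midpt b c) (midpt c a).
Proof.
move=> cf ha hb hc.
have sc u v : cball x r u -> cball x r v -> scont (seg u v) f.
  by move=> hu hv; apply: scont_sub cf; exact: seg_cball.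
have m1 : cball x r (midpt a b) by apply: (seg_cball ha hb); exact: midpt_seg.
have m2 : cball x r (midpt b c) by apply: (seg_cball hb hc); exact: midpt_seg.
have m3 : cball x r (midpt c a) by apply: (seg_cball hc ha); exact: midpt_seg.
rewrite /tri (sint_split (sc a b ha hb) (midpt_seg a b)).
rewrite (sint_split (sc b c hb hc) (midpt_seg b c)).
rewrite (sint_split (sc c a hc ha) (midpt_seg c a)).
rewrite (sintC (sc _ _ m1 m3)) (sintC (sc _ _ m1 m2)) -(sintC (sc _ _ m1 m2)).
rewrite (sintC (sc _ _ m3 m2)) (sintC (sc _ _ m1 m2)).
ring.
Qed.

End Goursat.

(** * Goursat's theorem and primitives on discs *)

Section GoursatTheorem.
Context {R : realType}.
Implicit Types (a b c x z w u v l : R[i]) (f g h : R[i] -> R[i]).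

Definition perim a b c : R := normc (b - a) + normc (c - b) + normc (a - c).

(** The bound on the displacement of the first vertex makes these vertices a geometric Cauchy
    sequence; its limit plays the part of the common point of the nested triangles. *)
Definition tri_step f x r (T T' : R[i] * R[i] * R[i]) :=
  let: (a, b, c) := T in let: (a', b', c') := T' in
  [/\ [/\ cball x r a', cball x r b' & cball x r c'],
      perim a' b' c' = perim a b c / 2,
      normc (a' - a) <= perim a b c / 2 &
      normc (tri f a b c) / 4 <= normc (tri f a' b' c')].

Lemma tri_step_ex f x r a b c : scont (cball x r) f ->
  cball x r a -> cball x r b -> cball x r c ->
  exists T, tri_step f x r (a, b, c) T.
Proof.
move=> cf ha hb hc.
have m1 : cball x r (midpt a b) by apply: (seg_cball ha hb); exact: midpt_seg.
have m2 : cball x r (midpt b c) by apply: (seg_cball hb hc); exact: midpt_seg.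
have m3 : cball x r (midpt c a) by apply: (seg_cball hc ha); exact: midpt_seg.
have n2 z : normc (z / 2) = normc z / 2 by rewrite normc_div normc_nat.
have S := tri_split cf ha hb hc.
have := normc_ge0 (b - a); have := normc_ge0 (c - b); have := normc_ge0 (a - c).
move=> p1 p2 p3.
have E1 : midpt a b - a = (b - a) / 2 by rewrite /midpt; ring.
have E2 : midpt c a - midpt a b = (c - b) / 2 by rewrite /midpt; field.
have E3 : a - midpt c a = (a - c) / 2 by rewrite /midpt; field.
have E4 : b - midpt a b = (b - a) / 2 by rewrite /midpt; field.
have E5 : midpt b c - b = (c - b) / 2 by rewrite /midpt; field.
have E6 : midpt a b - midpt b c = (a - c) / 2 by rewrite /midpt; field.
have E7 : midpt b c - midpt c a = (b - a) / 2 by rewrite /midpt; field.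
have E8 : c - midpt b c = (c - b) / 2 by rewrite /midpt; field.
have E9 : midpt c a - c = (a - c) / 2 by rewrite /midpt; field.
have F1 : normc (midpt a b - a) <= perim a b c / 2.
  by rewrite E1 n2 /perim; lra.
have F3 : normc (midpt c a - a) <= perim a b c / 2.
  by rewrite normcB E3 n2 /perim; lra.
have [k1|k1] := leP (normc (tri f a b c) / 4) (normc (tri f a (midpt a b) (midpt c a))).
  exists (a, midpt a b, midpt c a); split => //.
    by rewrite /perim E1 E2 E3 !n2; lra.
  by rewrite subrr normc0 /perim; lra.
have [k2|k2] := leP (normc (tri f a b c) / 4) (normc (tri f (midpt a b) b (midpt b c))).
  exists (midpt a b, b, midpt b c); split => //.
  by rewrite /perim E4 E5 E6 !n2; lra.
have [k3|k3] := leP (normc (tri f a b c) / 4) (normc (tri f (midpt c a) (midpt b c) c)).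
  exists (midpt c a, midpt b c, c); split => //.
  by rewrite /perim E7 E8 E9 !n2; lra.
(* If none of the three corner triangles carries a quarter of the integral, the medial one does. *)
exists (midpt a b, midpt b c, midpt c a); split => //.
  rewrite /perim (normcB (midpt b c)) E6 (normcB (midpt c a) (midpt b c)) E7.
  by rewrite (normcB (midpt a b) (midpt c a)) E2 !n2; lra.
move: k1 k2 k3; set t := tri f a b c in S *; rewrite S.
set t1 := tri _ _ _ _; set t2 := tri _ _ _ _; set t3 := tri _ _ _ _; set t4 := tri _ _ _ _.
have := normcD_le (t1 + t2 + t3) t4; have := normcD_le (t1 + t2) t3.
have := normcD_le t1 t2; lra.
Qed.

Lemma sprim_affine a b z0 u v : sprim a b (fun w => u + (w - z0) * v)
  (fun w => w * u + 2^-1 * ((w - z0) * (w - z0)) * v).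
Proof.
move=> w hw.
have hz := dwithin_subc (seg a b) z0 w.
have h1 : dwithin (seg a b) (fun w : R[i] => w * u) w u.
  have := dwithinM (dwithin_id (seg a b) w) (dwithin_cst (seg a b) u w).
  by rewrite mul1r mulr0 addr0.
have h2 := dwithinM (dwithinZ 2^-1 (dwithinM hz hz)) (dwithin_cst (seg a b) v w).
have := dwithinD h1 h2; congr (dwithin _ _ _ _); by field.
Qed.

Lemma goursat f x r : (forall w, cball x r w -> derivable f w 1) ->
  forall a b c, cball x r a -> cball x r b -> cball x r c -> tri f a b c = 0.
Proof.
move=> df0 a b c ha0 hb0 hc0.
(* A slightly smaller disc still contains the triangle and keeps the limit point of the subdivision
   inside the open disc. *)
have [r1 r1r [ha hb hc]] : exists2 r1, r1 < r &
    [/\ cball x r1 a, cball x r1 b & cball x r1 c].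
  pose m := Num.max (normc (a - x)) (Num.max (normc (b - x)) (normc (c - x))).
  have mr : m < r by rewrite /m !gt_max ha0 hb0 hc0.
  have /and3P[h1 h2 h3] : [&& normc (a - x) <= m, normc (b - x) <= m & normc (c - x) <= m].
    by rewrite /m !le_max !lexx !orbT.
  by exists ((m + r) / 2); [lra|rewrite /cball /=; split; lra].
have df w : cball x r1 w -> derivable f w 1.
  by move=> h; apply: df0; apply: lt_trans r1r.
have cf : scont (cball x r1) f by exact: scont_derivable.
pose nxt T := if pselect (exists T', tri_step f x r1 T T') is left e
  then projT1 (cid e) else T.
pose T_ n := iter n nxt (a, b, c).
pose L := perim a b c.
have inv n : [/\ [/\ cball x r1 (T_ n).1.1, cball x r1 (T_ n).1.2 & cball x r1 (T_ n).2],
     perim (T_ n).1.1 (T_ n).1.2 (T_ n).2 = L / 2 ^+ n,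
     normc (tri f a b c) / 4 ^+ n <= normc (tri f (T_ n).1.1 (T_ n).1.2 (T_ n).2) &
     normc ((T_ n.+1).1.1 - (T_ n).1.1) <= L / 2 ^+ n].
  have step k : [/\ cball x r1 (T_ k).1.1, cball x r1 (T_ k).1.2 & cball x r1 (T_ k).2] ->
    tri_step f x r1 (T_ k) (T_ k.+1).
    move=> [ia ib ic]; rewrite /T_ iterS -/(T_ k) /nxt.
    case: pselect => [e|]; first by case: cid.
    case; move: ia ib ic; case: (T_ k) => -[a1 b1] c1 /= ia ib ic.
    exact: tri_step_ex.
  have pos m : 0 <= perim (T_ m).1.1 (T_ m).1.2 (T_ m).2.
    by rewrite /perim !addr_ge0 // normc_ge0.
  elim: n => [|n [I1 I2 I3 I4]].
    split; rewrite ?expr0 ?divr1 //.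
    have := step 0%N; rewrite /tri_step; case E : (T_ 1%N) => [[a1 b1] c1].
    case => // _ _ h _ /=; have := pos 0%N; rewrite /= -/L in h *; lra.
  have := step n.+1; have := pos n.+1.
  have := step n I1; rewrite /tri_step.
  case E : (T_ n) => [[a1 b1] c1]; case E1 : (T_ n.+1) => [[a2 b2] c2].
  case E2 : (T_ n.+2) => [[a3 b3] c3] /=.
  rewrite E /= in I2 I3 => -[J1 J2 J3 J4] p /(_ J1)[K1 K2 K3 K4].
  have X : L / 2 ^+ n.+1 = L / 2 ^+ n / 2.
    by rewrite exprS; field; rewrite expf_neq0 // pnatr_eq0.
  split => //; first by rewrite J2 I2 X.
    apply: le_trans J4; rewrite exprS.
    have -> : normc (tri f a b c) / (4 * 4 ^+ n) = normc (tri f a b c) / 4 ^+ n / 4.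
      by field; rewrite expf_neq0 // pnatr_eq0.
    lra.
  by rewrite X -I2 -J2; lra.
have [|l hl] := @geom_cvg R (fun n => (T_ n).1.1) L.
  by move=> n; case: (inv n).
have L0 : 0 <= L by rewrite /L /perim !addr_ge0 // normc_ge0.
have lx : cball x r l.
  apply: le_lt_trans r1r; apply: normc_le_eps => e e0.
  have [n hn] := half_lt (4 * L) e0; have [[H _ _] _ _ _] := inv n.
  have := hl n; have := normc_dist l (T_ n).1.1 x; move: H; rewrite /cball /=; lra.
apply: eqc0_le => e0 e00.
(* With p the perimeter of the n-th triangle, its vertices lie within 5 p of l, so its integral is
   at most (e0 / K) 5 p^2. Since p = L / 2^n, the factor 4^n cancels, and K exceeds 5 L^2. *)
pose K := 5 * L ^+ 2 + 1.
have K0 : 0 < K by rewrite /K; have := sqr_ge0 L; lra.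
have e1 : 0 < e0 / K by rewrite divr_gt0.
have [d d0 hd] := derive_dwithin (df0 l lx) e1.
have [n hn] := half_lt (5 * L) d0.
have [[ia ib ic] I2 I3 _] := inv n; have hln := hl n.
have hE : 4 * L / 2 ^+ n = 4 * (L / 2 ^+ n) by ring.
have hE5 : 5 * L / 2 ^+ n = 5 * (L / 2 ^+ n) by ring.
rewrite hE5 in hn; rewrite hE in hln; set p := L / 2 ^+ n in I2 hn hln.
move: ia ib ic I2 I3 hln; case: (T_ n) => -[a' b'] c' /=.
move=> ia ib ic I2 I3 hln.
have q1 := normc_ge0 (b' - a'); have q2 := normc_ge0 (c' - b'); have q3 := normc_ge0 (a' - c').
have va : normc (a' - l) <= 5 * p by rewrite normcB; move: I2; rewrite /perim; lra.
have vb : normc (b' - l) <= 5 * p.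
  by have := normc_dist b' a' l; rewrite (normcB a' l); move: I2; rewrite /perim; lra.
have vc : normc (c' - l) <= 5 * p.
  have := normc_dist c' a' l; rewrite (normcB a' l) (normcB c' a').
  by move: I2; rewrite /perim; lra.
(* The affine part of f at l has a primitive, so only the remainder contributes to the triangle. *)
pose aff w := f l + (w - l) * derive1 f l.
have est u v : cball x r1 u -> cball x r1 v -> normc (u - l) <= 5 * p ->
    normc (v - l) <= 5 * p ->
    normc (sint f u v - sint aff u v) <= e0 / K * (5 * p) * normc (v - u).
  move=> hu hv lu lv.
  have sf : scont (seg u v) f by apply: scont_sub cf; exact: seg_cball.
  have sa : scont (seg u v) aff.
    apply: (@scont_sub _ _ setT) => //; apply: scont_derivable => w _.
    have h := dwithinD (dwithin_cst setT (f l) w) (dwithinM (dwithinB (dwithin_id setT w)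
       (dwithin_cst setT l w)) (dwithin_cst setT (derive1 f l) w)).
    by case: (dwithin_derive h).
  rewrite -(sintB sf sa); apply: sint_bound; first exact: scontB.
  move=> w hw; have wl := seg_ball lu lv hw.
  have -> : f w - aff w = f w - f l - (w - l) * derive1 f l by rewrite /aff; ring.
  apply: le_trans (hd w I _) _; first by apply: le_lt_trans wl _.
  by apply: ler_wpM2l => //; exact: ltW.
have affE u v : sint aff u v = (v * f l + 2^-1 * ((v - l) * (v - l)) * derive1 f l)
   - (u * f l + 2^-1 * ((u - l) * (u - l)) * derive1 f l).
  by rewrite (sintE (@sprim_affine u v l (f l) (derive1 f l))).
have tE : tri f a' b' c' = (sint f a' b' - sint aff a' b') +
   (sint f b' c' - sint aff b' c') + (sint f c' a' - sint aff c' a').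
  by rewrite !affE /tri; ring.
have B : normc (tri f a' b' c') <= e0 / K * 5 * (p * p).
  rewrite tE; apply: le_trans (normcD_le _ _) _.
  apply: le_trans (lerD (normcD_le _ _) (lexx _)) _.
  have := est a' b' ia ib va vb; have := est b' c' ib ic vb vc.
  have := est c' a' ic ia vc va.
  have -> : e0 / K * 5 * (p * p) = e0 / K * (5 * p) * (normc (b' - a') + normc (c' - b') + normc (a' - c')).
    by rewrite -/(perim a' b' c') I2; ring.
  by rewrite 2!mulrDr; lra.
have pp : p * p = L ^+ 2 / 4 ^+ n.
  have -> : (4:R) ^+ n = 2 ^+ n * 2 ^+ n by rewrite -exprMn; congr (_ ^+ _); ring.
  by rewrite /p; field; rewrite expf_neq0 // pnatr_eq0.
have p4 : 0 < (4:R) ^+ n by rewrite exprn_gt0.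
have := le_trans I3 B; rewrite pp mulrA ler_pM2r ?invr_gt0 // => h.
apply: le_trans h _.
have -> : e0 / K * 5 * L ^+ 2 = e0 * (5 * L ^+ 2 / K) by ring.
rewrite -[leRHS]mulr1; apply: ler_wpM2l; first exact: ltW.
by rewrite ler_pdivrMr // mul1r /K; lra.
Qed.

(** The integral from the centre works: by Goursat its increment from w to y is the integral over
    [w, y], which continuity compares with (y - w) f(w). *)
Lemma disc_primitive f x r : (forall w, cball x r w -> derivable f w 1) ->
  exists F, forall w, cball x r w -> dwithin setT F w (f w).
Proof.
move=> df; exists (sint f x) => w hw e e0.
have xx : cball x r x.
  by rewrite /cball /= subrr normc0; apply: le_lt_trans hw; exact: normc_ge0.
have cf : scont (cball x r) f by exact: scont_derivable.
have [d d0 hd] := dwithin_cont (derive_dwithin (df w hw)) e0.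
have rw : 0 < r - normc (w - x) by move: hw; rewrite /cball /=; lra.
exists (Num.min d (r - normc (w - x))); first by rewrite lt_min d0.
move=> y _; rewrite lt_min => /andP[y1 y2].
have hy : cball x r y by rewrite /cball /=; have := normc_dist y w x; lra.
have sc u v : cball x r u -> cball x r v -> scont (seg u v) f.
  by move=> hu hv; apply: scont_sub cf; exact: seg_cball.
have := goursat df xx hw hy; rewrite /tri (sintC (sc _ _ xx hy)) => T.
have -> : sint f x y - sint f x w = sint f w y.
  rewrite -[LHS]addr0 -T; ring.
have cw : sint (fun=> f w) w y = (y - w) * f w.
  rewrite (@sintE _ _ _ _ (fun u => u * f w)); first by ring.
  move=> u _; have := dwithinM (dwithin_id (seg w y) u) (dwithin_cst (seg w y) (f w) u).
  by rewrite mul1r mulr0 addr0.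
rewrite -cw -sintB; [|exact: sc|exact: scont_cst].
apply: sint_bound; first by apply: scontB; [exact: sc|exact: scont_cst].
move=> u hu; apply: ltW; apply: hd => //.
apply: le_lt_trans y1; apply: (seg_ball _ _ hu) => //.
by rewrite subrr normc0 normc_ge0.
Qed.

End GoursatTheorem.

(** * Continuous functions are bounded on segments *)

Section Bounded.
Context {R : realType}.

Lemma scont_bounded (a b : R[i]) (f : R[i] -> R[i]) : scont (seg a b) f ->
  exists M, forall w, seg a b w -> normc (f w) <= M.
Proof.
move=> cf; pose p (t : R) := a + t%:C * (b - a).
pose Q s t := exists M, forall u, s <= u <= t -> normc (f (p u)) <= M.
have [M hM] : Q 0 1.
  apply: (@cousin _ Q).
    move=> s m t sm mt [M1 h1] [M2 h2]; exists (Num.max M1 M2) => u /andP[su ut].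
    rewrite le_max; have [um|mu] := leP u m.
      by rewrite h1 ?su.
    by rewrite h2 ?orbT // ut ltW.
  move=> x x01; have px : seg a b (p x) by exists x.
  have [d d0 hd] := cf _ px 1 ltr01.
  pose n := normc (b - a) + 1.
  have n0 : 0 < n by rewrite /n; have := normc_ge0 (b - a); lra.
  exists (d / n); first by rewrite divr_gt0.
  move=> s t s0 t1 sx xt; rewrite ltr_pdivlMr // => ts.
  exists (normc (f (p x)) + 1) => u /andP[su ut].
  have hu : seg a b (p u) by exists u => //; apply/andP; split; lra.
  have ux : normc (p u - p x) < d.
    have -> : p u - p x = (u - x)%:C * (b - a) by rewrite /p rmorphB; ring.
    rewrite normcM normc_real; apply: le_lt_trans ts.
    apply: ler_pM => //; rewrite ?normc_ge0 //; last by rewrite /n; lra.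
    by rewrite ler_norml; apply/andP; split; lra.
  by have := hd _ hu ux; have := normc_rev (f (p u)) (f (p x)); lra.
by exists M => _ [t t01 ->]; exact: hM.
Qed.

End Bounded.

(** * Integrals over circles *)

Section CircleIntegral.
Context {R : realType}.
Implicit Types (x y z w l : R[i]) (f g h : R[i] -> R[i]) (r : R).

(** The parameter is complex because curves are parametrized by the segment from 0 to [turn]; only
    real parameters are meaningful, whence differentiability within that segment only. *)
Definition expi (t : R[i]) : R[i] := cos (Re t) +i* sin (Re t).

Definition circle_par z r t := z + r%:C * expi t.

Definition turn : R[i] := (pi *+ 2)%:C.

Definition sphere_at z r : set R[i] := [set w | normc (w - z) = r].

Lemma normc_expi t : normc (expi t) = 1.
Proof. by rewrite /= cos2Dsin2 sqrtr1. Qed.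

Lemma circle_par_sphere z r t : 0 <= r -> sphere_at z r (circle_par z r t).
Proof.
move=> r0; rewrite /sphere_at /circle_par /= addrAC subrr add0r normcM normc_expi.
by rewrite normc_real mulr1 ger0_norm.
Qed.

Lemma circle_par_turn z r : circle_par z r turn = circle_par z r 0.
Proof. by rewrite /circle_par /expi /turn /= cos2pi sin2pi cos0 sin0. Qed.

Lemma dwithin_expi t : seg 0 turn t -> dwithin (seg 0 turn) expi t ('i * expi t).
Proof.
have real s : seg 0 turn s -> exists u : R, s = u%:C.
  move=> [u _ ->]; exists (u * (pi *+ 2)).
  by rewrite subr0 add0r /turn rmorphM.
move=> /real[u ->] e e0.
have e2 : 0 < e / 2 by lra.
have [d d0 hd] := real_derive_eps (@ex_derive _ _ _ _ _ _ _ (is_derive_cos u)) erefl e2.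
have [d' d'0 hd'] := real_derive_eps (@ex_derive _ _ _ _ _ _ _ (is_derive_sin u)) erefl e2.
rewrite derive1E derive_val in hd; rewrite derive1E derive_val in hd'.
exists (Num.min d d'); first by rewrite lt_min d0.
move=> _ /real[s ->]; rewrite -rmorphB normc_real lt_min => /andP[sd sd'].
apply: le_trans (normc_ReIm _) _.
have {}hd := hd s sd; have {}hd' := hd' s sd'.
rewrite /expi !ReD !ImD !ReN !ImN Re_realM Im_realM /=.
have -> : e * `|s - u| = e / 2 * `|s - u| + e / 2 * `|s - u| by field.
apply: lerD.
  by rewrite mul0r mul1r sub0r.
by rewrite mul0r mul1r add0r.
Qed.

Lemma dwithin_circle_par z r t : seg 0 turn t ->
  dwithin (seg 0 turn) (circle_par z r) t (r%:C * ('i * expi t)).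
Proof.
move=> ht; have := dwithinD (dwithin_cst (seg 0 turn) z t)
  (dwithinZ r%:C (dwithin_expi ht)).
by rewrite add0r.
Qed.

Definition cint f z r := sint
  (fun t => f (circle_par z r t) * (r%:C * ('i * expi t))) 0 turn.

Lemma scont_cint f z r : 0 <= r -> scont (sphere_at z r) f ->
  scont (seg 0 turn) (fun t => f (circle_par z r t) * (r%:C * ('i * expi t))).
Proof.
move=> r0 cf; apply: scontM.
  move=> t ht e e0.
  have [d d0 hd] := cf _ (circle_par_sphere z t r0) e e0.
  have [d' d'0 hd'] := dwithin_cont (dwithin_circle_par z r ht) d0.
  exists d' => // s hs sd; apply: hd; first exact: circle_par_sphere.
  exact: hd'.
move=> t ht.
exact: dwithin_cont (dwithinZ r%:C (dwithinZ 'i (dwithin_expi ht))).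
Qed.

Lemma cintB f g z r : 0 <= r -> scont (sphere_at z r) f ->
  scont (sphere_at z r) g ->
  cint (fun w => f w - g w) z r = cint f z r - cint g z r.
Proof.
move=> r0 cf cg; rewrite /cint -(sintB (scont_cint r0 cf) (scont_cint r0 cg)).
by congr sint; apply: funext => t; rewrite mulrBl.
Qed.

Lemma cintZ k f z r : 0 <= r -> scont (sphere_at z r) f ->
  cint (fun w => k * f w) z r = k * cint f z r.
Proof.
move=> r0 cf; rewrite /cint -(sintZ k (scont_cint r0 cf)).
by congr sint; apply: funext => t; ring.
Qed.

Lemma cint_ext f g z r : 0 <= r -> (forall w, sphere_at z r w -> f w = g w) ->
  cint f z r = cint g z r.
Proof.
move=> r0 fg; rewrite /cint; congr sint; apply: funext => t.
by rewrite fg //; exact: circle_par_sphere.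
Qed.

Lemma cint_bound_par f z r (M : R) : 0 <= r -> scont (sphere_at z r) f ->
  (forall t, seg 0 turn t -> normc (f (circle_par z r t)) <= M) ->
  normc (cint f z r) <= M * r * (pi *+ 2).
Proof.
move=> r0 cf hM; have := @sint_bound R 0 turn _ (M * r) (scont_cint r0 cf).
rewrite subr0 normc_real (ger0_norm (_ : 0 <= pi *+ 2)); last first.
  by rewrite mulrn_wge0 // pi_ge0.
apply=> t ht; rewrite !normcM normc_expi normc_real ger0_norm //.
rewrite normc_i !mulr1; apply: ler_wpM2r => //; exact: hM.
Qed.

Lemma cint_bound f z r (M : R) : 0 <= r -> scont (sphere_at z r) f ->
  (forall w, sphere_at z r w -> normc (f w) <= M) ->
  normc (cint f z r) <= M * r * (pi *+ 2).
Proof.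
move=> r0 cf hM; apply: cint_bound_par => // t _; apply: hM.
exact: circle_par_sphere.
Qed.

Lemma cint_primitive f F z r : 0 <= r ->
  (forall w, sphere_at z r w -> dwithin setT F w (f w)) -> cint f z r = 0.
Proof.
move=> r0 hF; rewrite /cint (@sintE _ _ _ _ (fun t => F (circle_par z r t))).
  by rewrite circle_par_turn subrr.
move=> t ht; have hw := hF _ (circle_par_sphere z t r0).
exact: dwithin_comp (dwithin_circle_par z r ht) hw _.
Qed.

Lemma cint_center z r : 0 < r -> cint (fun w => (w - z)^-1) z r = 'i * turn.
Proof.
move=> r0; rewrite /cint (@sintE _ _ _ _ (fun t => 'i * t)).
  by rewrite mulr0 subr0.
move=> t ht.
have rn : r%:C != 0 :> R[i] by rewrite -normc_gt0 normc_real gtr0_norm.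
have en : expi t != 0 by rewrite -normc_gt0 normc_expi.
have -> : (circle_par z r t - z)^-1 * (r%:C * ('i * expi t)) = 'i * 1.
  rewrite /circle_par addrAC subrr add0r; move: (r%:C) (expi t) rn en => c d c0 d0.
  by field; rewrite c0 d0.
exact: dwithinZ (dwithin_id _ _).
Qed.

(** Differentiation under the integral sign: a remainder quadratic in y - z, uniform over the
    circle, is integrated against f, which is bounded on the circle. *)
Lemma cint_param f (k : R[i] -> R[i] -> R[i]) (dk : R[i] -> R[i]) z0 r z (d C : R) :
  0 <= r -> 0 < d -> scont (sphere_at z0 r) f -> scont (sphere_at z0 r) dk ->
  (forall y, normc (y - z) < d -> scont (sphere_at z0 r) (k y)) ->
  (forall y w, normc (y - z) < d -> sphere_at z0 r w ->
    normc (k y w - k z w - (y - z) * dk w) <= C * normc (y - z) ^+ 2) ->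
  dwithin setT (fun y => cint (fun w => f w * k y w) z0 r) z
    (cint (fun w => f w * dk w) z0 r).
Proof.
move=> r0 d0 cf cdk ck hk e e0.
have cc : scont (seg 0 turn) (fun t => f (circle_par z0 r t)).
  move=> t ht e1 e10.
  have [d1 d10 hd] := cf _ (circle_par_sphere z0 t r0) e1 e10.
  have [d' d'0 hd'] := dwithin_cont (dwithin_circle_par z0 r ht) d10.
  exists d' => // s hs sd; apply: hd; first exact: circle_par_sphere.
  exact: hd'.
have [M hM] := scont_bounded cc.
have M0 : 0 <= M by apply: le_trans (normc_ge0 _) (hM 0 (seg_l _ _)).
have pi0 : 0 <= (pi : R) *+ 2 by rewrite mulrn_wge0 // pi_ge0.
pose K := M * `|C| * r * (pi *+ 2) + 1.
have K0 : 0 < K by rewrite /K ltr_wpDl // !mulr_ge0.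
exists (Num.min d (e / K)); first by rewrite lt_min d0 divr_gt0.
move=> y _; rewrite lt_min => /andP[yd ye].
have zz : normc (z - z) < d by rewrite subrr normc0.
have c1 := scontM cf (ck y yd); have c2 := scontM cf (ck z zz).
have c3 := scontM cf cdk.
have c4 : scont (sphere_at z0 r) (fun w => (y - z) * (f w * dk w)).
  by apply: scontM => //; exact: scont_cst.
rewrite -(cintZ _ r0 c3) -(cintB r0 c1 c2) -(cintB r0 (scontB c1 c2) c4).
have b := @cint_bound_par _ z0 r (M * (`|C| * normc (y - z) ^+ 2)) r0 (scontB (scontB c1 c2) c4).
apply: le_trans (b _) _ => [t ht|].
  have -> (u v w c : R[i]) : c * u - c * v - (y - z) * (c * w) = c * (u - v - (y - z) * w) by ring.
  rewrite normcM; apply: ler_pM => //; try exact: normc_ge0; first exact: hM.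
  apply: le_trans (hk y _ yd (circle_par_sphere z0 t r0)) _.
  by apply: ler_wpM2r; [rewrite exprn_ge0 // normc_ge0|exact: ler_norm].
rewrite ltr_pdivlMr // in ye.
have -> : M * (`|C| * normc (y - z) ^+ 2) * r * (pi *+ 2) = normc (y - z) * (K - 1) * normc (y - z).
  by rewrite /K; ring.
apply: ler_wpM2r; first exact: normc_ge0.
have := normc_ge0 (y - z); lra.
Qed.

End CircleIntegral.

(** * Cauchy's integral formula and estimates *)

Section CauchyFormula.
Context {R : realType}.
Implicit Types (x y z w l : R[i]) (f g h F : R[i] -> R[i]) (r : R).

Let sph_ne z0 r z w : normc (z - z0) < r -> sphere_at z0 r w -> w - z != 0.
Proof.
move=> hz; rewrite /sphere_at /= => hw; rewrite subr_eq0.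
by apply/eqP => E; move: hz; rewrite -E hw ltxx.
Qed.

Lemma scont_kernel z0 r z n : normc (z - z0) < r ->
  scont (sphere_at z0 r) (fun w => (w - z)^-1 ^+ n).
Proof.
move=> hz w hw; apply: dwithin_cont.
by apply: dwithinX; apply: dwithin_invB; exact: sph_ne hz hw.
Qed.

Definition cauchy_int n f z0 r z := cint (fun w => f w * (w - z)^-1 ^+ n) z0 r.

(** For x = 1 / (w - y), u = 1 / (w - z) and h = y - z the hypothesis is the resolvent identity; it
    makes the Taylor remainder divisible by h^2 x u. The constant 6 is 1 + 2 + 3 from the case n =
    3. Three powers suffice, since only three derivatives of a primitive are taken later. *)
Lemma kernel_taylor n (h x u : R[i]) (B : R) : (n = 1 \/ n = 2 \/ n = 3)%N ->
  x - u = h * x * u -> normc x <= B -> normc u <= B -> 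
  normc (x ^+ n - u ^+ n - h * (n%:R * u ^+ n.+1)) <= 6 * B ^+ n.+2 * normc h ^+ 2.
Proof.
move=> hn E hx hu.
have B0 : 0 <= B by apply: le_trans hx; exact: normc_ge0.
have nx := normc_ge0 x; have nu := normc_ge0 u.
have X (a b : R[i]) (A A' : R) : normc a <= A -> normc b <= A' -> normc (a * b) <= A * A'.
  by move=> ha hb; rewrite normcM; apply: ler_pM => //; exact: normc_ge0.
have xE : x = u + h * x * u by rewrite -E addrC subrK.
have P q (Q : R) : normc q <= Q -> normc (h ^+ 2 * x * u * q) <= normc h ^+ 2 * B * B * Q.
  by move=> hq; do 2 apply: (X) => //; apply: (X) => //; rewrite normcX.
have Y (a b : R[i]) (A A' : R) : normc a <= A -> normc b <= A' -> normc (a + b) <= A + A'.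
  by move=> ha hb; apply: le_trans (normcD_le _ _) _; exact: lerD.
case: hn => [->|[->|->]].
- have -> : x ^+ 1 - u ^+ 1 - h * (1%:R * u ^+ 2) = h ^+ 2 * x * u * u.
    by rewrite !expr1 mul1r [LHS](_ : _ = h * u * (x - u) + (x - u - h * x * u)); [rewrite E; ring|ring].
  apply: le_trans (P _ _ hu) _.
  rewrite (_ : 6 * B ^+ 3 * normc h ^+ 2 = normc h ^+ 2 * B * B * B * 6); last by ring.
  by rewrite ler_peMr ?ler1n // !mulr_ge0 ?exprn_ge0 ?normc_ge0 //.
- have -> : x ^+ 2 - u ^+ 2 - h * (2%:R * u ^+ 3) = h ^+ 2 * x * u * (u * (x + 2 * u)).
    rewrite [LHS](_ : _ = (x - u) * (x + u) - h * (2%:R * u ^+ 3)); last by ring.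
    rewrite E [LHS](_ : _ = h * u * (x - u) * (x + 2 * u)); last by ring.
    by rewrite E; ring.
  have q : normc (u * (x + 2 * u)) <= B * (B + 2 * B).
    by apply: (X) => //; apply: (Y) => //; rewrite normcM normc_nat; lra.
  apply: le_trans (P _ _ q) _.
  rewrite (_ : 6 * B ^+ 4 * normc h ^+ 2 = normc h ^+ 2 * B * B * (B * (B + 2 * B)) * 2); last by ring.
  by rewrite ler_peMr ?ler1n // !mulr_ge0 ?exprn_ge0 ?normc_ge0 //; lra.
- have -> : x ^+ 3 - u ^+ 3 - h * (3%:R * u ^+ 4) = h ^+ 2 * x * u * (u * (x ^+ 2 + 2 * x * u + 3 * u ^+ 2)).
    rewrite [LHS](_ : _ = (x - u) * (x ^+ 2 + x * u + u ^+ 2) - h * (3%:R * u ^+ 4)); last by ring.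
    rewrite E [LHS](_ : _ = h * u * (x - u) * (x ^+ 2 + 2 * x * u + 3 * u ^+ 2)); last by ring.
    by rewrite E; ring.
  have q : normc (u * (x ^+ 2 + 2 * x * u + 3 * u ^+ 2)) <= B * (B ^+ 2 + 2 * B * B + 3 * B ^+ 2).
    apply: (X) => //; apply: (Y); first apply: (Y).
    - by rewrite expr2; apply: (X).
    - by apply: (X) => //; apply: (X) => //; rewrite normc_nat.
    - by apply: (X); [rewrite normc_nat|rewrite expr2; apply: (X)].
  apply: le_trans (P _ _ q) _.
  by rewrite le_eqVlt; apply/orP; left; apply/eqP; ring.
Qed.

Lemma cauchy_int_diff n f z0 r z : (n = 1 \/ n = 2 \/ n = 3)%N -> 0 < r ->
  scont (sphere_at z0 r) f -> normc (z - z0) < r ->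
  dwithin setT (cauchy_int n f z0 r) z (n%:R * cauchy_int n.+1 f z0 r z).
Proof.
move=> hn r0 cf hz.
(* Half the distance from z to the circle: points within d of z remain at distance at least d from
   it. *)
pose d := (r - normc (z - z0)) / 2.
have d0 : 0 < d by rewrite /d; lra.
have c1 : scont (sphere_at z0 r) (fun w => f w * (w - z)^-1 ^+ n.+1).
  by apply: scontM => //; exact: scont_kernel.
have -> : n%:R * cauchy_int n.+1 f z0 r z =
   cint (fun w => f w * (n%:R * (w - z)^-1 ^+ n.+1)) z0 r.
  rewrite /cauchy_int -cintZ ?ltW //; apply: cint_ext; first exact: ltW.
  by move=> w _; ring.
have yz y : normc (y - z) < d -> normc (y - z0) < r.
  by move=> yd; have := normc_dist y z z0; move: yd; rewrite /d; lra.
apply: (@cint_param _ _ _ _ _ _ _ d (6 * d^-1 ^+ n.+2) (ltW r0) d0 cf).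
- by apply: scontM; [exact: scont_cst|exact: scont_kernel].
- by move=> y /yz yd; exact: scont_kernel.
move=> y w yd hw.
have bnd v : normc (v - z) < d -> normc ((w - v)^-1) <= d^-1.
  move=> vd; rewrite normcV lef_pV2 ?posrE //.
    have := normc_dist w v z0; have := normc_dist v z z0.
    by move: hw vd; rewrite /sphere_at /= /d; lra.
  by rewrite normc_gt0; apply: sph_ne hw; exact: yz.
apply: kernel_taylor => //.
- by have := sph_ne (yz _ yd) hw; have := sph_ne hz hw => h1 h2; field; rewrite h1 h2.
- exact: bnd.
- by apply: bnd; rewrite subrr normc0.
Qed.

(** The singularity at z is removed by hand: F' = f is itself derivable at z, so the quotient has
    derivative f'(z) / 2 there. This is why Cauchy's formula is first proved for functions with a
    holomorphic derivative. *)
Lemma quotient_derivable F f z0 r z : (forall w, cball z0 r w -> dwithin setT F w (f w)) ->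
  cball z0 r z -> derivable f z 1 ->
  forall w, cball z0 r w ->
  derivable (fun w => if w == z then f z else (F w - F z) / (w - z)) w 1.
Proof.
move=> hF hz df w hw; set G := fun w => _.
have [->|wz] := eqVneq w z; last first.
  have wz0 : w - z != 0 by rewrite subr_eq0.
  have h := dwithinM (dwithinB (hF w hw) (dwithin_cst setT (F z) w))
     (dwithin_invB setT wz0).
  have n0 : 0 < normc (w - z) by rewrite normc_gt0.
  have [] // := dwithin_derive (@dwithin_near _ _ _ G _ _ _ n0 _ _ h).
    move=> y _ hy; rewrite /G; case: eqP => // E; move: hy.
    by rewrite E normcB ltxx.
  by rewrite /G (negbTE wz).
have [] // := @dwithin_derive _ G z (2^-1 * derive1 f z).
move=> e e0.
have [d d0 hd] := derive_dwithin df e0.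
have rz : 0 < r - normc (z - z0) by move: hz; rewrite /cball /=; lra.
exists (Num.min d (r - normc (z - z0))); first by rewrite lt_min d0.
move=> y _; rewrite lt_min => /andP[yd yr]; rewrite /G eqxx.
case: eqVneq => [->|yz]; first by rewrite !subrr mul0r subr0 normc0 mulr0.
have yz0 : y - z != 0 by rewrite subr_eq0.
(* second order expansion of F at z, by the mean value inequality *)
pose H u := F u - u * f z - 2^-1 * ((u - z) * (u - z)) * derive1 f z.
have sb : seg z y `<=` cball z (Num.min d (r - normc (z - z0))).
  apply: seg_cball; rewrite /cball /= ?subrr ?normc0 lt_min ?yd ?yr //.
  by rewrite d0.
have hH u : seg z y u -> dwithin (seg z y) H u (f u - f z - (u - z) * derive1 f z).
  move=> hu; have := sb u hu; rewrite /cball /= lt_min => /andP[ud ur].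
  have hu0 : cball z0 r u by rewrite /cball /=; have := normc_dist u z z0; lra.
  have hz1 := dwithin_subc (seg z y) z u.
  have := dwithinB (dwithinB (dwithin_sub (@subsetT _ _) (hF u hu0))
    (dwithinM (dwithin_id (seg z y) u) (dwithin_cst (seg z y) (f z) u)))
    (dwithinM (dwithinZ 2^-1 (dwithinM hz1 hz1)) (dwithin_cst (seg z y) (derive1 f z) u)).
  by congr (dwithin _ _ _ _); field.
have := @mvi _ _ _ _ _ (e * normc (y - z)) hH.
have hb u : seg z y u -> normc (f u - f z - (u - z) * derive1 f z) <= e * normc (y - z).
  move=> hu; have := sb u hu; rewrite /cball /= lt_min => /andP[ud ur].
  apply: le_trans (hd u I ud) _; apply: ler_wpM2l; first exact: ltW.
  by apply: (seg_ball _ _ hu) => //; rewrite subrr normc0 normc_ge0.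
move=> /(_ hb) K.
have -> : (F y - F z) / (y - z) - f z - (y - z) * (2^-1 * derive1 f z) =
  (H y - H z) / (y - z) by rewrite /H; field.
by rewrite normc_div ler_pdivrMr ?normc_gt0.
Qed.

(** The derivative in z is the integral of 1 / (w - z)^2, which has a primitive on the circle, so
    the value at z is the value at the centre. *)
Lemma cauchy_winding z0 r z : 0 < r -> normc (z - z0) < r ->
  cauchy_int 1 (fun=> 1) z0 r z = 'i * turn.
Proof.
move=> r0 hz.
have h0 : normc (z0 - z0) < r by rewrite subrr normc0.
have -> : cauchy_int 1 (fun=> 1) z0 r z = cauchy_int 1 (fun=> 1) z0 r z0.
  apply: dwithin_eq0_cst => w hw.
  have hw0 : cball z0 r w by apply: (seg_cball _ _ hw).
  have -> : 0 = 1%:R * cauchy_int 2 (fun=> 1) z0 r w.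
    rewrite (_ : cauchy_int 2 _ _ _ _ = 0) ?mulr0 //; apply: (@cint_primitive _ _ (fun u => - (u - w)^-1)); first exact: ltW.
    move=> u hu; have uw := sph_ne hw0 hu.
    have := dwithinN (dwithin_invB setT uw).
    by congr (dwithin _ _ _ _); rewrite mul1r opprK exprVn.
  apply: (dwithin_sub (@subsetT _ _)); apply: cauchy_int_diff => //; first by left.
  exact: scont_cst.
rewrite -(cint_center z0 r0); apply: cint_ext; first exact: ltW.
by move=> w _; rewrite mul1r expr1.
Qed.

Lemma turn_neq0 : 'i * turn != 0 :> R[i].
Proof.
have p := pi_gt0 R.
rewrite -normc_gt0 normcM normc_i mul1r normc_real normr_gt0 gt_eqF //.
by rewrite mulrn_wgt0.
Qed.

(** The difference quotient of F at z is holomorphic, hence has a primitive on the disc, and its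
    circle integral vanishes; the winding integral then gives F z. *)
Let cauchy_primitive F f z0 r r1 : (forall w, cball z0 r w -> dwithin setT F w (f w)) ->
  (forall w, cball z0 r w -> derivable f w 1) -> 0 < r1 < r ->
  forall z, normc (z - z0) < r1 -> cauchy_int 1 F z0 r1 z = 'i * turn * F z.
Proof.
move=> hF df /andP[r10 r1r] z hz.
have hzr : cball z0 r z by apply: lt_trans r1r.
have [G' hG'] := disc_primitive (quotient_derivable hF hzr (df z hzr)).
have sb w : sphere_at z0 r1 w -> cball z0 r w by rewrite /sphere_at /cball /= => ->.
have cF : scont (sphere_at z0 r1) F.
  by move=> w /sb/hF hw; apply: dwithin_cont (dwithin_sub (@subsetT _ _) hw).
have ck := @scont_kernel z0 r1 z 1 hz.
have c1 := scontM cF ck; have c2 := scontM (scont_cst (S := sphere_at z0 r1) (F z)) ck.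
have : cauchy_int 1 F z0 r1 z - cint (fun w => F z * (w - z)^-1 ^+ 1) z0 r1 = 0.
  rewrite -(cintB (ltW r10) c1 c2); apply: (@cint_primitive _ _ G'); first exact: ltW.
  move=> w hw; have := hG' w (sb w hw); have := sph_ne hz hw.
  rewrite subr_eq0 => /negbTE ->; congr (dwithin _ _ _ _); rewrite expr1; ring.
move=> /eqP; rewrite subr_eq0 => /eqP ->.
rewrite cintZ ?ltW // mulrC -(cauchy_winding r10 hz); congr (_ * _).
by apply: cint_ext; [exact: ltW|move=> w _; rewrite mul1r].
Qed.

(** f is the derivative of a primitive F, and F is a Cauchy integral. Differentiating the kernel
    once gives f, twice f', and the third derivative shows that f' is derivable. *)
Let cauchy_hol_derive f z0 r : (forall w, cball z0 r w -> derivable f w 1) ->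
  forall w, cball z0 r w -> derivable (derive1 f) w 1.
Proof.
move=> df w hw; have [F hF] := disc_primitive df.
have [r1 [r10 r1r hwr]] : exists r1, [/\ 0 < r1, r1 < r & normc (w - z0) < r1].
  exists ((normc (w - z0) + r) / 2); have := normc_ge0 (w - z0).
  by move: hw; rewrite /cball /=; split; lra.
have rr : 0 < r1 < r by rewrite r10.
have CF := cauchy_primitive hF df rr.
have cF : scont (sphere_at z0 r1) F.
  move=> u; rewrite /sphere_at /= => hu.
  have /hF hw' : cball z0 r u by rewrite /cball /= hu.
  by apply: dwithin_cont (dwithin_sub (@subsetT _ _) hw').
set c := 'i * turn in CF; have c0 : c != 0 := turn_neq0.
have FE u : normc (u - z0) < r1 -> F u = c^-1 * cauchy_int 1 F z0 r1 u.
  by move=> hu; rewrite CF // mulKf.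
have nbh u : normc (u - z0) < r1 -> 0 < r1 - normc (u - z0) by lra.
have inn u y : normc (y - u) < r1 - normc (u - z0) -> normc (y - z0) < r1.
  by move=> hy; have := normc_dist y u z0; lra.
have fE u : normc (u - z0) < r1 -> f u = c^-1 * cauchy_int 2 F z0 r1 u.
  move=> hu; have hur : cball z0 r u by apply: lt_trans r1r.
  have [_ <-] := dwithin_derive (hF u hur).
  have h := dwithinZ c^-1 (@cauchy_int_diff 1 F z0 r1 u (or_introl erefl) r10 cF hu).
  have := @dwithin_near _ _ _ F _ _ _ (nbh u hu) _ _ h.
  rewrite mul1r => h'; have [] // := dwithin_derive (h' _ _).
    by move=> y _ /inn hy; rewrite -FE.
  by rewrite -FE.
have dfE u : normc (u - z0) < r1 -> derive1 f u = c^-1 * (2 * cauchy_int 3 F z0 r1 u).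
  move=> hu.
  have h := dwithinZ c^-1 (@cauchy_int_diff 2 F z0 r1 u (or_intror (or_introl erefl)) r10 cF hu).
  have h' := @dwithin_near _ _ _ f _ _ _ (nbh u hu) _ _ h.
  have [] // := dwithin_derive (h' _ _).
    by move=> y _ /inn hy; rewrite -fE.
  by rewrite -fE.
have h := dwithinZ c^-1 (dwithinZ 2 (@cauchy_int_diff 3 F z0 r1 w (or_intror (or_intror erefl)) r10 cF hwr)).
have h' := @dwithin_near _ _ _ (derive1 f) _ _ _ (nbh w hwr) _ _ h.
have [] // := dwithin_derive (h' _ _).
  by move=> y _ /inn hy; rewrite -dfE.
by rewrite -dfE.
Qed.

Lemma holomorphic_derive f z0 r : (forall w, cball z0 r w -> derivable f w 1) ->
  forall w, cball z0 r w -> derivable (derive1 f) w 1.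
Proof. exact: cauchy_hol_derive. Qed.

(** f is a primitive of f', which is now known to be derivable. *)
Lemma cauchy_formula f z0 r r1 : (forall w, cball z0 r w -> derivable f w 1) ->
  0 < r1 < r -> forall z, normc (z - z0) < r1 ->
  cauchy_int 1 f z0 r1 z = 'i * turn * f z.
Proof.
move=> df rr z hz.
have hF w : cball z0 r w -> dwithin setT f w (derive1 f w).
  by move=> /df; exact: derive_dwithin.
exact: cauchy_primitive hF (holomorphic_derive df) rr z hz.
Qed.

Lemma cauchy_formula_derive f z0 r r1 : (forall w, cball z0 r w -> derivable f w 1) ->
  0 < r1 < r -> forall z, normc (z - z0) < r1 ->
  cauchy_int 2 f z0 r1 z = 'i * turn * derive1 f z.
Proof.
move=> df rr z hz; have /andP[r10 r1r] := rr.
have C := cauchy_formula df rr.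
have cf : scont (sphere_at z0 r1) f.
  move=> u; rewrite /sphere_at /= => hu.
  have /df/derive_dwithin hw' : cball z0 r u by rewrite /cball /= hu.
  by apply: dwithin_cont (dwithin_sub (@subsetT _ _) hw').
set c := 'i * turn in C *; have c0 : c != 0 := turn_neq0.
have h := dwithinZ c^-1 (@cauchy_int_diff 1 f z0 r1 z (or_introl erefl) r10 cf hz).
have n0 : 0 < r1 - normc (z - z0) by lra.
have h' := @dwithin_near _ _ _ f _ _ _ n0 _ _ h.
have [||_ ->] := dwithin_derive (h' _ _).
- by move=> y _ hy; rewrite C ?mulKf //; have := normc_dist y z z0; lra.
- by rewrite C ?mulKf.
by rewrite mul1r mulVKf.
Qed.

(** The bound degrades towards the circle, but at the centre the factor is 1, which is already the
    maximum principle there. *)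
Lemma cauchy_bound f z0 r r1 (M : R) : (forall w, cball z0 r w -> derivable f w 1) ->
  0 < r1 < r -> (forall w, sphere_at z0 r1 w -> normc (f w) <= M) ->
  forall z, normc (z - z0) < r1 -> normc (f z) <= M * r1 / (r1 - normc (z - z0)).
Proof.
move=> df rr hM z hz; have /andP[r10 r1r] := rr.
have p := pi_gt0 R.
have cf : scont (sphere_at z0 r1) f.
  move=> u; rewrite /sphere_at /= => hu.
  have /df/derive_dwithin hw' : cball z0 r u by rewrite /cball /= hu.
  by apply: dwithin_cont (dwithin_sub (@subsetT _ _) hw').
have n0 : 0 < r1 - normc (z - z0) by lra.
have := @cint_bound R _ z0 r1 (M / (r1 - normc (z - z0))) (ltW r10) (scontM cf (@scont_kernel _ _ _ 1 hz)).
rewrite -/(cauchy_int 1 f z0 r1 z) (cauchy_formula df rr hz).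
rewrite !normcM normc_real (ger0_norm (_ : 0 <= pi *+ 2)); last by lra.
rewrite normc_i mul1r [X in X <= _]mulrC ler_pM2r; last by lra.
move=> H; rewrite -mulrA [r1 / _]mulrC mulrA; apply: H => w hw.
rewrite expr1 normc_div; apply: ler_pM; try exact: normc_ge0.
- by rewrite invr_ge0 normc_ge0.
- exact: hM.
rewrite lef_pV2 ?posrE //; last by rewrite normc_gt0; exact: sph_ne hz hw.
by have := normc_dist w z z0; move: hw; rewrite /sphere_at /=; lra.
Qed.

Lemma cauchy_estimate f z r (M : R) : 0 < r ->
  (forall w, cball z r w -> derivable f w 1) ->
  (forall w, cball z r w -> normc (f w) <= M) ->
  normc (derive1 f z) <= 2 * M / r.
Proof.
move=> r0 df hM; have p := pi_gt0 R.
have rr : 0 < r / 2 < r by apply/andP; split; lra.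
have r20 : 0 < r / 2 by lra.
have hz : normc (z - z) < r / 2 by rewrite subrr normc0.
have sb w : sphere_at z (r / 2) w -> cball z r w.
  by rewrite /sphere_at /cball /= => ->; lra.
have cf : scont (sphere_at z (r / 2)) f.
  move=> u /sb/df/derive_dwithin hw'.
  by apply: dwithin_cont (dwithin_sub (@subsetT _ _) hw').
have := @cint_bound R _ z (r / 2) (M * ((r / 2)^-1 ^+ 2)) (ltW r20) (scontM cf (@scont_kernel _ _ _ 2 hz)).
rewrite -/(cauchy_int 2 f z (r / 2) z) (cauchy_formula_derive df rr hz).
rewrite !normcM normc_real (ger0_norm (_ : 0 <= pi *+ 2)); last by lra.
rewrite normc_i mul1r [X in X <= _]mulrC ler_pM2r; last by lra.
have -> : M * (r / 2)^-1 ^+ 2 * (r / 2) = 2 * M / r.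
  by field; rewrite gt_eqF.
apply=> w hw; rewrite normcM normcX normcV; move: (hw); rewrite /sphere_at /= => ->.
by apply: ler_wpM2r; [rewrite exprn_ge0 // invr_ge0 ltW|apply: hM; exact: sb].
Qed.

End CauchyFormula.

(** * An opaque complex derivative *)

Section ComplexDerivative.
Context {R : realType}.
Implicit Types (z w l : R[i]) (f g : R[i] -> R[i]) (r : R).

(* Unification would otherwise unfold [derive1] down to limits of filters each
   time it compares the derivatives of two distinct functions. *)
Definition cd : (R[i] -> R[i]) -> R[i] -> R[i] := locked (@derive1 R[i] R[i]).

Lemma cdE : cd = @derive1 R[i] R[i].
Proof. by rewrite /cd -lock. Qed.

Definition cdiff f z := dwithin setT f z (cd f z).

Lemma cdiffP f z : derivable f z 1 <-> cdiff f z.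
Proof.
rewrite /cdiff cdE; split; first exact: derive_dwithin.
by move=> h; exact: (dwithin_derive h).1.
Qed.

Lemma cdiff_cd f z l : dwithin setT f z l -> cdiff f z /\ cd f z = l.
Proof.
move=> h; have [h1 h2] := dwithin_derive h.
by split; [exact/cdiffP|rewrite cdE].
Qed.

Lemma cdiff_dwithin f z : cdiff f z -> dwithin setT f z (cd f z).
Proof. by []. Qed.

Definition hol f z r := forall w, cball z r w -> cdiff f w.

Lemma hol_derivable f z r : hol f z r -> forall w, cball z r w -> derivable f w 1.
Proof. by move=> h w hw; apply/cdiffP; exact: h. Qed.

Lemma cdiff_cd_hol f z r : hol f z r -> hol (cd f) z r.
Proof.
move=> /hol_derivable h w hw; apply/cdiffP; rewrite cdE.
exact: holomorphic_derive h w hw.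
Qed.

Lemma cdiff_bound f z0 r r1 (M : R) : hol f z0 r -> 0 < r1 < r ->
  (forall w, sphere_at z0 r1 w -> normc (f w) <= M) ->
  forall z, normc (z - z0) < r1 -> normc (f z) <= M * r1 / (r1 - normc (z - z0)).
Proof. by move=> /hol_derivable h; exact: cauchy_bound h. Qed.

Lemma cdiff_estimate f z r (M : R) : 0 < r -> hol f z r ->
  (forall w, cball z r w -> normc (f w) <= M) -> normc (cd f z) <= 2 * M / r.
Proof. by move=> r0 /hol_derivable h; rewrite cdE; exact: cauchy_estimate h. Qed.

Lemma quotient_cdiff F f z0 r z :
  (forall w, cball z0 r w -> dwithin setT F w (f w)) ->
  cball z0 r z -> cdiff f z ->
  hol (fun w => if w == z then f z else (F w - F z) / (w - z)) z0 r.
Proof.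
move=> hF hz /cdiffP hf w hw; apply/cdiffP.
exact: quotient_derivable hF hz hf w hw.
Qed.

End ComplexDerivative.

(** * Zeros, open mapping and Bloch's theorem *)

Section HolomorphicFunctions.
Context {R : realType}.
Implicit Types (x y z w l : R[i]) (f g h V : R[i] -> R[i]) (r : R).

Lemma cball_center z r : 0 < r -> cball z r z.
Proof. by move=> r0; rewrite /cball /= subrr normc0. Qed.

Lemma cball_le z w r r' : normc (w - z) + r' <= r -> cball w r' `<=` cball z r.
Proof.
by move=> h u; rewrite /cball /= => hu; have := normc_dist u w z; lra.
Qed.

Lemma hol_sub f z w r r' : normc (w - z) + r' <= r -> hol f z r -> hol f w r'.
Proof. by move=> h hf u hu; apply: hf; exact: cball_le hu. Qed.

Lemma hol_dwithin f z r w : hol f z r -> cball z r w ->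
  dwithin setT f w (cd f w).
Proof. by move=> hf hw; apply: cdiff_dwithin; exact: hf. Qed.

Lemma cdiff_ext f g z r : 0 < r -> (forall w, cball z r w -> f w = g w) ->
  cdiff f z -> cdiff g z /\ cd g z = cd f z.
Proof.
move=> r0 fg df; apply: cdiff_cd.
apply: (@dwithin_near _ _ f _ _ _ r) => //.
- by move=> w _; exact: fg.
- by apply: fg; exact: cball_center.
Qed.

Lemma cdiffD f g z : cdiff f z -> cdiff g z ->
  cdiff (fun w => f w + g w) z /\
  cd (fun w => f w + g w) z = cd f z + cd g z.
Proof.
by move=> hf hg; apply: cdiff_cd; apply: dwithinD; exact: cdiff_dwithin.
Qed.

Lemma cdiffB f g z : cdiff f z -> cdiff g z ->
  cdiff (fun w => f w - g w) z /\
  cd (fun w => f w - g w) z = cd f z - cd g z.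
Proof.
by move=> hf hg; apply: cdiff_cd; apply: dwithinB; exact: cdiff_dwithin.
Qed.

Lemma cdiffM f g z : cdiff f z -> cdiff g z ->
  cdiff (fun w => f w * g w) z /\
  cd (fun w => f w * g w) z = cd f z * g z + f z * cd g z.
Proof.
by move=> hf hg; apply: cdiff_cd; apply: dwithinM; exact: cdiff_dwithin.
Qed.

Lemma cdiff_cst k z : cdiff (fun=> k) z /\ cd (fun=> k : R[i]) z = 0.
Proof. by apply: cdiff_cd; exact: dwithin_cst. Qed.

Lemma cdiffV f z : f z != 0 -> cdiff f z ->
  cdiff (fun w => (f w)^-1) z.
Proof.
by move=> fz /cdiff_dwithin h; have [] := cdiff_cd (dwithinV fz h).
Qed.

Lemma cdiff_comp f g z : cdiff f z -> cdiff g (f z) ->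
  cdiff (fun w => g (f w)) z /\
  cd (fun w => g (f w)) z = cd g (f z) * cd f z.
Proof.
move=> /cdiff_dwithin hf /cdiff_dwithin hg; apply: cdiff_cd.
exact: dwithin_comp hf hg _.
Qed.

Lemma cdiff_cont f z : cdiff f z -> forall e : R, 0 < e ->
  exists2 d : R, 0 < d & forall w, normc (w - z) < d -> normc (f w - f z) < e.
Proof.
move=> /cdiff_dwithin h e e0; have [d d0 hd] := dwithin_cont h e0.
by exists d => // w; exact: hd.
Qed.

Lemma cdiff_sum (n : nat) (F : 'I_n -> R[i] -> R[i]) z :
  (forall i, cdiff (F i) z) ->
  dwithin setT (fun w => \sum_(i < n) F i w) z (\sum_(i < n) cd (F i) z).
Proof.
elim: n F => [|n IH] F hF.
  rewrite big_ord0 (_ : (fun w => _) = fun=> 0); first exact: dwithin_cst.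
  by apply: funext => w; rewrite big_ord0.
rewrite big_ord_recr (_ : (fun w => _) = fun w =>
   (\sum_(i < n) F (widen_ord (leqnSn n) i) w) + F ord_max w).
  by apply: dwithinD; [apply: IH|exact: cdiff_dwithin].
by apply: funext => w; rewrite big_ord_recr.
Qed.

Lemma hol_increment f z r (A : R[i]) (c : R) : hol f z r ->
  (forall w, cball z r w -> normc (cd f w - A) <= c) ->
  forall u w, cball z r u -> cball z r w ->
  normc (f w - f u - (w - u) * A) <= c * normc (w - u).
Proof.
move=> hf hA u w hu hw.
have := @mvi R u w (fun y => f y - y * A) (fun y => cd f y - A) c.
have -> : f w - w * A - (f u - u * A) = f w - f u - (w - u) * A by ring.
apply=> y /(seg_cball hu hw) hy; last exact: hA.
have := dwithinM (dwithin_id (seg u w) y) (dwithin_cst (seg u w) A y).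
rewrite mul1r mulr0 addr0; apply: dwithinB.
by apply: dwithin_sub (hol_dwithin hf hy).
Qed.

Lemma maximum_center f z r r1 (M : R) : hol f z r -> 0 < r1 < r ->
  (forall w, sphere_at z r1 w -> normc (f w) <= M) -> normc (f z) <= M.
Proof.
move=> hf rr hM; have /andP[r10 _] := rr.
have := cdiff_bound hf rr hM (cball_center z r10).
by rewrite subrr normc0 subr0 mulfK // gt_eqF.
Qed.

(** If y were omitted, 1 / (f - y) would be holomorphic, of modulus above 2 / d at the centre and at
    most 2 / d on the circle, against the maximum principle. *)
Lemma hol_covers f z r r1 (d : R) y : hol f z r -> 0 < r1 < r -> 0 < d ->
  (forall w, sphere_at z r1 w -> d <= normc (f w - f z)) ->
  normc (y - f z) < d / 2 -> exists2 w, cball z r w & f w = y.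
Proof.
move=> hf rr d0 hd hy; apply: contrapT => no.
have ne w : cball z r w -> f w - y != 0.
  by move=> hw; rewrite subr_eq0; apply/eqP => E; apply: no; exists w.
have hg : hol (fun w => (f w - y)^-1) z r.
  move=> w hw; apply: (@cdiffV (fun w => f w - y)); first exact: ne.
  by have [] := cdiffB (hf w hw) (cdiff_cst y w).1.
have /andP[r10 r1r] := rr.
have zz : cball z r z by apply: cball_center; lra.
have := @maximum_center _ _ _ _ (2 / d) hg rr.
have -> : normc (f z - y)^-1 <= 2 / d <-> False.
  have n0 : 0 < normc (f z - y) by rewrite normc_gt0 ne.
  split => //; rewrite normcV; apply/negP; rewrite -ltNge.
  rewrite -[2 / d]invrK invf_div ltf_pV2 ?posrE //; last by rewrite divr_gt0.
  by rewrite normcB.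
apply=> w hw; rewrite normcV -[2 / d]invrK invf_div.
have hw' : cball z r w by move: hw; rewrite /sphere_at /cball /= => ->.
rewrite lef_pV2 ?posrE ?normc_gt0 ?ne ?divr_gt0 //.
have := hd w hw; have := normc_dist (f w) y (f z); lra.
Qed.

Lemma hol_quotient f z r : 0 < r -> hol f z r -> f z = 0 ->
  exists2 g, hol g z r & forall w, f w = (w - z) * g w.
Proof.
move=> r0 hf fz.
have zz := cball_center z r0.
exists (fun w => if w == z then cd f z else (f w - f z) / (w - z)).
  exact: (quotient_cdiff (fun w hw => hol_dwithin hf hw) zz (cdiff_cd_hol hf zz)).
move=> w; case: eqVneq => [->|wz]; first by rewrite fz subrr mul0r.
by rewrite fz subr0 mulrC divfK // subr_eq0.
Qed.

(** Zeros at z are divided out one at a time, without power series. If this never stops, f = (w -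
    z)^m g with a holomorphic g for every m, and Cauchy's bound for g gives |f(w)| <= 2 M / 2^m for
    all w within r1 / 2 of z, so f vanishes there. *)
Lemma hol_order f z r : 0 < r -> hol f z r ->
  (exists2 r' : R, 0 < r' & forall w, cball z r' w -> f w = 0) \/
  (exists m g, [/\ hol g z r, g z != 0 & forall w, f w = (w - z) ^+ m * g w]).
Proof.
move=> r0 hf; apply: contrapT => /not_orP[n1 n2].
have div m : exists2 g, hol g z r & forall w, f w = (w - z) ^+ m * g w.
  elim: m => [|m [g hg fg]].
    by exists f => // w; rewrite expr0 mul1r.
  have [gz|gz] := eqVneq (g z) 0; last by case: n2; exists m, g.
  have [k hk gk] := hol_quotient r0 hg gz; exists k => // w.
  by rewrite fg gk exprSr mulrA.
have [d d0 hd] := cdiff_cont (hf z (cball_center z r0)) ltr01.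
pose r1 := Num.min r d / 2.
have rd0 : 0 < Num.min r d by rewrite lt_min r0.
have rd1 : Num.min r d <= r by rewrite ge_min lexx.
have rd2 : Num.min r d <= d by rewrite ge_min lexx orbT.
have rr : 0 < r1 < r by rewrite /r1; apply/andP; split; lra.
have /andP[r10 r1r] := rr.
apply: n1; exists (r1 / 2); first lra.
move=> w; rewrite /cball /= => hw.
pose M := normc (f z) + 1.
have M0 : 0 < M by rewrite /M; have := normc_ge0 (f z); lra.
apply: eqc0_le => e e0.
have [m hm] := half_lt (2 * M) e0; have [g hg fg] := div m.
apply: le_trans (ltW hm).
have p1 : 0 < r1 ^+ m by rewrite exprn_gt0.
have B u : sphere_at z r1 u -> normc (g u) <= M / r1 ^+ m.
  rewrite /sphere_at /= => hu.
  have uz : normc (u - z) < d by rewrite hu /r1; lra.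
  rewrite ler_pdivlMr // mulrC -hu -normcX -normcM -fg /M.
  by have := hd u uz; have := normc_rev (f u) (f z); lra.
have hw1 : normc (w - z) < r1 by lra.
have := cdiff_bound hg rr B hw1 => G.
have G' : normc (g w) <= 2 * M / r1 ^+ m.
  apply: le_trans G _; rewrite ler_pdivrMr; last lra.
  have -> : 2 * M / r1 ^+ m * (r1 - normc (w - z)) = M / r1 ^+ m * (2 * (r1 - normc (w - z))) by ring.
  by apply: ler_wpM2l; [rewrite divr_ge0 // ltW|lra].
rewrite fg normcM normcX.
apply: (@le_trans _ _ ((r1 / 2) ^+ m * (2 * M / r1 ^+ m))).
  apply: ler_pM => //; rewrite ?exprn_ge0 ?normc_ge0 //.
  by apply: lerXn2r; rewrite ?nnegrE ?normc_ge0 //; lra.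
by rewrite expr_div_n le_eqVlt; apply/orP; left; apply/eqP; field; rewrite !gt_eqF // exprn_gt0.
Qed.

Lemma hol_order_lower f z r m g : 0 < r -> hol g z r -> g z != 0 ->
  (forall w, f w = (w - z) ^+ m * g w) ->
  exists2 d : R, 0 < d & forall w, normc (w - z) < d ->
    normc (w - z) ^+ m * (normc (g z) / 2) <= normc (f w).
Proof.
move=> r0 hg gz fg.
have g0 : 0 < normc (g z) / 2 by rewrite divr_gt0 // normc_gt0.
have [d d0 hd] := cdiff_cont (hg z (cball_center z r0)) g0.
exists d => // w wd; rewrite fg normcM normcX; apply: ler_wpM2l.
  by rewrite exprn_ge0 // normc_ge0.
by have := hd w wd; have := normc_rev (g z) (g w); rewrite (normcB (g z)); lra.
Qed.

Lemma hol_isolated f z r : 0 < r -> hol f z r ->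
  (exists2 r' : R, 0 < r' & forall w, cball z r' w -> f w = 0) \/
  (exists2 d : R, 0 < d & forall w, w != z -> normc (w - z) < d -> f w != 0).
Proof.
move=> r0 hf; have [h|[m [g [hg gz fg]]]] := hol_order r0 hf; first by left.
right; have [d d0 hd] := hol_order_lower r0 hg gz fg; exists d => // w wz wd.
rewrite -normc_gt0; apply: lt_le_trans (hd w wd).
by rewrite mulr_gt0 // ?exprn_gt0 ?divr_gt0 ?normc_gt0 // subr_eq0.
Qed.

(** The order of the zero of f - f(z) bounds it from below on small circles, so [hol_covers]
    applies. *)
Lemma hol_open f z r : 0 < r -> hol f z r ->
  (forall r' : R, 0 < r' -> exists2 w, cball z r' w & f w != f z) ->
  forall s : R, 0 < s -> exists2 d : R, 0 < d &
    forall y, normc (y - f z) < d -> exists2 w, cball z s w & f w = y.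
Proof.
move=> r0 hf nc s s0.
have hF : hol (fun w => f w - f z) z r.
  by move=> w hw; have [] := cdiffB (hf w hw) (cdiff_cst (f z) w).1.
have [[r' r'0 h]|[d d0 h]] := hol_isolated r0 hF.
  have [w /h/eqP] := nc r' r'0; rewrite subr_eq0 => /eqP ->.
  by rewrite eqxx.
have [[r' r'0 h']|[m [g [hg gz fg]]]] := hol_order r0 hF.
  have [w /h'/eqP] := nc r' r'0; rewrite subr_eq0 => /eqP ->.
  by rewrite eqxx.
have [d1 d10 hd1] := hol_order_lower r0 hg gz fg.
pose r2 := Num.min (Num.min s r) d1.
have r20 : 0 < r2 by rewrite /r2 !lt_min s0 r0.
have r2s : r2 <= s by rewrite /r2 !ge_min lexx.
have r2r : r2 <= r by rewrite /r2 !ge_min lexx ?orbT.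
have r2d : r2 <= d1 by rewrite /r2 !ge_min lexx ?orbT.
have rr : 0 < r2 / 2 < r2 by apply/andP; split; lra.
have hf2 : hol f z r2 by apply: hol_sub hf; rewrite subrr normc0; lra.
pose dl := (r2 / 2) ^+ m * (normc (g z) / 2).
have dl0 : 0 < dl.
  by rewrite /dl mulr_gt0 ?exprn_gt0 // ?divr_gt0 // normc_gt0.
exists (dl / 2); first lra.
move=> y hy; have [||w hw <-] := @hol_covers f z r2 (r2 / 2) dl y hf2 rr dl0.
- move=> w hw; have := hd1 w; rewrite (_ : normc (w - z) = r2 / 2) //.
  by apply; lra.
- exact: hy.
by exists w => //; apply: lt_le_trans r2s.
Qed.

(** f differs from its linear part by at most |A| |w - z| / 2, so on the circle of radius s / 2 it
    stays at distance at least |A| s / 4 from f(z). *)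
Lemma hol_covers_linear f z s (A : R[i]) : 0 < s -> hol f z s ->
  (forall w, cball z s w -> normc (cd f w - A) <= normc A / 2) ->
  forall y, normc (y - f z) < normc A * s / 8 -> exists2 w, cball z s w & f w = y.
Proof.
move=> s0 hf hA y hy.
have A0 : 0 < normc A.
  rewrite lt_def normc_ge0 andbT; apply/eqP => A0; move: hy.
  by rewrite A0 !mul0r ltNge normc_ge0.
have rr : 0 < s / 2 < s by apply/andP; split; lra.
apply: (@hol_covers f z s (s / 2) (normc A * s / 4) y hf rr).
- by have := mulr_gt0 A0 s0; lra.
- move=> w hw; have hw' : cball z s w by move: hw; rewrite /sphere_at /cball /= => ->; lra.
  have := hol_increment hf hA (cball_center z s0) hw'.
  have := normc_rev ((w - z) * A) (f w - f z); rewrite (normcB ((w - z) * A)).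
  rewrite normcM; move: hw; rewrite /sphere_at /= => ->; lra.
- lra.
Qed.

Lemma half_le (x : R) n k : 0 <= x -> x / 2 ^+ (n + k) <= x / 2 ^+ n.
Proof.
move=> x0; apply: ler_wpM2l => //.
by rewrite lef_pV2 ?posrE ?exprn_gt0 // ler_weXn2l ?ler1n // leq_addr.
Qed.

(* Hofer's point-picking argument replaces the maximisation of
   (s - |w - z|) |f'(w)| over a compact disc. *)
Lemma bloch f z s : 0 < s -> hol f z s -> cd f z != 0 ->
  exists2 w0, cball z s w0 & forall y,
    normc (y - f w0) < normc (cd f z) * s / 512 ->
    exists2 w, cball z s w & f w = y.
Proof.
move=> s0 hf fz; have hf' : hol (cd f) z s by exact: cdiff_cd_hol.
have hcl w (s' : R) (y : R[i]) : 0 < s' -> hol f w s' ->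
    (forall v, cball w s' v -> normc (cd f v - cd f w) <= normc (cd f w) / 2) ->
    normc (y - f w) < normc (cd f w) * s' / 8 -> exists2 u, cball w s' u & f u = y.
  by move=> s'0 hfw hA; exact: hol_covers_linear s'0 hfw hA y.
(* hiding the derivative keeps conversion tests between its values cheap *)
move: fz hf' hcl; move: (cd f) => D fz hf' hcl.
have [A AE] : exists A, A = normc (D z) by eexists; reflexivity.
have A0 : 0 < A by rewrite AE normc_gt0.
rewrite -AE.
have p2 n : 0 < (2:R) ^+ n by rewrite exprn_gt0.
(* These radii sum to s / 2, so a walk from z whose n-th step is below [rho n] stays within s / 2 of
   z. *)
pose rho n : R := s / 4 / 2 ^+ n.
have rho0 n : 0 < rho n by rewrite /rho !divr_gt0.
have rhos n : rho n <= s / 4.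
  by have := @half_le (s / 4) 0 n; rewrite expr0 divr1 add0n; apply; lra.
(* At such a point |f'| at most doubles on the disc of radius [rho n], while |f'(w)| [rho n] is at
   least |f'(z)| s / 4. Cauchy's estimate for f'' then keeps f' within |f'(w)| / 2 of f'(w) on a
   disc 16 times smaller, where [hol_covers_linear] costs a further 8: in all 512. *)
have [[n [w [hw hA hgood]]]|nogood] := pselect (exists n (w : R[i]),
   [/\ normc (w - z) <= s / 2, 2 ^+ n * A <= normc (D w) &
      forall u, cball w (rho n) u -> normc (D u) <= 2 * normc (D w)]).
  have [a aE] : exists a, a = normc (D w) by eexists; reflexivity.
  rewrite -aE in hA hgood.
  have hwz r' : r' <= rho n -> normc (w - z) + r' <= s by have := rhos n; lra.
  have a0 : 0 < a by apply: lt_le_trans hA; rewrite mulr_gt0.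
  exists w; first by rewrite /cball /=; lra.
  move=> y hy.
  have r160 : 0 < rho n / 16 by have := rho0 n; lra.
  have hf16 : hol f w (rho n / 16) by apply: hol_sub hf; apply: hwz; have := rho0 n; lra.
  have hd2 u : cball w (rho n / 16) u -> normc (cd D u) <= 8 * a / rho n.
    move=> hu; have rn2 : 0 < rho n / 2 by have := rho0 n; lra.
    have hin v : cball u (rho n / 2) v -> cball w (rho n) v.
      by apply: cball_le; move: hu; rewrite /cball /=; have := rho0 n; lra.
    have := @cdiff_estimate R D u (rho n / 2) (2 * a) rn2.
    have -> : 2 * (2 * a) / (rho n / 2) = 8 * a / rho n by field; rewrite gt_eqF.
    apply=> v /hin hv; last exact: hgood.
    by apply: hf'; apply: cball_le hv; exact: hwz.
  have hcov v : cball w (rho n / 16) v -> normc (D v - D w) <= normc (D w) / 2.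
    move=> hv.
    have hf'16 : hol D w (rho n / 16).
      by apply: hol_sub hf'; apply: hwz; have := rho0 n; lra.
    have h0 u : cball w (rho n / 16) u -> normc (cd D u - 0) <= 8 * a / rho n.
      by rewrite subr0; exact: hd2.
    have := hol_increment hf'16 h0 (cball_center w r160) hv.
    rewrite mulr0 subr0 => /le_trans; apply.
    rewrite -aE.
    have -> : a / 2 = 8 * a / rho n * (rho n / 16) by field; rewrite gt_eqF.
    apply: ler_wpM2l; last exact: ltW.
    by apply: divr_ge0; [apply: mulr_ge0 => //; exact: ltW|exact: ltW].
  have [|u hu <-] := hcl w (rho n / 16) y r160 hf16 hcov.
    apply: lt_le_trans hy _; rewrite -aE.
    have -> : A * s / 512 = 2 ^+ n * A * (rho n / 16) / 8.
      by rewrite /rho; field; rewrite gt_eqF.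
    rewrite ler_pM2r ?invr_gt0 // ler_pM2r //.
  by exists u => //; apply: cball_le hu; apply: hwz; have := rho0 n; lra.
(* Otherwise each point reached has a neighbour where |f'| more than doubles. The walk along these
   neighbours converges inside the disc, and f' would be unbounded near its limit. *)
exfalso.
have next n w : exists w', normc (w - z) <= s / 2 -> 2 ^+ n * A <= normc (D w) ->
    normc (w' - w) < rho n /\ 2 * normc (D w) < normc (D w').
  apply: contrapT => /forallNP hn; apply: nogood; exists n, w.
  have [h1 [h2 _]] : normc (w - z) <= s / 2 /\ 2 ^+ n * A <= normc (D w) /\ True.
    have := hn w => /not_implyP[h1 /not_implyP[h2 _]]; by [].
  split => // u hu; rewrite leNgt; apply/negP => hlt.
  by apply: (hn u) => _ _.
pose nx n w := projT1 (cid (next n w)).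
pose u := fix u n := if n is m.+1 then nx m (u m) else z.
have uS n : normc (u n - z) <= s / 2 -> 2 ^+ n * A <= normc (D (u n)) ->
    normc (u n.+1 - u n) < rho n /\ 2 * normc (D (u n)) < normc (D (u n.+1)).
  exact: (projT2 (cid (next n (u n)))).
have inv n : normc (u n - z) <= s / 2 - s / 2 / 2 ^+ n /\ 2 ^+ n * A <= normc (D (u n)).
  elim: n => [|n [I1 I2]]; first by rewrite /= expr0 divr1 mul1r subrr normc0 subrr -AE.
  have pp : 0 < s / 2 / 2 ^+ n by rewrite !divr_gt0.
  have [|//|J1 J2] := uS n; first by lra.
  split; last by rewrite (exprS 2) -(mulrA 2); lra.
  have := normc_dist (u n.+1) (u n) z.
  have : s / 2 / 2 ^+ n.+1 = rho n by rewrite /rho exprS; field; rewrite gt_eqF.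
  have : s / 2 / 2 ^+ n = 2 * rho n by rewrite /rho; field; rewrite gt_eqF.
  lra.
have us n : normc (u n - z) <= s / 2.
  have [I1 _] := inv n; apply: le_trans I1 _.
  have : 0 < s / 2 / 2 ^+ n by rewrite !divr_gt0.
  lra.
have [|l hl] := @geom_cvg R u (s / 4).
  by move=> n; apply: ltW; apply: (uS n _ _).1; [exact: us|exact: (inv n).2].
have lz : cball z s l.
  rewrite /cball /=; apply: (@le_lt_trans _ _ (s / 2)); last lra.
  apply: normc_le_eps => e e0; have [n hn] := half_lt (4 * (s / 4)) e0.
  have := hl n; have := us n; have := normc_dist l (u n) z; lra.
have [d d0 hd] := cdiff_cont (hf' l lz) ltr01.
have [n1 hn1] := half_lt (4 * (s / 4)) d0.
have [n2 hn2] := half_lt (normc (D l) + 1) A0.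
pose n := (n1 + n2)%N.
have un : normc (u n - l) < d.
  rewrite normcB; apply: le_lt_trans (hl n) _; apply: le_lt_trans hn1.
  by apply: half_le; lra.
have := hd _ un; have [_ I2] := inv n.
have : normc (D l) + 1 < 2 ^+ n * A.
  rewrite mulrC -ltr_pdivrMr //; apply: le_lt_trans hn2.
  rewrite /n addnC; apply: half_le; have := normc_ge0 (D l); lra.
have := normc_rev (D (u n)) (D l); lra.
Qed.

End HolomorphicFunctions.

(** * Higher derivatives along the flow of a vector field *)

Section FlowDerivatives.
Context {R : realType}.
Implicit Types (z w : R[i]) (f phi F V Phi : R[i] -> R[i]) (r rho B : R).

Definition cdn n f := iter n (@cd R) f.
Arguments cdn : simpl never.

Lemma cdnE n f : cdn n f = derive1n n f.
Proof. by rewrite /cdn cdE. Qed.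

Lemma cdnSr n f : cdn n.+1 f = cdn n (cd f).
Proof. by rewrite /cdn iterSr. Qed.

(* [vf V j] is the (j+1)-st derivative, as a function of the position, of a
   solution of x' = V x. *)
Fixpoint vf V j : R[i] -> R[i] :=
  if j is k.+1 then fun z => cd (vf V k) z * V z else V.

Lemma hol_vf V w rho j : hol V w rho -> hol (vf V j) w rho.
Proof.
move=> hV; elim: j => [|j IH] z hz; first exact: hV.
exact: (cdiffM (cdiff_cd_hol IH hz) (hV z hz)).1.
Qed.

(** Each passage to the next [vf] halves the disc and costs, by Cauchy's estimate, a factor of order
    B / rho. The constant depends on j alone, which is what makes the later estimate uniform in
    n. *)
Lemma vf_bound j : exists2 C : R, 0 <= C & forall V w rho B, 0 < rho ->
  hol V w rho -> (forall u, cball w rho u -> normc (V u) <= B) ->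
  (forall u, cball w (rho / 2 ^+ j) u -> normc (vf V j u) <= C * B * (B / rho) ^+ j) /\
  normc (cd (vf V j) w) <= 2 ^+ j.+1 * C * (B / rho) ^+ j.+1.
Proof.
have p2 n : 0 < (2:R) ^+ n by rewrite exprn_gt0.
suff [C C0 hC] : exists2 C : R, 0 <= C & forall V w rho B, 0 < rho ->
  hol V w rho -> (forall u, cball w rho u -> normc (V u) <= B) ->
  forall u, cball w (rho / 2 ^+ j) u -> normc (vf V j u) <= C * B * (B / rho) ^+ j.
  exists C => // V w rho B r0 hV hB.
  have H := hC V w rho B r0 hV hB; split => //.
  have rj : 0 < rho / 2 ^+ j by rewrite divr_gt0.
  have hvf : hol (vf V j) w (rho / 2 ^+ j).
    move=> v hv; apply: (hol_vf j hV); apply: lt_le_trans hv _.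
    by have := @half_le R rho 0 j (ltW r0); rewrite expr0 divr1 add0n.
  have := cdiff_estimate rj hvf H; congr (_ <= _).
  by rewrite !exprS; field; rewrite !gt_eqF.
elim: j => [|j [C C0 hC]].
  exists 1 => // V w rho B r0 hV hB u; rewrite expr0 divr1 mul1r mulr1; exact: hB.
exists (2 ^+ j.+2 * C); first by rewrite mulr_ge0 // ltW.
move=> V w rho B r0 hV hB u hu.
have rj : 0 < rho / 2 ^+ j.+1 by rewrite divr_gt0.
have r2 : rho / 2 ^+ j = rho / 2 ^+ j.+1 + rho / 2 ^+ j.+1.
  by rewrite exprS; field; rewrite gt_eqF.
have huj : cball u (rho / 2 ^+ j.+1) `<=` cball w (rho / 2 ^+ j).
  by apply: cball_le; move: hu; rewrite /cball /= r2; lra.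
have jr : rho / 2 ^+ j <= rho.
  by have := @half_le R rho 0 j (ltW r0); rewrite expr0 divr1 add0n.
have hvf : hol (vf V j) u (rho / 2 ^+ j.+1).
  move=> v /huj hv; apply: (hol_vf j hV); apply: lt_le_trans hv _.
  exact: jr.
have H v : cball u (rho / 2 ^+ j.+1) v -> normc (vf V j v) <= C * B * (B / rho) ^+ j.
  by move=> /huj; exact: hC.
have := cdiff_estimate rj hvf H => E.
have hur : cball w rho u.
  by apply: lt_le_trans hu _; apply: le_trans jr; rewrite r2; lra.
rewrite /= normcM.
have -> : 2 ^+ j.+2 * C * B * (B / rho) ^+ j.+1 =
   2 * (C * B * (B / rho) ^+ j) / (rho / 2 ^+ j.+1) * B.
  by rewrite !exprS; field; rewrite !gt_eqF.
apply: ler_pM => //; try exact: normc_ge0; exact: hB.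
Qed.

(** The partial Bell polynomials of Faa di Bruno's formula in phi = Phi' and its derivatives: the
    weight of the derivative of order j + 1 of the flow in the derivative of order t + 1 of the
    composite. The recursion is the product and chain rule. *)
Fixpoint flow_coef phi t j : R[i] -> R[i] :=
  if t is s.+1 then fun z => cd (flow_coef phi s j) z +
    (if j is k.+1 then flow_coef phi s k z * phi z else 0)
  else if j is 0%N then phi else fun=> 0.

Lemma hol_flow_coef phi z r t j : hol phi z r -> hol (flow_coef phi t j) z r.
Proof.
move=> hp; elim: t j => [|t IH] [|j] w hw.
- exact: hp.
- exact: (cdiff_cst 0 w).1.
- exact: (cdiffD (cdiff_cd_hol (IH 0%N) hw) (cdiff_cst 0 w).1).1.
have [h _] := cdiffM (IH j w hw) (hp w hw).
exact: (cdiffD (cdiff_cd_hol (IH j.+1) hw) h).1.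
Qed.

Lemma flow_coef_gt phi t j : (t < j)%N -> flow_coef phi t j = fun=> 0.
Proof.
elim: t j => [|t IH] [|j] //= tj; apply: funext => z.
rewrite IH; last exact: ltnW.
by rewrite (cdiff_cst 0 z).2 IH // mul0r addr0.
Qed.

Lemma flow_coef0 phi t : flow_coef phi t 0 = cdn t phi.
Proof.
elim: t => [//|t IH] /=; apply: funext => z.
by rewrite addr0 IH.
Qed.

(** Since F' = phi V(F), differentiating [vf V j] at F gives phi times [vf V j.+1] at F, which is
    the recursion of [flow_coef]. *)
Lemma cdn_flow phi F V z r w rho : hol phi z r -> hol F z r -> hol V w rho ->
  (forall u, cball z r u -> cball w rho (F u)) ->
  (forall u, cball z r u -> cd F u = phi u * V (F u)) ->
  forall t u, cball z r u ->
  cdn t.+1 F u = \sum_(j < t.+1) flow_coef phi t j u * vf V j (F u).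
Proof.
move=> hp hF hV hFV dF; elim=> [|t IH] u hu.
  by rewrite big_ord_recl big_ord0 addr0; exact: dF.
have ru : 0 < r - normc (u - z) by move: hu; rewrite /cball /=; lra.
have FE v : cball u (r - normc (u - z)) v ->
   \sum_(j < t.+1) flow_coef phi t j v * vf V j (F v) = cdn t.+1 F v.
  move=> hv; rewrite IH //; apply: cball_le hv.
  by rewrite addrC subrK.
have hd (j : 'I_t.+1) : cdiff (fun v => flow_coef phi t j v * vf V j (F v)) u /\
   cd (fun v => flow_coef phi t j v * vf V j (F v)) u =
   cd (flow_coef phi t j) u * vf V j (F u) +
   flow_coef phi t j u * phi u * vf V j.+1 (F u).
  have [h1 h2] := cdiff_comp (hF u hu) (hol_vf j hV (hFV u hu)).
  have [h3 h4] := cdiffM (hol_flow_coef t j hp hu) h1.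
  by split; [exact: h3|rewrite h4 h2 (dF u hu) /=; ring].
have hs := cdiff_sum (fun j => (hd j).1).
have [h1 h2] := cdiff_cd hs.
have [_ h3] := cdiff_ext ru FE h1.
rewrite -[LHS]/(cd (cdn t.+1 F) u) h3 h2.
under eq_bigr => j _ do rewrite (hd j).2.
rewrite big_split /=.
under [RHS]eq_bigr => j _ do rewrite mulrDl.
rewrite [RHS]big_split /=; congr (_ + _).
  rewrite [RHS]big_ord_recr /= flow_coef_gt // (cdiff_cst 0 u).2 mul0r addr0.
  by [].
by rewrite [RHS]big_ord_recl /= mul0r add0r.
Qed.

Lemma normc_sum (n : nat) (a : 'I_n -> R[i]) :
  normc (\sum_(i < n) a i) <= \sum_(i < n) normc (a i).
Proof.
elim: n a => [|n IH] a; first by rewrite !big_ord0 normc0.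
rewrite !big_ord_recr /=; apply: le_trans (normcD_le _ _) _.
by apply: lerD.
Qed.

Lemma family_bound (G : nat -> R[i] -> R[i]) z n :
  (forall j, cdiff (G j) z) -> exists K r, [/\ 0 <= K, 0 < r &
    forall j w, (j < n)%N -> cball z r w -> normc (G j w) <= K].
Proof.
move=> hG; elim: n => [|n [K [r [K0 r0 h]]]]; first by exists 0, 1.
have [d d0 hd] := cdiff_cont (hG n) ltr01.
exists (Num.max K (normc (G n z) + 1)), (Num.min r d); split.
- by rewrite le_max K0.
- by rewrite lt_min r0.
move=> j w; rewrite /cball /= ltnS lt_min le_max leq_eqVlt => /orP[/eqP ->|jn] /andP[wr wd].
  by have := hd w wd; have := normc_rev (G n w) (G n z) => h1 h2; apply/orP; right; lra.
by rewrite h.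
Qed.

(** M and r' are chosen before F, V, rho and B, which will vary with n. Dividing the expansion of
    F^(t+1) by F' = Phi' V(F), the term of index 0 is exactly the quotient for Phi; each other term
    is a bounded coefficient times a positive power of B / rho, and B / rho <= 1 reduces it to the
    first power. *)
Lemma flow_estimate Phi z0 r t : 0 < r -> hol Phi z0 r -> cd Phi z0 != 0 ->
  exists M r', [/\ 0 <= M, 0 < r' & forall z F V (d rho B : R),
    cball z0 r' z -> 0 < d -> hol F z d -> 0 < rho -> hol V (F z) rho ->
    (forall u, cball (F z) rho u -> normc (V u) <= B) ->
    (forall u, cball z d u -> cd F u = cd Phi u * V (F u)) ->
    V (F z) != 0 -> B / rho <= 1 ->
    normc (cdn t.+1 F z / cd F z - cdn t.+1 Phi z / cd Phi z)
      <= M * (B / rho)].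
Proof.
move=> r0 hPhi dPhi.
have hphi : hol (cd Phi) z0 r by exact: cdiff_cd_hol.
have DE z : cdn t.+1 Phi z = cdn t (cd Phi) z.
  by rewrite cdnSr.
move: hphi dPhi; set phi := cd Phi => hphi dPhi.
have zz := cball_center z0 r0.
have hfc j : cdiff (fun z => flow_coef phi t j.+1 z / phi z) z0.
  have hi := cdiffV dPhi (hphi _ zz).
  exact: (cdiffM (hol_flow_coef t j.+1 hphi zz) hi).1.
have [K [r1 [K0 r10 hK]]] := family_bound t hfc.
have n0 : 0 < normc (phi z0) by rewrite normc_gt0.
have [r2 r20 hr2] := cdiff_cont (hphi _ zz) n0.
pose C j := projT1 (cid2 (vf_bound j)).
have C0 j : 0 <= C j by rewrite /C; case: cid2.
have hC j V w rho B : 0 < rho -> hol V w rho ->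
   (forall u, cball w rho u -> normc (V u) <= B) ->
   normc (cd (vf V j) w) <= 2 ^+ j.+1 * C j * (B / rho) ^+ j.+1.
  move=> h1 h2 h3; rewrite /C; case: cid2 => /= c _ h.
  exact: (h V w rho B h1 h2 h3).2.
exists (\sum_(j < t) K * (2 ^+ j.+1 * C j)), (Num.min (r / 2) (Num.min r1 r2)); split.
- by apply: sumr_ge0 => j _; rewrite !mulr_ge0 // exprn_ge0.
- by rewrite !lt_min r10 r20 divr_gt0.
move=> z F V d rho B hz d0 hF rho0 hV hB dF Vz Br.
move: hz; rewrite /cball /= !lt_min => /and3P[hz0 hz1 hz2].
have phiz : phi z != 0.
  apply/eqP => E; have := hr2 z hz2; rewrite E sub0r normcN ltxx.
  by [].
have [d1 d10 hd1] := cdiff_cont (hF z (cball_center z d0)) rho0.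
pose d2 := Num.min (Num.min d d1) (r / 2).
have d20 : 0 < d2 by rewrite !lt_min d0 d10 divr_gt0.
have d2d : d2 <= d by rewrite /d2 !ge_min lexx.
have d2d1 : d2 <= d1 by rewrite /d2 !ge_min lexx !orbT.
have d2r : d2 <= r / 2 by rewrite /d2 !ge_min lexx !orbT.
have h1 : hol phi z d2 by apply: hol_sub hphi; lra.
have h2 : hol F z d2 by apply: hol_sub hF; rewrite subrr normc0; lra.
have h3 u : cball z d2 u -> cball (F z) rho (F u).
  by move=> hu; apply: hd1; apply: lt_le_trans d2d1.
have h4 u : cball z d2 u -> cd F u = phi u * V (F u).
  by move=> hu; apply: dF; apply: lt_le_trans d2d.
have zd := cball_center z d20.
have E := cdn_flow h1 h2 hV h3 h4 t zd.
rewrite E (h4 z zd) DE big_ord_recl /= flow_coef0.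
have X : (cdn t phi z * V (F z) +
   \sum_(i < t) flow_coef phi t (bump 0 i) z * (cd (vf V i) (F z) * V (F z))) / (phi z * V (F z))
   - cdn t phi z / phi z = \sum_(i < t) (flow_coef phi t i.+1 z / phi z) * cd (vf V i) (F z).
  rewrite [in LHS](_ : \sum_(i < t) _ = (\sum_(i < t) (flow_coef phi t i.+1 z / phi z) * cd (vf V i) (F z)) * (phi z * V (F z))).
    by field; rewrite phiz Vz.
  rewrite big_distrl /=; apply: eq_bigr => i _; rewrite /bump /= add1n.
  by field.
rewrite X; apply: le_trans (normc_sum _) _.
have B0 : 0 <= B by apply: le_trans (normc_ge0 _) (hB _ (cball_center (F z) rho0)).
have Br0 : 0 <= B / rho by rewrite divr_ge0 // ltW.
rewrite mulr_suml; apply: ler_sum => i _; rewrite normcM -mulrA.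
apply: ler_pM; try exact: normc_ge0; first by apply: hK.
apply: le_trans (hC i V (F z) rho B rho0 hV hB) _.
apply: ler_wpM2l; first by rewrite mulr_ge0 // exprn_ge0.
rewrite exprS -[leRHS]mulr1; apply: ler_wpM2l => //.
exact: exprn_ile1.
Qed.

End FlowDerivatives.

(** * The chordal metric *)

Section ChordalMetric.
Context {R : realType}.
Implicit Types (z w : R[i]) (e : R).

Definition stereo z : R := Num.sqrt (1 + normc z ^+ 2).

Lemma stereoE z : sqrtC (1 + `|z| ^+ 2) = (stereo z)%:C.
Proof.
have h : 0 <= 1 + normc z ^+ 2 by rewrite addr_ge0 // sqr_ge0.
have -> : 1 + `|z| ^+ 2 = (stereo z)%:C ^+ 2.
  by rewrite normC_normc -!rmorphXn /stereo sqr_sqrtr // rmorphD rmorph1.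
by rewrite sqrCK // ler0c sqrtr_ge0.
Qed.

Lemma stereo_ge1 z : 1 <= stereo z.
Proof. by rewrite -[X in X <= _]sqrtr1 ler_wsqrtr // lerDl sqr_ge0. Qed.

Lemma stereo_le z : stereo z <= 1 + normc z.
Proof.
have n0 := normc_ge0 z.
rewrite -[leRHS]ger0_norm; last by lra.
rewrite -sqrtr_sqr ler_wsqrtr // sqrrD expr1n mul1r -addrA lerD2l lerDr.
by rewrite mulrn_wge0.
Qed.

Lemma chordal_fin z w : chordal (Some z) (Some w) =
  (2 * normc (z - w) / (stereo z * stereo w))%:C.
Proof.
rewrite /chordal !stereoE normC_normc -[2 in LHS](rmorph_nat (real_complex R)).
by rewrite -!rmorphM -fmorphV -rmorphM.
Qed.

Lemma chordal_inf z : chordal (Some z) None = (2 / stereo z)%:C.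
Proof.
by rewrite /chordal stereoE -[2 in LHS](rmorph_nat (real_complex R)) -fmorphV -rmorphM.
Qed.

Lemma chordal_infl z : chordal None (Some z) = (2 / stereo z)%:C.
Proof. exact: chordal_inf. Qed.

Lemma chordal_refl (x : sphere R) : chordal x x = 0.
Proof.
by case: x => [z|//]; rewrite chordal_fin subrr normc0 mulr0 mul0r rmorph0.
Qed.

Lemma chordal_le z w : chordal (Some z) (Some w) <= (2 * normc (z - w))%:C.
Proof.
rewrite chordal_fin lecR ler_pdivrMr; last first.
  by apply: mulr_gt0; apply: lt_le_trans (stereo_ge1 _).
rewrite ler_peMr // ?mulr_ge0 ?normc_ge0 //.
by rewrite -[1]mulr1; apply: ler_pM => //; exact: stereo_ge1.
Qed.

Lemma chordal_near z e : 0 < e -> exists2 d : R, 0 < d & forall x : sphere R,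
  chordal x (Some z) < d%:C -> exists2 w, x = Some w & normc (w - z) < e.
Proof.
move=> e0; have s1 := stereo_ge1 z.
have [k kE] : exists k, k = stereo z by eexists; reflexivity.
rewrite -kE in s1.
have k0 : 0 < k by lra.
have n0 := normc_ge0 z.
pose K := k * (1 + normc z) + 1.
have K1 : 0 <= k * (1 + normc z) by apply: mulr_ge0; lra.
have K0 : 0 < K by rewrite /K; lra.
(* The bound [1 / k] excludes infinity and forces |w - z| < 1 + |z|, hence bounds the factor of w in
   the chordal distance; [e / K] then gives |w - z| < e. *)
exists (Num.min (1 / k) (e / K)); first by rewrite lt_min !divr_gt0.
case=> [w|]; last first.
  rewrite chordal_infl ltcR lt_min -kE => /andP[].
  by rewrite ltr_pdivrMr // divfK ?gt_eqF //; lra.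
rewrite chordal_fin ltcR -kE lt_min => /andP[].
have sw1 := stereo_ge1 w; have swl := stereo_le w.
have wz : stereo w <= 1 + normc z + normc (w - z).
  by have := normc_rev w z; lra.
have nn := normc_ge0 (w - z).
have [n nE] : exists n, n = normc (w - z) by eexists; reflexivity.
rewrite -nE in wz nn *; move: sw1 wz nn; move: (stereo w) => t sw1 wz nn.
have tk : 0 < t * k by apply: mulr_gt0; lra.
rewrite !ltr_pdivrMr // (_ : 1 / k * (t * k) = t); last by field; rewrite gt_eqF.
move=> h1; rewrite (_ : e / K * (t * k) = e * (t * k) / K); last by ring.
rewrite ltr_pdivlMr // => h2; exists w => //.
rewrite -nE -(ltr_pM2r K0).
have : e * (t * k) <= e * (2 * (k * (1 + normc z))).
  apply: ler_wpM2l; first exact: ltW.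
  have : t * k <= (2 * (1 + normc z)) * k by apply: ler_wpM2r; lra.
  lra.
have -> : e * K = e * (k * (1 + normc z)) + e by rewrite /K; ring.
have -> : e * (2 * (k * (1 + normc z))) = 2 * (e * (k * (1 + normc z))) by ring.
rewrite -[2 * n * K]mulrA in h2.
move: h2; move: (n * K) (e * (t * k)) (e * (k * (1 + normc z))) => x1 x2 x3; lra.
Qed.

Lemma chordal_far e : 0 < e -> exists2 d : R, 0 < d & forall w,
  chordal (Some w) None < d%:C -> e < normc w.
Proof.
move=> e0; exists (2 / (1 + e)); first by rewrite divr_gt0 //; lra.
move=> w; rewrite chordal_inf ltcR.
have sw1 := stereo_ge1 w; have swl := stereo_le w; have sw0 : 0 < stereo w by lra.
rewrite ltr_pdivrMr // mulrAC ltr_pdivlMr; last lra.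
by rewrite ltr_pM2l //; lra.
Qed.

(** Needed to push limit functions forward under f: the limit at a point of the image must not
    depend on the chosen preimage. *)
Lemma chordal_lim_unique (x : nat -> sphere R) (a b : sphere R) :
  (forall e : R[i], 0 < e -> exists N, forall n, (N <= n)%N -> chordal (x n) a < e) ->
  (forall e : R[i], 0 < e -> exists N, forall n, (N <= n)%N -> chordal (x n) b < e) ->
  a = b.
Proof.
have fin z : (forall e : R[i], 0 < e -> exists N, forall n, (N <= n)%N -> chordal (x n) (Some z) < e) ->
  forall e : R, 0 < e -> exists N, forall n, (N <= n)%N -> exists2 w, x n = Some w & normc (w - z) < e.
  move=> h e e0; have [d d0 hd] := chordal_near z e0.
  have [|N hN] := h d%:C; first by rewrite ltcR.
  by exists N => n /hN/hd.
have finf z : (forall e : R[i], 0 < e -> exists N, forall n, (N <= n)%N -> chordal (x n) (Some z) < e) ->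
  (forall e : R[i], 0 < e -> exists N, forall n, (N <= n)%N -> chordal (x n) None < e) -> False.
  move=> h1 h2; have [N1 hN1] := fin z h1 1 ltr01.
  have M0 : 0 < normc z + 1 by have := normc_ge0 z; lra.
  have [d d0 hd] := chordal_far M0.
  have [|N2 hN2] := h2 d%:C; first by rewrite ltcR.
  have [w wE wz] := hN1 (maxn N1 N2) (leq_maxl _ _).
  have := hN2 (maxn N1 N2) (leq_maxr _ _); rewrite wE => /hd.
  by have := normc_rev w z; lra.
case: a => [a|]; case: b => [b|] // ha hb.
- congr Some; apply/eqP; rewrite -subr_eq0; apply/eqP; apply: eqc0_le => e e0.
  have e2 : 0 < e / 2 by lra.
  have [N1 hN1] := fin a ha _ e2; have [N2 hN2] := fin b hb _ e2.
  have [w wE wz] := hN1 (maxn N1 N2) (leq_maxl _ _).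
  have [w' wE' wz'] := hN2 (maxn N1 N2) (leq_maxr _ _).
  move: wE'; rewrite wE => -[E]; rewrite -E in wz'.
  by have := normc_dist a w b; rewrite (normcB a w); lra.
- by have := finf a ha hb.
- by have := finf b hb ha.
Qed.

End ChordalMetric.

(** * Iterates of a meromorphic function *)

Section Iterates.
Context {R : realType}.
Implicit Types (z w y a b : R[i]) (f : R[i] -> sphere R) (r e : R).

Lemma near_inftyP (P : set nat) :
  (\forall n \near \oo, P n) <-> exists N, forall n, (N <= n)%N -> P n.
Proof.
split; first by move=> [N _ h]; exists N => n Nn; exact: h.
by move=> [N h]; exists N => // n; exact: h.
Qed.

Lemma fiterS f n z : fiter f n.+1 z = obind f (fiter f n z).
Proof. by []. Qed.

Lemma fiter_Some f n z : fiter f n z <> None -> fiter f n z = Some (fiterc f n z).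
Proof. by rewrite /fiterc /finval; case: (fiter f n z). Qed.

Lemma fitercE f n z w : fiter f n z = Some w -> fiterc f n z = w.
Proof. by rewrite /fiterc => ->. Qed.

Lemma fiter_None f m n z : fiter f n z = None -> fiter f (m + n) z = None.
Proof. by move=> h; elim: m => [//|m IH]; rewrite addSn fiterS IH. Qed.

Lemma fiter_le f m n z : (m <= n)%N -> fiter f n z <> None -> fiter f m z <> None.
Proof. by move=> mn h E; apply: h; rewrite -(subnK mn) fiter_None. Qed.

Lemma fiter_add f m n z w : fiter f n z = Some w -> fiter f (m + n) z = fiter f m w.
Proof.
by move=> h; elim: m => [//|m IH]; rewrite addSn !fiterS IH.
Qed.

Lemma fiter_addc f m n z : fiter f n z <> None ->
  fiter f (m + n) z = fiter f m (fiterc f n z).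
Proof. by move=> /fiter_Some; exact: fiter_add. Qed.

Lemma fiterc_addc f m n z : fiter f n z <> None ->
  fiterc f (m + n) z = fiterc f m (fiterc f n z).
Proof. by move=> h; rewrite /fiterc fiter_addc. Qed.

Lemma near_ball z (P : set R[i]) : (\forall w \near z, P w) ->
  exists2 r, 0 < r & forall w, cball z r w -> P w.
Proof. by move=> /nbhs_normcP[r r0 h]; exists r => // w; exact: h. Qed.

Lemma mero_near f z : meromorphic f -> f z <> None -> exists2 r, 0 < r &
  (forall w, cball z r w -> f w <> None) /\ hol (finval \o f) z r.
Proof.
move=> /(_ z)[/near_ball[r r0 h] _|[//]].
exists r => //; split=> w /h[] // _ hd; exact/cdiffP.
Qed.

Lemma fiter_near f n z : meromorphic f -> fiter f n z <> None -> exists2 r, 0 < r &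
  (forall w, cball z r w -> fiter f n w <> None) /\ hol (fiterc f n) z r.
Proof.
move=> mf; elim: n => [_|n IH].
  exists 1 => //; split => // w _.
  have -> : fiterc f 0 = fun z => z by apply: funext.
  exact: (cdiff_cd (dwithin_id setT w)).1.
move=> h; have hn : fiter f n z <> None by apply: fiter_le h.
have [r r0 [h1 h2]] := IH hn.
have hf : f (fiterc f n z) <> None by move: h; rewrite fiterS fiter_Some.
have [s s0 [h3 h4]] := mero_near mf hf.
have [d d0 hd] := cdiff_cont (h2 z (cball_center z r0)) s0.
have lt1 : Num.min r d <= r by rewrite ge_min lexx.
have lt2 : Num.min r d <= d by rewrite ge_min lexx orbT.
have rd0 : 0 < Num.min r d by rewrite lt_min r0.
have b1 w : cball z (Num.min r d) w -> cball z r w by move=> hw; apply: lt_le_trans lt1.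
have b2 w : cball z (Num.min r d) w -> cball (fiterc f n z) s (fiterc f n w).
  by move=> hw; apply: hd; apply: lt_le_trans lt2.
exists (Num.min r d) => //; split => w hw.
  by rewrite fiterS (fiter_Some (h1 _ (b1 _ hw))); exact: h3 (b2 _ hw).
have [g1 g2] := cdiff_comp (h2 w (b1 w hw)) (h4 _ (b2 w hw)).
have rw : 0 < Num.min r d - normc (w - z) by move: hw; rewrite /cball /=; lra.
have [] := @cdiff_ext _ _ (fiterc f n.+1) w _ rw _ g1; last by [].
move=> v hv; have hv' : cball z (Num.min r d) v.
  by apply: cball_le hv; rewrite addrC subrK.
by rewrite [in RHS]/fiterc fiterS (fiter_Some (h1 _ (b1 _ hv'))).
Qed.

Lemma fiter_cont f n z e : meromorphic f -> fiter f n z <> None -> 0 < e ->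
  exists2 d, 0 < d & forall w, cball z d w ->
    fiter f n w <> None /\ normc (fiterc f n w - fiterc f n z) < e.
Proof.
move=> mf h e0; have [r r0 [h1 h2]] := fiter_near mf h.
have [d d0 hd] := cdiff_cont (h2 z (cball_center z r0)) e0.
exists (Num.min r d); first by rewrite lt_min r0.
move=> w; rewrite /cball /= lt_min => /andP[wr wd]; split; [exact: h1|exact: hd].
Qed.

(** An identity theorem along the segment from z to w. Whether f equals c near a point of the
    segment cannot change along a short interval: near a point where this fails, f omits c on a
    punctured disc, because zeros of f - c are isolated and |f| is large near a pole. *)
Lemma mero_identity f c z r : meromorphic f -> 0 < r ->
  (forall w, cball z r w -> f w = Some c) -> forall w, f w = Some c.
Proof.
move=> mf r0 hz w.
pose p (t : R) := z + t%:C * (w - z).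
pose C t := exists2 r, 0 < r & forall y, cball (p t) r y -> f y = Some c.
pose Q s t := (forall u, s <= u <= t -> C u) \/ (forall u, s <= u <= t -> ~ C u).
have C0 : C 0 by exists r => // y; rewrite /p rmorph0 mul0r addr0; exact: hz.
suff : Q 0 1.
  case=> [h|/(_ 0)]; last by rewrite lexx ler01 => /(_ erefl).
  have [|r1 r10 h1] := h 1; first by rewrite lexx ler01.
  have <- : p 1 = w by rewrite /p rmorph1 mul1r addrC subrK.
  by apply: h1; exact: cball_center.
apply: (@cousin _ Q).
  move=> s m t sm mt [h1|h1] [h2|h2].
  - left=> u /andP[su ut]; have [um|mu] := leP u m; first by apply: h1; rewrite su.
    by apply: h2; rewrite ut ltW.
  - by case: (h2 m); [rewrite lexx mt|apply: h1; rewrite sm lexx].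
  - by case: (h1 m); [rewrite sm lexx|apply: h2; rewrite lexx mt].
  - right=> u /andP[su ut]; have [um|mu] := leP u m; first by apply: h1; rewrite su.
    by apply: h2; rewrite ut ltW.
move=> x x01.
pose n := normc (w - z) + 1.
have n0 : 0 < n by rewrite /n; have := normc_ge0 (w - z); lra.
have close (d : R) s t u : t - s < d / n -> s <= x -> x <= t -> s <= u <= t ->
    normc (p u - p x) < d.
  rewrite ltr_pdivlMr // => ts sx xt /andP[su ut].
  have -> : p u - p x = (u - x)%:C * (w - z) by rewrite /p rmorphB; ring.
  rewrite normcM normc_real; apply: le_lt_trans ts.
  apply: ler_pM => //; rewrite ?normc_ge0 //; last by rewrite /n; lra.
  by rewrite ler_norml; apply/andP; split; lra.
have [[d d0 hd]|nC] := pselect (C x).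
  exists (d / 2 / n); first by rewrite !divr_gt0.
  move=> s t _ _ sx xt ts; left=> u su; exists (d / 2); first lra.
  move=> y hy; apply: hd; apply: cball_le hy.
  by have := close (d / 2) s t u ts sx xt su; lra.
have [d d0 hd] : exists2 d, 0 < d & forall y, y != p x -> normc (y - p x) < d -> f y <> Some c.
  have [/near_ball[d d0 hd]|[_ _ /(_ (normc c))/dnbhs_normcP[d d0 hd]]] := mf (p x).
    have hg : hol (fun y => finval (f y) - c) (p x) d.
      move=> y /hd[_ /cdiffP hy].
      exact: (cdiffB hy (cdiff_cst c y).1).1.
    have [[r' r'0 h]|[r' r'0 h]] := hol_isolated d0 hg.
      case: nC; exists (Num.min d r'); first by rewrite lt_min d0.
      move=> y; rewrite /cball /= lt_min => /andP[y1 y2].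
      have [h1 _] := hd y y1; have := h y y2; move: h1.
      by case: (f y) => [v|//] _ /= /eqP; rewrite subr_eq0 => /eqP ->.
    exists r' => // y yx yr fy; have := h y yx yr.
    by rewrite fy /= subrr eqxx.
  exists d => // y yx yd fy; have := hd y yx yd.
  by rewrite fy /= normC_normc ltcR ltxx.
exists (d / n); first by rewrite divr_gt0.
move=> s t _ _ sx xt ts; right=> u su [r1 r10 h1].
have fu : f (p u) = Some c by apply: h1; exact: cball_center.
have [E|ne] := eqVneq (p u) (p x).
  by apply: nC; exists r1 => // y; rewrite -E; exact: h1.
by apply: (hd _ ne) => //; exact: close ts sx xt su.
Qed.

(** By the identity theorem f would be the rational function c / 1, whose degree is 0. *)
Lemma admissible_nonconstant f z c r : meromorphic f -> admissible f -> 0 < r ->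
  ~ (forall w, cball z r w -> f w = Some c).
Proof.
move=> mf af r0 /(mero_identity mf r0) hc.
have [|||] := af c%:P 1.
- exact: oner_neq0.
- exact: coprimep1.
- by move=> w; rewrite /= hornerC hc oner_eq0 hornerC divr1.
move=> h _; move: h; rewrite /rational_degree size_poly1 maxn0.
by have := size_polyC_leq1 c; case: (size _) => [|[|n]].
Qed.

End Iterates.

(** * Invariance of the Fatou set and normality near attracting cycles *)

Section FatouSet.
Context {R : realType}.
Implicit Types (z w y a b : R[i]) (f : R[i] -> sphere R) (r e : R).

Lemma openP_cball (U : set R[i]) : open U <->
  forall z, U z -> exists2 r, 0 < r & cball z r `<=` U.
Proof.
rewrite openE; split=> h z Uz.
  by have /nbhs_normcP[r r0 hr] := h z Uz; exists r => // w; exact: hr.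
by have [r r0 hr] := h z Uz; apply/nbhs_normcP; exists r => // w; exact: hr.
Qed.

Lemma fatou_nbhs f z : fatou f z -> exists2 r, 0 < r & cball z r `<=` fatou f.
Proof.
move=> [U [oU Uz h1 h2]]; have [r r0 hr] := (openP_cball U).1 oU z Uz.
by exists r => // w /hr Uw; exists U.
Qed.

Lemma fatou_fin f z n : fatou f z -> fiter f n z <> None.
Proof.
move=> [U [_ Uz h _]] E; apply: (h z Uz); apply: subset_closure.
by exists n.
Qed.

Lemma open_not_closure (U A : set R[i]) : open U -> (forall z, U z -> ~ A z) ->
  U `<=` ~` closure A.
Proof.
move=> oU h z Uz cz; have [w [Aw Uw]] := cz U (open_nbhs_nbhs (conj oU Uz)).
exact: h Uw Aw.
Qed.

Lemma mero_open f z s : meromorphic f -> admissible f -> f z <> None -> 0 < s ->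
  exists2 d : R, 0 < d & forall y, cball (finval (f z)) d y ->
    exists2 w, cball z s w & f w = Some y.
Proof.
move=> mf af fz s0; have [r r0 [h1 h2]] := mero_near mf fz.
pose t := Num.min s r.
have t0 : 0 < t by rewrite lt_min s0.
have ts : t <= s by rewrite ge_min lexx.
have tr : t <= r by rewrite ge_min lexx orbT.
have [|d d0 hd] := hol_open r0 h2 _ t0.
  move=> r' r'0; apply: contrapT => no.
  have m0 : 0 < Num.min r r' by rewrite lt_min r0.
  apply: (@admissible_nonconstant R f z (finval (f z)) _ mf af m0).
  move=> w; rewrite /cball /= lt_min => /andP[wr wr'].
  have fw := h1 w wr.
  have : finval (f w) = finval (f z).
    by apply/eqP; apply: contrapT => /negP ne; apply: no; exists w.
  by move: fw; case: (f w) => [v|//] _ /= ->.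
exists d => // y /hd[w hw /= E]; exists w; first exact: lt_le_trans ts.
have := h1 w (lt_le_trans hw tr); move: E; rewrite /=.
by case: (f w) => [v|//] /= ->.
Qed.

(** The image V of a normality domain U is open, and the iterate f^m on V is f^(m+1) on U read
    through f. A limit function on U therefore descends to V; local uniformity descends because f
    maps small discs onto neighbourhoods. *)
Lemma fatou_image f z : meromorphic f -> admissible f -> fatou f z ->
  fatou f (finval (f z)).
Proof.
move=> mf af fz; have [U [oU Uz Uc nU]] := fz.
have Ufat u : U u -> fatou f u by exists U.
have Uf u : U u -> f u <> None by move=> /Ufat/(@fatou_fin _ _ 1).
pose V : set R[i] := [set y | exists2 u, U u & f u = Some y].
have oV : open V.
  apply/openP_cball => y [u Uu fu].
  have [s s0 hs] := (openP_cball U).1 oU u Uu.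
  have [d d0 hd] := mero_open mf af (Uf u Uu) s0.
  exists d => // y' hy'; have [|w /hs Uw fw] := hd y'; last by exists w.
  by move: hy'; rewrite fu.
have Vz : V (finval (f z)).
  by exists z => //; move: (Uf z Uz); case: (f z).
have shift u y n : f u = Some y -> fiter f n.+1 u = fiter f n y.
  by move=> fu; rewrite -addn1; apply: fiter_add; rewrite fiterS /= fu.
exists V; split => //.
  apply: open_not_closure => // y [u Uu fu] [n yn].
  by apply: (@fatou_fin _ _ n.+1 (Ufat u Uu)); rewrite (shift u y n fu).
move=> g hg.
have hg' n : exists m, fiter f m = g n by have [m _ E] := hg n; exists m.
pose m n := projT1 (cid (hg' n)).
have mE n : fiter f (m n) = g n by exact: projT2 (cid (hg' n)).
have [|s [h [smon hlim]]] := nU (fun n => fiter f (m n).+1).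
  by move=> n; exists (m n).+1.
(* An arbitrary choice of preimage, with no regularity; [hpre] shows that the limit does not depend
   on it. *)
pose pre y := xget z [set u | U u /\ f u = Some y].
have preP y : V y -> U (pre y) /\ f (pre y) = Some y.
  by move=> [u Uu fu]; rewrite /pre; case: xgetP => [v _ //|/(_ u)]; case.
have ptw u (e : R[i]) : U u -> 0 < e -> exists N, forall n, (N <= n)%N ->
    chordal (fiter f (m (s n)).+1 u) (h u) < e.
  move=> Uu e0; have [W Wu hW] := hlim u Uu.
  have [N hN] := (near_inftyP _).1 (hW e e0); exists N => n Nn.
  by apply: hN => //; split => //; exact: nbhs_singleton.
have hpre u y : U u -> f u = Some y -> h (pre y) = h u.
  move=> Uu fu; have [Up fp] := preP y (ex_intro2 _ _ u Uu fu).
  apply: (@chordal_lim_unique _ (fun n => fiter f (m (s n)) y)) => e e0.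
    have [N hN] := ptw _ e Up e0; exists N => n /hN.
    by rewrite (shift _ _ _ fp).
  have [N hN] := ptw _ e Uu e0; exists N => n /hN.
  by rewrite (shift _ _ _ fu).
exists s, (fun y => h (pre y)); split => // y0 [u0 Uu0 fu0].
have [W Wu hW] := hlim u0 Uu0.
have [t t0 ht] := (nbhs_normcP _ _).1 Wu.
have [t' t'0 ht'] := (openP_cball U).1 oU u0 Uu0.
have tt : 0 < Num.min t t' by rewrite lt_min t0.
have [d d0 hd] := mero_open mf af (Uf u0 Uu0) tt.
exists (cball y0 d); first by apply/nbhs_normcP; exists d.
move=> e e0; apply: filterS (hW e e0) => n hn y [Vy yd].
have [|w] := hd y; first by rewrite fu0.
rewrite /cball /= lt_min => /andP[wt wt'] fw.
have Uw : U w by exact: ht'.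
rewrite -mE -(shift w y _ fw) (hpre w y Uw fw).
by apply: hn; split => //; exact: ht.
Qed.

Lemma subsequence (Q : nat -> Prop) : (forall N, exists2 n, (N <= n)%N & Q n) ->
  exists s : nat -> nat, (forall m n, (m < n)%N -> (s m < s n)%N) /\ forall n, Q (s n).
Proof.
move=> h; have h' N : exists n, (N <= n)%N /\ Q n by have [n] := h N; exists n.
pose nx N := projT1 (cid (h' N)).
have nxP N : (N <= nx N)%N /\ Q (nx N) by exact: projT2 (cid (h' N)).
pose s := fix s n := if n is k.+1 then nx (s k).+1 else nx 0%N.
have mono n : (s n < s n.+1)%N by have [] := nxP (s n).+1.
exists s; split; last by case=> [|n]; [exact: (nxP 0%N).2|exact: (nxP (s n).+1).2].
move=> m n; elim: n => [//|n IH]; rewrite ltnS leq_eqVlt => /orP[/eqP ->|/IH h1].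
  exact: mono.
exact: ltn_trans h1 (mono n).
Qed.

(** A common interface for discs about hyperbolic points and for petals; b need not lie in U, as for
    petals, where it is a boundary point. *)
Definition attracted f p b (U : set R[i]) := [/\ open U,
  forall z, U z -> exists2 w, fiter f p z = Some w & U w &
  forall e, 0 < e -> exists N, forall l z, (N <= l)%N -> U z ->
    normc (fiterc f (p * l) z - b) < e].

Lemma attracted_fin f p b U z n : (0 < p)%N -> attracted f p b U -> U z ->
  fiter f n z <> None /\ exists2 w, fiter f (p * n) z = Some w & U w.
Proof.
move=> p0 [_ hU _] Uz.
have H l : exists2 w, fiter f (p * l) z = Some w & U w.
  elim: l => [|l [w fw Uw]]; first by exists z => //; rewrite muln0.
  by have [w' fw' Uw'] := hU w Uw; exists w' => //; rewrite mulnS (fiter_add _ fw).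
split=> //; have [w fw _] := H n.
by apply: (@fiter_le _ _ _ (p * n)); [rewrite leq_pmull|rewrite fw].
Qed.

(** A sequence of iterates has infinitely many exponents in one residue class i modulo p. Either one
    quotient recurs, giving a constant subsequence, or the quotients tend to infinity and the limit
    is the constant f^i(b). *)
Lemma attracted_fatou f p b U : meromorphic f -> (0 < p)%N -> fiter f p b = Some b ->
  attracted f p b U -> U `<=` fatou f.
Proof.
move=> mf p0 fb aU z Uz; have [oU hU cU] := aU.
have fin u n : U u -> fiter f n u <> None by move=> Uu; exact: (attracted_fin n p0 aU Uu).1.
exists U; split => //.
  by apply: open_not_closure => // u Uu [n]; exact: fin.
move=> g hg.
have hg' n : exists m, fiter f m = g n by have [m _ E] := hg n; exists m.
pose m n := projT1 (cid (hg' n)).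
have mE n : fiter f (m n) = g n by exact: projT2 (cid (hg' n)).
have [i ip hi] : exists2 i, (i < p)%N & forall N, exists2 n, (N <= n)%N & (m n %% p = i)%N.
  apply: contrapT => no.
  have H i : exists N, (i < p)%N -> forall n, (N <= n)%N -> (m n %% p)%N <> i.
    have [ip|ip] := boolP (i < p)%N; last by exists 0%N.
    have : ~ forall N, exists2 n, (N <= n)%N & (m n %% p = i)%N.
      by move=> h; apply: no; exists i.
    move=> /existsNP[N hN]; exists N => _ n Nn E; apply: hN; by exists n.
  pose N i := projT1 (cid (H i)).
  pose M := \max_(i < p) N i.
  have ilt : (m M %% p < p)%N by rewrite ltn_mod.
  apply: (projT2 (cid (H (m M %% p)%N)) ilt M) => //.
  exact: (leq_bigmax (Ordinal ilt)).
have [[k hk]|nk] := pselect (exists k, forall N, exists2 n, (N <= n)%N &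
   (m n %% p = i)%N /\ (m n %/ p = k)%N).
  have [s [smon hs]] := subsequence hk.
  exists s, (fiter f (k * p + i)); split => // u _.
  exists setT; first exact: filterT.
  move=> e e0; apply/near_inftyP; exists 0%N => n _ y _ /=.
  have [h1 h2] := hs n; rewrite -mE (divn_eq (m (s n)) p) h1 h2.
  by rewrite chordal_refl.
have {}nk k : exists N, forall n, (N <= n)%N -> (m n %% p = i)%N -> (m n %/ p)%N <> k.
  have : ~ forall N, exists2 n, (N <= n)%N & (m n %% p = i)%N /\ (m n %/ p = k)%N.
    by move=> h; apply: nk; exists k.
  by move=> /existsNP[N hN]; exists N => n Nn h1 h2; apply: hN; exists n.
pose N k := projT1 (cid (nk k)).
have hN k n : (N k <= n)%N -> (m n %% p = i)%N -> (m n %/ p)%N <> k.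
  exact: projT2 (cid (nk k)) n.
have [s [smon hs]] := subsequence hi.
have sge n : (n <= s n)%N.
  by elim: n => [//|n IH]; apply: leq_ltn_trans IH (smon _ _ _).
have big K : exists M, forall n, (M <= n)%N -> (K <= m (s n) %/ p)%N.
  exists (\max_(k < K) N k) => n Mn; rewrite leqNgt; apply/negP => lt.
  apply: (hN (m (s n) %/ p)%N (s n) _ (hs n) erefl).
  apply: leq_trans (sge n); apply: leq_trans Mn.
  exact: (leq_bigmax (Ordinal lt)).
exists s, (fun=> Some (fiterc f i b)); split => // u Uu.
exists setT; first exact: filterT.
move=> e e0; have eE : e = (Re e)%:C by rewrite RRe_real // gtr0_real.
have e0' : 0 < Re e by move: e0; rewrite eE ltcR.
have fib : fiter f i b <> None by apply: fiter_le (ltnW ip) _; rewrite fb.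
have e2 : 0 < Re e / 2 by lra.
have [d d0 hd] := fiter_cont mf fib e2.
have [L hL] := cU d d0; have [M hM] := big L.
apply/near_inftyP; exists M => n Mn y [Uy _] /=.
rewrite -mE (divn_eq (m (s n)) p) hs addnC mulnC.
have finy := fin y (p * (m (s n) %/ p))%N Uy.
rewrite fiter_addc //.
have [|h1 h2] := hd (fiterc f (p * (m (s n) %/ p)) y).
  by apply: hL => //; exact: hM.
rewrite (fiter_Some h1); apply: le_lt_trans (chordal_le _ _) _.
by rewrite eE ltcR /=; lra.
Qed.

End FatouSet.

(** * The basin of a cycle *)

Section Basin.
Context {R : realType}.
Implicit Types (z w y a b : R[i]) (f : R[i] -> sphere R) (r e : R).

Lemma basinP f p a z : basin f p a z <-> fatou f z /\ exists j, forall e, 0 < e ->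
  exists N, forall n, (N <= n)%N -> normc (fiterc f (p * n + j) z - a) < e.
Proof.
split=> -[fz [j hj]]; split => //; exists j.
  move=> e e0; apply/near_inftyP.
  exact: ((cvg_normcP _ _ _).1 hj e e0).
by apply/cvg_normcP => e e0; apply/near_inftyP; exact: hj.
Qed.

Lemma basin_image f p a z : meromorphic f -> admissible f -> (0 < p)%N ->
  basin f p a z -> basin f p a (finval (f z)).
Proof.
move=> mf af p0 /basinP[fz [j hj]]; apply/basinP; split; first exact: fatou_image.
(* The index j - 1 raised by one period, so that j = 0 is covered too. *)
exists (j + p.-1)%N => e e0; have [N hN] := hj e e0; exists N => n Nn.
have -> : finval (f z) = fiterc f 1 z by [].
rewrite -fiterc_addc; last exact: fatou_fin.
have -> : (p * n + (j + p.-1) + 1 = p * n.+1 + j)%N.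
  by rewrite mulnS; have := prednK p0; move: (p * n)%N => x; lia.
by apply: hN; exact: leqW.
Qed.

Lemma basin_iter f p a z n : meromorphic f -> admissible f -> (0 < p)%N ->
  basin f p a z -> basin f p a (fiterc f n z).
Proof.
move=> mf af p0 bz; elim: n => [//|n IH].
rewrite /fiterc fiterS fiter_Some; first exact: basin_image.
by apply: fatou_fin; case/basinP: bz.
Qed.

Lemma fiterc_chain f m n z : meromorphic f -> fiter f (m + n) z <> None ->
  cd (fiterc f (m + n)) z = cd (fiterc f m) (fiterc f n z) * cd (fiterc f n) z.
Proof.
move=> mf h; have hn : fiter f n z <> None by apply: fiter_le h; rewrite leq_addl.
have hm : fiter f m (fiterc f n z) <> None by rewrite -fiter_addc.
have [r r0 [h1 h2]] := fiter_near mf hn; have [s s0 [h3 h4]] := fiter_near mf hm.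
have [g1 g2] := cdiff_comp (h2 z (cball_center z r0)) (h4 _ (cball_center _ s0)).
rewrite -g2.
have [] := @cdiff_ext _ _ (fiterc f (m + n)) z _ r0 _ g1; last by [].
by move=> w hw; rewrite fiterc_addc //; exact: h1.
Qed.

Lemma periodic_orbit f p a i : fiter f p a = Some a -> (i <= p)%N ->
  fiter f p (fiterc f i a) = Some (fiterc f i a).
Proof.
move=> fa ip; have h : fiter f i a <> None by apply: fiter_le ip _; rewrite fa.
by rewrite -(fiter_addc _ h) addnC (fiter_add _ fa) fiter_Some.
Qed.

(** Differentiate the commutation of f^p and f^i at a; the factor (f^i)'(a) can be cancelled because
    it divides the nonzero multiplier. *)
Lemma multiplier_orbit f p a i : meromorphic f -> fiter f p a = Some a -> (i <= p)%N ->
  cd (fiterc f p) a != 0 -> cd (fiterc f p) (fiterc f i a) = cd (fiterc f p) a.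
Proof.
move=> mf fa ip l0.
have fi : fiter f i a <> None by apply: fiter_le ip _; rewrite fa.
have fpi : fiter f (p + i) a <> None by rewrite addnC (fiter_add _ fa).
have fip : fiter f (i + p) a <> None by rewrite (fiter_add _ fa).
have fpi' : fiter f (p - i + i) a <> None by rewrite subnK // fa.
have E1 := fiterc_chain mf fpi; have E2 := fiterc_chain mf fip.
have E3 := fiterc_chain mf fpi'; rewrite subnK // in E3.
have i0 : cd (fiterc f i) a != 0.
  by apply: contraNneq l0 => h; rewrite E3 h mulr0.
rewrite addnC E1 (fitercE fa) mulrC in E2.
by apply: (mulfI i0); rewrite E2.
Qed.

Lemma basin_shift f p a i z : meromorphic f -> fiter f p a = Some a -> (i <= p)%N ->
  basin f p (fiterc f i a) z -> basin f p a z.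
Proof.
move=> mf fa ip /basinP[fz [j hj]]; apply/basinP; split => //.
exists (p - i + j)%N => e e0.
have fi : fiter f i a <> None by apply: fiter_le ip _; rewrite fa.
have fpi : fiter f (p - i) (fiterc f i a) <> None.
  by rewrite -(fiter_addc _ fi) subnK // fa.
have [d d0 hd] := fiter_cont mf fpi e0.
have [N hN] := hj d d0; exists N => n /hN/hd[_ H].
have -> : (p * n + (p - i + j) = p - i + (p * n + j))%N.
  by move: (p * n)%N => x; lia.
rewrite fiterc_addc; last exact: fatou_fin.
move: H; by rewrite -(fiterc_addc _ fi) subnK // (fitercE fa).
Qed.

Lemma residue_limit f p a z k : meromorphic f -> (0 < p)%N -> fiter f p a = Some a ->
  basin f p a z -> exists2 i, (i < p)%N & forall e, 0 < e ->
  exists L, forall l, (L <= l)%N -> normc (fiterc f (p * l + k) z - fiterc f i a) < e.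
Proof.
move=> mf p0 fa /basinP[fz [j hj]].
(* The residue of k - j: for l large, p l + k = i + (p n + j) for some n, so the limit is f^i of the
   limit a. *)
pose i := ((k + (p - j %% p)) %% p)%N.
have ip : (i < p)%N by rewrite ltn_mod.
have jp : (j %% p < p)%N by rewrite ltn_mod.
have ji : (j + i = k %[mod p])%N.
  rewrite /i modnDmr -modnDml addnCA [(j %% p + _)%N]addnC subnK; last exact: ltnW.
  by rewrite modnDr.
exists i => // e e0.
have fi : fiter f i a <> None by apply: fiter_le (ltnW ip) _; rewrite fa.
have [d d0 hd] := fiter_cont mf fi e0.
have [N hN] := hj d d0; exists (N + (j + i))%N => l hl.
have le1 : (j + i <= p * l + k)%N.
  apply: leq_trans (leq_addr _ _); apply: leq_trans (leq_pmull l p0).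
  by apply: leq_trans hl; exact: leq_addl.
have /dvdnP[n hn] : (p %| p * l + k - (j + i))%N.
  by rewrite -eqn_mod_dvd // mulnC modnMDl ji.
have -> : (p * l + k = i + (p * n + j))%N.
  by move: hn le1; rewrite [(n * p)%N]mulnC; move: (p * n)%N (p * l)%N => x y; lia.
have Nn : (N <= n)%N.
  rewrite -(leq_pmul2l p0) [(p * n)%N]mulnC -hn.
  have : (p * (N + (j + i)) <= p * l)%N by rewrite leq_mul2l hl orbT.
  rewrite mulnDr; have := leq_pmull (j + i) p0.
  move: (p * (j + i))%N (p * N)%N (p * l)%N => x y u; lia.
rewrite fiterc_addc; last exact: fatou_fin.
by case: (hd _ (hN n Nn)).
Qed.

Lemma geometric_small (q e : R) : 0 <= q -> q < 1 -> 0 < e ->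
  exists N, forall n, (N <= n)%N -> q ^+ n < e.
Proof.
move=> q0 q1 e0.
(* 1 - q^n is 1 - q times a sum of n powers of q, each at least q^n. *)
have H n : n%:R * (1 - q) * q ^+ n <= 1 - q ^+ n.
  elim: n => [|n IH]; first by rewrite !mul0r expr0 subrr.
  have p0 : 0 <= q ^+ n by rewrite exprn_ge0.
  have p1 : q ^+ n <= 1 by rewrite exprn_ile1 // ltW.
  have h1 : q * (n%:R * (1 - q) * q ^+ n) <= q * (1 - q ^+ n) by apply: ler_wpM2l.
  have h2 : 0 <= (1 - q) * (1 - q * q ^+ n).
    have : q * q ^+ n <= 1 * 1 by apply: ler_pM => //; exact: ltW.
    by move=> ?; apply: mulr_ge0; lra.
  have -> : n.+1%:R * (1 - q) * q ^+ n.+1 = q * (n%:R * (1 - q) * q ^+ n) + (1 - q) * (q * q ^+ n).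
    by rewrite -natr1 exprS; ring.
  rewrite exprS; move: h1 h2.
  have -> : (1 - q) * (1 - q * q ^+ n) = 1 - q - (1 - q) * (q * q ^+ n) by ring.
  have -> : q * (1 - q ^+ n) = q - q * q ^+ n by ring.
  lra.
have c0 : 0 < e * (1 - q) by apply: mulr_gt0; lra.
pose N := Num.bound `|(e * (1 - q))^-1|.
have hN : (e * (1 - q))^-1 < N%:R.
  by apply: le_lt_trans (ler_norm _) (archi_boundP (normr_ge0 _)).
exists N => n Nn.
have nN : (N%:R : R) <= n%:R by rewrite ler_nat.
have n0 : (0 : R) < n%:R.
  by apply: lt_le_trans nN; apply: le_lt_trans hN; rewrite invr_ge0 ltW.
have h1 : 1 < n%:R * (e * (1 - q)).
  by rewrite -ltr_pdivrMr // div1r; apply: lt_le_trans nN.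
have p0 : 0 <= q ^+ n by rewrite exprn_ge0.
rewrite -(ltr_pM2l (_ : 0 < n%:R * (1 - q))); last by apply: mulr_gt0 => //; lra.
apply: le_lt_trans (H n) _.
have -> : n%:R * (1 - q) * e = n%:R * (e * (1 - q)) by ring.
lra.
Qed.

(** Stated for all small radii because two are used later: a large disc contained in the basin, and
    a smaller one that the orbit enters. *)
Lemma hyperbolic_attracted f p b : meromorphic f -> (0 < p)%N -> fiter f p b = Some b ->
  normc (cd (fiterc f p) b) < 1 ->
  exists2 r0, 0 < r0 & forall r, 0 < r -> r <= r0 -> attracted f p b (cball b r).
Proof.
move=> mf p0 fb l1.
have fbn : fiter f p b <> None by rewrite fb.
have [s s0 [h1 h2]] := fiter_near mf fbn.
have e0 : 0 < (1 - normc (cd (fiterc f p) b)) / 2 by lra.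
have [d d0 hd] := h2 b (cball_center b s0) _ e0.
pose q := (1 + normc (cd (fiterc f p) b)) / 2.
have q1 : q < 1 by rewrite /q; lra.
have q0 : 0 <= q by have := normc_ge0 (cd (fiterc f p) b); rewrite /q; lra.
exists (Num.min s d); first by rewrite lt_min s0.
move=> r r0; rewrite le_min => /andP[rs rd].
have step w : cball b r w -> exists2 y, fiter f p w = Some y & normc (y - b) <= q * normc (w - b).
  move=> hw; exists (fiterc f p w).
    by apply: fiter_Some; apply: h1; exact: lt_le_trans rs.
  have := hd w I (lt_le_trans hw rd); rewrite (fitercE fb).
  have := normc_rev (fiterc f p w - b) ((w - b) * cd (fiterc f p) b).
  rewrite normcM /q; move: (normc (w - b)) (normc (cd (fiterc f p) b)) => x l.
  have -> : (1 - l) / 2 * x = x / 2 - x * l / 2 by field.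
  have -> : (1 + l) / 2 * x = x / 2 + x * l / 2 by field.
  lra.
have inB w y : cball b r w -> normc (y - b) <= q * normc (w - b) -> cball b r y.
  rewrite /cball /= => hw hy; apply: le_lt_trans hy _; apply: le_lt_trans hw.
  by rewrite ler_piMl ?normc_ge0 // ltW.
split.
- apply/openP_cball => w hw; exists (r - normc (w - b)).
    by move: hw; rewrite /cball /=; lra.
  by apply: cball_le; rewrite addrC subrK.
- by move=> w hw; have [y fy hy] := step w hw; exists y => //; exact: inB hy.
move=> e e1; have er : 0 < e / r by rewrite divr_gt0.
have [N hN] := geometric_small q0 q1 er; exists N => l z Nl hz.
suff [y fy [hy1 hy2]] : exists2 y, fiter f (p * l) z = Some y &
    cball b r y /\ normc (y - b) <= q ^+ l * r.
  rewrite (fitercE fy); apply: le_lt_trans hy2 _.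
  by rewrite -ltr_pdivlMr //; exact: hN.
elim: (l) => [|k [y fy [hy1 hy2]]].
  by exists z; [rewrite muln0|split=> //; rewrite expr0 mul1r ltW].
have [y' fy' hy'] := step y hy1; exists y'; first by rewrite mulnS (fiter_add _ fy).
split; first exact: inB hy1 hy'.
by apply: le_trans hy' _; rewrite exprS -mulrA; apply: ler_wpM2l.
Qed.

Lemma attracted_basin f p a i U : meromorphic f -> (0 < p)%N -> fiter f p a = Some a ->
  (i <= p)%N -> attracted f p (fiterc f i a) U -> U `<=` basin f p a.
Proof.
move=> mf p0 fa ip aU z Uz; apply: (basin_shift mf fa ip).
apply/basinP; split; first exact: attracted_fatou mf p0 (periodic_orbit fa ip) aU z Uz.
have [_ _ cU] := aU; exists 0%N => e e0; have [N hN] := cU e e0.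
by exists N => n Nn; rewrite addn0; exact: hN.
Qed.

(** Continuity of f^m makes one entry time m serve a whole neighbourhood, which is therefore
    contained in the basin; uniformity in the initial point comes from here. *)
Lemma basin_entry f p a i U z m : meromorphic f -> (0 < p)%N -> fiter f p a = Some a ->
  (i <= p)%N -> attracted f p (fiterc f i a) U -> fatou f z -> U (fiterc f m z) ->
  exists2 s, 0 < s & forall w, cball z s w ->
    [/\ basin f p a w, U (fiterc f m w) & forall l, U (fiterc f (p * l + m) w)].
Proof.
move=> mf p0 fa ip aU fz Uz; have [oU _ cU] := aU.
have [r r0 hr] := fatou_nbhs fz.
have [d d0 hd] := (openP_cball U).1 oU _ Uz.
have [s s0 hs] := fiter_cont mf (@fatou_fin _ _ _ m fz) d0.
exists (Num.min r s); first by rewrite lt_min r0.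
move=> w; rewrite /cball /= lt_min => /andP[wr ws].
have fw : fatou f w by exact: hr.
have Uw : U (fiterc f m w) by apply: hd; case: (hs w ws).
split => //.
  apply: (basin_shift mf fa ip); apply/basinP; split=> //; exists m => e e0.
  have [N hN] := cU e e0; exists N => n Nn.
  by rewrite fiterc_addc; [exact: hN|exact: fatou_fin].
move=> l; rewrite fiterc_addc; last exact: fatou_fin.
by have [_ [y /fitercE -> Uy]] := attracted_fin l p0 aU Uw.
Qed.

End Basin.

(** * Linearizers: Schroder ([kappa] = 0) and Abel ([mu] = 1) treated together *)

Section Linearizer.
Context {R : realType}.
Implicit Types (z w y b : R[i]) (s rho B C : R).

Context (f : R[i] -> sphere R) (p : nat) (a mu kappa : R[i]) (Phi : R[i] -> R[i]).
Context (mf : meromorphic f) (af : admissible f) (p0 : (0 < p)%N)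
  (fa : fiter f p a = Some a).
Context (Phi_hol : forall z, basin f p a z -> cdiff Phi z).
Context (Phi_eq : forall z, basin f p a z -> Phi (finval (f z)) = mu * Phi z + kappa).

Lemma linearizer_iter n : exists k, forall z, basin f p a z ->
  Phi (fiterc f n z) = mu ^+ n * Phi z + k.
Proof.
elim: n => [|n [k hk]]; first by exists 0 => z _; rewrite expr0 mul1r addr0.
exists (mu * k + kappa) => z bz.
rewrite /fiterc fiterS fiter_Some /=; last by apply: fatou_fin; case/basinP: bz.
rewrite Phi_eq; last exact: basin_iter.
by rewrite hk // exprS; ring.
Qed.

Lemma linearizer_cd n z s : 0 < s -> cball z s `<=` basin f p a ->
  cd Phi (fiterc f n z) * cd (fiterc f n) z = mu ^+ n * cd Phi z.
Proof.
move=> s0 hs; have [k hk] := linearizer_iter n.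
have bz : basin f p a z by apply: hs; exact: cball_center.
have fz : fatou f z by case/basinP: bz.
have [r r0 [h1 h2]] := fiter_near mf (@fatou_fin _ _ _ n fz).
have [g1 g2] := cdiff_comp (h2 z (cball_center z r0)) (Phi_hol (basin_iter n mf af p0 bz)).
rewrite -g2.
have h3 := dwithinD (dwithinZ (mu ^+ n) (Phi_hol bz)) (dwithin_cst setT k z).
have [g3 g4] := cdiff_cd h3.
rewrite -[RHS]addr0 -g4.
have [] := @cdiff_ext _ _ (fun w => Phi (fiterc f n w)) z _ s0 _ g3; last by [].
by move=> w hw; rewrite hk //; exact: hs.
Qed.

(** What the flow estimate asks of the field [mu ^+ n / cd Phi], for n in one residue class modulo
    p, with B / rho measured by the rate. The local dynamics only has to establish this
    predicate. *)
Definition controlled z0 k (rate : nat -> R) := exists C s L, [/\ 0 < s,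
  cball z0 s `<=` basin f p a & forall l z, (L <= l)%N -> cball z0 s z ->
  exists rho B, [/\ 0 < rho, cball (fiterc f (p * l + k) z) rho `<=` basin f p a,
    forall u, cball (fiterc f (p * l + k) z) rho u -> cd Phi u != 0 /\
      normc (mu ^+ (p * l + k) / cd Phi u) <= B,
    B / rho <= 1 & B / rho <= C * rate (p * l + k)%N]].

Lemma controlled_estimate z0 k rate t : mu != 0 -> controlled z0 k rate -> cd Phi z0 != 0 ->
  exists M s L, 0 < s /\ forall l z, (L <= l)%N -> cball z0 s z ->
    let n := (p * l + k)%N in
    normc (cdn t.+1 (fiterc f n) z / cd (fiterc f n) z - cdn t.+1 Phi z / cd Phi z)
      <= M * rate n.
Proof.
move=> mu0 [C [s [L [s0 hs hl]]]] dPhi.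
have hPhi : hol Phi z0 s by move=> w /hs; exact: Phi_hol.
have [M [s' [M0 s'0 hM]]] := flow_estimate t s0 hPhi dPhi.
exists (M * C), (Num.min s' (s / 2)), L; split; first by rewrite lt_min s'0 divr_gt0.
move=> l z Ll hz /=; set n := (p * l + k)%N.
have [zs' zs2] : cball z0 s' z /\ cball z0 (s / 2) z.
  by move: hz; rewrite /cball /= lt_min => /andP.
have zs : cball z0 s z by apply: lt_le_trans zs2 _; lra.
have [rho [B [rho0 hrho hB B1 B2]]] := hl l z Ll zs.
rewrite -/n in hrho hB B2.
have bz : basin f p a z by exact: hs.
have fz : fatou f z by case/basinP: bz.
have [r r0 [h1 h2]] := fiter_near mf (@fatou_fin _ _ _ n fz).
have [d d0 hd] := cdiff_cont (h2 z (cball_center z r0)) rho0.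
pose d1 := Num.min (Num.min r d) (s / 2).
have d10 : 0 < d1 by rewrite !lt_min r0 d0 divr_gt0.
have d1r : d1 <= r by rewrite /d1 !ge_min lexx.
have d1d : d1 <= d by rewrite /d1 !ge_min lexx !orbT.
have d1s : d1 <= s / 2 by rewrite /d1 !ge_min lexx !orbT.
pose V u := mu ^+ n / cd Phi u.
have hphi : hol (cd Phi) (fiterc f n z) rho.
  by apply: cdiff_cd_hol => u /hrho; exact: Phi_hol.
have hV : hol V (fiterc f n z) rho.
  move=> u hu; have [pu _] := hB u hu.
  exact: (cdiff_cd (dwithinZ (mu ^+ n) (cdiffV pu (hphi u hu)))).1.
have F1 : hol (fiterc f n) z d1 by move=> u hu; apply: h2; exact: lt_le_trans d1r.
have F2 u : cball (fiterc f n z) rho u -> normc (V u) <= B by move=> /hB[].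
have F3 u : cball z d1 u -> cd (fiterc f n) u = cd Phi u * V (fiterc f n u).
  move=> hu.
  have hu1 : cball (fiterc f n z) rho (fiterc f n u) by apply: hd; exact: lt_le_trans d1d.
  have [ne _] := hB _ hu1.
  have us : 0 < s - normc (u - z0).
    by have := normc_dist u z z0; move: hu zs2; rewrite /cball /=; lra.
  have := linearizer_cd n us; rewrite /V => /(_ _) E.
  rewrite mulrA [cd Phi u * _]mulrC -E; last first.
    by apply: subset_trans hs; apply: cball_le; rewrite addrC subrK.
  by rewrite mulrAC mulfV // mul1r.
have F4 : V (fiterc f n z) != 0.
  have [ne _] := hB _ (cball_center _ rho0).
  by rewrite /V mulf_neq0 // ?invr_eq0 // expf_neq0.
apply: le_trans (hM z (fiterc f n) V d1 rho B zs' d10 F1 rho0 hV F2 F3 F4 B1) _.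
by rewrite -mulrA; apply: ler_wpM2l.
Qed.

Lemma controlled_all z0 rate t : mu != 0 -> (forall n, 0 <= rate n) ->
  (forall k, (k < p)%N -> controlled z0 k rate) -> cd Phi z0 != 0 ->
  exists M s N, 0 < s /\ forall n z, (N <= n)%N -> cball z0 s z ->
    normc (cdn t.+1 (fiterc f n) z / cd (fiterc f n) z - cdn t.+1 Phi z / cd Phi z)
      <= M * rate n.
Proof.
move=> mu0 rate0 hk dPhi.
have [M [s [L [s0 h]]]] : exists M s L, 0 < s /\ forall k, (k < p)%N ->
    forall l z, (L <= l)%N -> cball z0 s z -> let n := (p * l + k)%N in
    normc (cdn t.+1 (fiterc f n) z / cd (fiterc f n) z - cdn t.+1 Phi z / cd Phi z)
      <= M * rate n.
  move: {1 3}p (leqnn p) => m; elim: m => [|m IH] mp.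
    by exists 0, 1, 0%N; split.
  have [M [s [L [s0 h]]]] := IH (ltnW mp).
  have [M' [s' [L' [s'0 h']]]] := controlled_estimate t mu0 (hk m mp) dPhi.
  exists (Num.max M M'), (Num.min s s'), (maxn L L'); split; first by rewrite lt_min s0.
  move=> k; rewrite ltnS leq_eqVlt => km l z.
  rewrite geq_max /cball /= lt_min => /andP[Ll Ll'] /andP[zs zs'].
  case/orP: km => [/eqP ->|km].
    apply: le_trans (h' l z Ll' zs') _; apply: ler_wpM2r; first exact: rate0.
    by rewrite le_max lexx orbT.
  apply: le_trans (h k km l z Ll zs) _; apply: ler_wpM2r; first exact: rate0.
  by rewrite le_max lexx.
exists M, s, (p * L)%N; split => // n z Nn hz.
have np : (n %% p < p)%N by rewrite ltn_mod.
have Ln : (L <= n %/ p)%N by rewrite leq_divRL // mulnC.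
have := h _ np (n %/ p)%N z Ln hz.
by rewrite /= mulnC -divn_eq.
Qed.

Lemma hyperbolic_controlled z0 k : 0 < normc (cd (fiterc f p) a) ->
  normc (cd (fiterc f p) a) < 1 -> mu ^+ p = cd (fiterc f p) a ->
  (forall j, (j < p)%N -> cd Phi (fiterc f j a) != 0) ->
  basin f p a z0 -> controlled z0 k (fun n => normc mu ^+ n).
Proof.
move=> l0 l1 mup dPhi bz0.
have [i ip lim] := residue_limit k mf p0 fa bz0.
set b := fiterc f i a in lim.
have fb : fiter f p b = Some b by exact: periodic_orbit (ltnW ip).
have lb : normc (cd (fiterc f p) b) < 1.
  by rewrite (multiplier_orbit mf fa (ltnW ip)) // -normc_gt0.
have [r0 r00 hr0] := hyperbolic_attracted mf p0 fb lb.
have hbas := attracted_basin mf p0 fa (ltnW ip) (hr0 r0 r00 (lexx _)).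
have hphi : hol (cd Phi) b r0.
  by apply: cdiff_cd_hol => u /hbas; exact: Phi_hol.
have c0 : 0 < normc (cd Phi b) / 2 by rewrite divr_gt0 // normc_gt0 dPhi.
have [d d0 hd] := cdiff_cont (hphi b (cball_center b r00)) c0.
(* With half the radius, a disc of radius rho about a point of [cball b rho] stays where |Phi'| is
   at least |Phi'(b)| / 2. *)
pose rho := Num.min r0 d / 2.
have m0 : 0 < Num.min r0 d by rewrite lt_min r00.
have m1 : Num.min r0 d <= r0 by rewrite ge_min lexx.
have m2 : Num.min r0 d <= d by rewrite ge_min lexx orbT.
have rho0 : 0 < rho by rewrite /rho; lra.
have aU : attracted f p b (cball b rho) by apply: hr0 => //; rewrite /rho; lra.
have [L1 hL1] := lim rho rho0.
have fz0 : fatou f z0 by case/basinP: bz0.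
have [s s0 hs] := basin_entry mf p0 fa (ltnW ip) aU fz0 (hL1 L1 (leqnn _)).
have nmu : normc mu < 1.
  rewrite ltNge; apply/negP => h; move: l1; rewrite -mup normcX ltNge.
  by rewrite exprn_ege1.
set c := normc (cd Phi b) / 2 in c0 hd.
have crho : 0 < c * rho by rewrite mulr_gt0.
(* From this rank on |mu|^n < c rho, which is the condition B / rho <= 1. *)
have [L2 hL2] := geometric_small (normc_ge0 mu) nmu crho.
exists (c * rho)^-1, s, (maxn L1 L2); split => //.
  by move=> w /hs[].
move=> l z; rewrite geq_max => /andP[Ll1 Ll2] hz.
have [bz _ hU] := hs z hz.
have := hU (l - L1)%N; rewrite addnA -mulnDr subnK // => hw.
set n := (p * l + k)%N in hw *.
have nl : (L2 <= n)%N.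
  by apply: leq_trans Ll2 _; apply: leq_trans (leq_pmull l p0) (leq_addr _ _).
have sub u : cball (fiterc f n z) rho u -> normc (u - b) < Num.min r0 d.
  move=> hu; have := normc_dist u (fiterc f n z) b.
  by move: hw hu; rewrite /cball /= /rho; lra.
have BE : normc mu ^+ n / c / rho = (c * rho)^-1 * normc mu ^+ n.
  by field; rewrite !gt_eqF.
exists rho, (normc mu ^+ n / c); split => //.
- by move=> u /sub hu; apply: hbas; exact: lt_le_trans m1.
- move=> u /sub hu; have h : c <= normc (cd Phi u).
    have := hd u (lt_le_trans hu m2); have := normc_rev (cd Phi b) (cd Phi u).
    by rewrite (normcB (cd Phi b)) /c; lra.
  split; first by rewrite -normc_gt0; lra.
  rewrite normc_div normcX; apply: ler_wpM2l; first by rewrite exprn_ge0 // normc_ge0.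
  by rewrite lef_pV2 ?posrE //; lra.
- rewrite BE mulrC ler_pdivrMr // mul1r ltW //; exact: hL2.
- by rewrite BE.
Qed.

End Linearizer.

(** * Explicit petals in an approximate Fatou coordinate *)

Section Petals.
Context {R : realType}.
Implicit Types (u w z q zeta omega : R[i]) (T eta d e : R) (G : R[i] -> R[i]).

Definition cone T zeta := `|Im zeta| < T * Re zeta.

Lemma cone_Re_gt0 T zeta : 0 < T -> cone T zeta -> 0 < Re zeta.
Proof.
by move=> T0 h; rewrite -(pmulr_rgt0 _ T0); apply: le_lt_trans h; exact: normr_ge0.
Qed.

Lemma coneD T z w : cone T z -> cone T w -> cone T (z + w).
Proof.
rewrite /cone ReD ImD mulrDr => hz hw.
by apply: le_lt_trans (ler_normD _ _) _; exact: ltrD.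
Qed.

Lemma cone_near1 T z : 0 < T -> T <= 1 -> normc (z - 1) <= T / 3 -> cone T z.
Proof.
move=> T0 T1 h; rewrite /cone.
have h1 : `|Re (z - 1)| <= T / 3 by apply: le_trans (normc_Re _) h.
have h2 : `|Im (z - 1)| <= T / 3 by apply: le_trans (normc_Im _) h.
have E : (1 : R[i]) = (1 : R)%:C by rewrite rmorph1.
move: h1 h2; rewrite ReD ImD ReN ImN E /= subr0 ler_norml => /andP[h1 _] h2.
apply: le_lt_trans h2 _.
have : T / 3 * T <= T * 1 / 3 by nra.
have : T * (1 - T / 3) <= T * Re z by apply: ler_wpM2l; lra.
lra.
Qed.

Lemma cone_scale T (r : R) z : 0 < r -> cone T (r%:C * z) <-> cone T z.
Proof.
move=> r0; rewrite /cone Re_realM Im_realM normrM (gtr0_norm r0).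
by rewrite mulrCA ltr_pM2l.
Qed.

Lemma cone_norm T z : 0 < T -> cone T z -> normc z <= (1 + T) * Re z.
Proof.
move=> T0 h; have := cone_Re_gt0 T0 h => h0; have := normc_ReIm z.
by rewrite (gtr0_norm h0); move: h; rewrite /cone; lra.
Qed.

(** For T <= 1 both vectors lie within 45 degrees of the positive axis, so their scalar product is
    positive. *)
Lemma cone_grow T z w : 0 < T -> T <= 1 -> cone T z -> cone T w ->
  normc z < normc (z + w).
Proof.
move=> T0 T1 hz hw; have z0 := cone_Re_gt0 T0 hz; have w0 := cone_Re_gt0 T0 hw.
rewrite -(@ltr_pXn2r _ 2) // ?nnegrE ?normc_ge0 // !normc_sqr ReD ImD.
have hz' : `|Im z| < Re z by apply: lt_le_trans hz _; rewrite ler_piMl // ltW.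
have hw' : `|Im w| < Re w by apply: lt_le_trans hw _; rewrite ler_piMl // ltW.
have : `|Im z * Im w| < Re z * Re w.
  by rewrite normrM; apply: ltr_pM.
rewrite ltr_norml => /andP[h _]; have := sqr_ge0 (Im w).
have : 0 < Re w ^+ 2 by rewrite exprn_gt0.
move: h; rewrite !sqrrD; lra.
Qed.

(** One factor 1 + T compares |zeta| with Re zeta; the other pays for the perturbation of both T Re
    and Im. *)
Lemma cone_stable T1 T zeta xi : 0 < T1 -> T1 < T -> cone T1 zeta ->
  normc (xi - zeta) <= normc zeta * ((T - T1) / ((1 + T) * (1 + T))) -> cone T xi.
Proof.
move=> T10 TT hz dz; have T0 : 0 < T by exact: lt_trans T10 TT.
have r0 := cone_Re_gt0 T10 hz.
have nz : normc zeta <= (1 + T) * Re zeta.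
  by apply: cone_norm => //; apply: lt_trans hz _; rewrite ltr_pM2r.
have T2 : 0 < 1 + T by rewrite addr_gt0.
have DE : Re zeta * (T - T1) / (1 + T) * (1 + T) = Re zeta * (T - T1).
  by rewrite divfK // gt_eqF.
have {}dz : normc (xi - zeta) <= Re zeta * (T - T1) / (1 + T).
  apply: le_trans dz _.
  have -> : Re zeta * (T - T1) / (1 + T) = (1 + T) * Re zeta * ((T - T1) / ((1 + T) * (1 + T))).
    by field; rewrite gt_eqF.
  apply: ler_wpM2r => //; rewrite divr_ge0 //; last by rewrite mulr_ge0 // ltW.
  by rewrite subr_ge0 ltW.
move: (Re zeta * (T - T1) / (1 + T)) DE dz => D DE dz.
have := le_trans (normc_Re (xi - zeta)) dz; have := le_trans (normc_Im (xi - zeta)) dz.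
rewrite ReD ImD ReN ImN; move: hz; rewrite /cone {nz dz}.
move: (Re zeta) (Im zeta) (Re xi) (Im xi) r0 DE => x y x' y' r0 DE hz hy hx.
have h1 : T * (x - x') <= T * D.
  by apply: ler_wpM2l; [exact: ltW|rewrite distrC in hx; exact: le_trans (ler_norm _) hx].
have h2 : `|y'| <= `|y| + D.
  by rewrite -[y'](subrK y) addrC; apply: le_trans (ler_normD _ _) _; rewrite lerD2l.
apply: le_lt_trans h2 _; rewrite -subr_gt0.
have -> : T * x' - (`|y| + D) = (T1 * x - `|y|) + (T * D - T * (x - x')) + (x * (T - T1) - D * (1 + T)).
  by ring.
by rewrite DE subrr addr0 addrC ltr_wpDl ?subr_ge0 ?subr_gt0.
Qed.

Lemma unit_pow_dist q j : normc q = 1 -> normc (q ^+ j - 1) <= j%:R * normc (q - 1).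
Proof.
move=> q1; elim: j => [|j IH]; first by rewrite expr0 subrr normc0 mul0r.
have -> : q ^+ j.+1 - 1 = q * (q ^+ j - 1) + (q - 1) by rewrite exprS; ring.
apply: le_trans (normcD_le _ _) _; rewrite normcM q1 mul1r -natr1 mulrDl mul1r.
exact: lerD.
Qed.

(** So close to 1, the geometric sum of the powers of q is within m / 2 of m; it is thus bounded
    below by 1 / 2 and can be divided out of q^m - 1. *)
Lemma unit_root_dist q m : (0 < m)%N -> normc q = 1 ->
  normc (q - 1) <= (2 * m%:R)^-1 -> normc (q - 1) <= 2 * normc (q ^+ m - 1).
Proof.
move=> m0 q1 hq; have m1 : (1 : R) <= m%:R by rewrite ler1n.
rewrite subrX1 normcM.
suff h : 1 / 2 <= normc (\sum_(i < m) q ^+ i).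
  have : normc (q - 1) * (1 / 2) <= normc (q - 1) * normc (\sum_(i < m) q ^+ i).
    by apply: ler_wpM2l => //; exact: normc_ge0.
  lra.
have E : \sum_(i < m) q ^+ i - m%:R = \sum_(i < m) (q ^+ i - 1).
  by rewrite sumrB sumr_const card_ord.
have h : normc (\sum_(i < m) q ^+ i - m%:R) <= m%:R / 2.
  rewrite E; apply: le_trans (normc_sum _) _.
  apply: (@le_trans _ _ (\sum_(i < m) (2^-1 : R))).
    apply: ler_sum => i _; apply: le_trans (unit_pow_dist i q1) _.
    have -> : (2^-1 : R) = m%:R * (2 * m%:R)^-1 by field; rewrite gt_eqF //; lra.
    apply: ler_pM => //; first exact: normc_ge0.
    by rewrite ler_nat ltnW.
  by rewrite sumr_const card_ord -[X in X <= _]mulr_natl lexx.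
have := normc_rev m%:R (\sum_(i < m) q ^+ i); rewrite (normcB m%:R) normc_nat; lra.
Qed.

Lemma dwithin_inv_pow m :
  dwithin setT (fun y : R[i] => ((1 + y) ^+ m)^-1) 0 (- m%:R).
Proof.
have g1 := dwithinX m (dwithinD (dwithin_cst setT (1 : R[i]) 0) (dwithin_id setT (0 : R[i]))).
have n1 : (1 + 0 : R[i]) ^+ m != 0 by rewrite addr0 expr1n oner_neq0.
have := @dwithinV _ setT (fun y : R[i] => (1 + y) ^+ m) 0 _ n1 g1.
congr (dwithin _ _ _ _).
by rewrite addr0 !expr1n invr1 add0r !mulr1 mulN1r.
Qed.

(* In the coordinate u, where an attraction vector sits at each m-th root of
   unity omega, [(u ^+ m)^-1] is an approximate Fatou coordinate. *)
Definition petal m omega T eta d : set R[i] := [set u |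
  [/\ 0 < normc u < d, normc (u - (normc u)%:C * omega) < eta * normc u &
      cone T (u ^+ m)^-1]].

(** The coordinate u^(-m) turns G into translation by 1 up to o(1). The construction of petals uses
    only this, and not f. *)
Definition parabolic_step m G := forall e, 0 < e -> exists2 d, 0 < d &
  forall u, 0 < normc u < d -> [/\ G u != 0, normc (G u - u) <= e * normc u &
    normc ((G u ^+ m)^-1 - (u ^+ m)^-1 - 1) <= e].

(** Write G u = u (1 + y) with y of order u^m. Expanding (1 + y)^(-m) to first order and dividing by
    u^m, the linear term -m y contributes kap u, which tends to 1. *)
Lemma parabolic_stepP m G (kap : R[i] -> R[i]) (r : R) : (0 < m)%N -> 0 < r ->
  (forall e, 0 < e -> exists2 d, 0 < d & forall u, normc u < d -> normc (kap u - 1) <= e) ->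
  (forall u, normc u < r -> G u = u * (1 - u ^+ m * kap u / m%:R)) ->
  parabolic_step m G.
Proof.
move=> m0 r0 hk hG e e0.
have m1 : (1 : R) <= m%:R by rewrite ler1n.
have mC : (m%:R : R[i]) != 0 by rewrite pnatr_eq0 -lt0n.
have e2 : 0 < Num.min (e / 2) 1 by rewrite lt_min divr_gt0 // ltr01.
have [d1 d10 h1] := hk _ e2.
have hder := dwithin_inv_pow m.
have e4 : 0 < e / 4 by lra.
have [d2 d20 h2] := hder _ e4.
pose d := Num.min (Num.min (Num.min r d1) (Num.min (d2 / 2) (e / 2))) 4^-1.
exists d; first by rewrite !lt_min r0 d10 !divr_gt0 //= invr_gt0.
move=> u /andP[u0]; rewrite /d !lt_min => /andP[/andP[/andP[ur ud1] /andP[ud2 ue]] u4].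
have k1 := h1 u ud1; have ke : normc (kap u - 1) <= e / 2.
  by apply: le_trans k1 _; rewrite ge_min lexx.
have k2 : normc (kap u) <= 2.
  have : normc (kap u - 1) <= 1 by apply: le_trans k1 _; rewrite ge_min lexx orbT.
  have := normcD_le (kap u - 1) 1; rewrite subrK normc1; lra.
have um : normc u ^+ m <= normc u.
  rewrite -(prednK m0) exprS ler_piMr //; first exact: ltW.
  by apply: exprn_ile1; [exact: ltW|lra].
have um0 : 0 <= normc u ^+ m by rewrite exprn_ge0 // ltW.
have [y yE] : exists y, y = - (u ^+ m * kap u / m%:R) by eexists; reflexivity.
have yn : normc y <= 2 * normc u ^+ m.
  rewrite yE normcN normc_div normcM normcX normc_nat ler_pdivrMr; last lra.
  have : normc u ^+ m * normc (kap u) <= normc u ^+ m * 2 by apply: ler_wpM2l.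
  have : 2 * normc u ^+ m <= 2 * normc u ^+ m * m%:R by rewrite ler_peMr // mulr_ge0.
  lra.
have GE : G u = u * (1 + y) by rewrite hG // yE.
have y1 : 1 + y != 0.
  by rewrite -normc_gt0; have := normc_rev 1 (- y); rewrite opprK normc1 normcN; lra.
have u1 : u != 0 by rewrite -normc_gt0.
split.
- by rewrite GE mulf_neq0.
- have -> : G u - u = u * y by rewrite GE; ring.
  rewrite normcM mulrC; apply: ler_wpM2r; [exact: ltW|lra].
have := h2 y I; rewrite !subr0 addr0 expr1n invr1 => /(_ _) h.
have {}h : normc (((1 + y) ^+ m)^-1 - 1 - y * - m%:R) <= e / 4 * normc y.
  by apply: h; lra.
have u2 : u ^+ m != 0 by rewrite expf_neq0.
have y2 : (1 + y) ^+ m != 0 by rewrite expf_neq0.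
have -> : (G u ^+ m)^-1 - (u ^+ m)^-1 - 1 =
   (u ^+ m)^-1 * (((1 + y) ^+ m)^-1 - 1 - y * - m%:R) + (kap u - 1).
  rewrite GE exprMn invfM mulrBr.
  have -> : (u ^+ m)^-1 * (y * - m%:R) = kap u by rewrite yE; field; rewrite mC u2.
  ring.
apply: le_trans (normcD_le _ _) _.
suff : normc ((u ^+ m)^-1 * (((1 + y) ^+ m)^-1 - 1 - y * - m%:R)) <= e / 2 by lra.
rewrite normcM normcV normcX mulrC ler_pdivrMr ?exprn_gt0 //.
apply: le_trans h _.
have -> : e / 2 * normc u ^+ m = e / 4 * (2 * normc u ^+ m) by field.
by apply: ler_wpM2l => //; lra.
Qed.

Section FixedRoot.
Context (m : nat) (m0 : (0 < m)%N) (omega : R[i]) (omega_m : omega ^+ m = 1).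

Lemma normc_root1 : normc omega = 1.
Proof.
have h : normc omega ^+ m = 1 by rewrite -normcX omega_m normc1.
by apply/eqP; rewrite -(pexpr_eq1 m0) ?normc_ge0 ?h.
Qed.

(** The sector condition only singles out the root omega; the cone condition controls the m-th power
    of the direction of u, and [unit_root_dist] turns this into 4 T. The gain from eta to 4 T pays
    for the displacement by one step in [petal_invariant]. *)
Lemma sector_improve u T eta : u != 0 -> 0 < T -> eta <= (2 * m%:R)^-1 ->
  normc (u - (normc u)%:C * omega) <= eta * normc u -> cone T (u ^+ m)^-1 ->
  normc (u - (normc u)%:C * omega) <= 4 * T * normc u.
Proof.
move=> u0 T0 he hs hc; have n0 : 0 < normc u by rewrite normc_gt0.
have o1 := normc_root1.
have oN : omega != 0 by rewrite -normc_gt0 o1.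
have nC : (normc u)%:C != 0 :> R[i] by rewrite -normc_gt0 normc_real normr_gt0 gt_eqF.
pose q := u / ((normc u)%:C * omega).
have q1 : normc q = 1.
  by rewrite /q normc_div normcM normc_real o1 mulr1 gtr0_norm // divff // gt_eqF.
have qE : normc (u - (normc u)%:C * omega) = normc u * normc (q - 1).
  have -> : u - (normc u)%:C * omega = (normc u)%:C * omega * (q - 1).
    by rewrite /q; move: ((normc u)%:C) nC => c cN; field; rewrite cN oN.
  by rewrite !normcM normc_real o1 mulr1 gtr0_norm.
rewrite qE mulrC ler_pM2r // in hs; rewrite qE [normc u * _]mulrC ler_pM2r //.
have hq : normc (q - 1) <= (2 * m%:R)^-1 by apply: le_trans hs he.
have := unit_root_dist m0 q1 hq.
suff : normc (q ^+ m - 1) <= 2 * T by lra.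
set zeta := (u ^+ m)^-1 in hc.
have z0 := cone_Re_gt0 T0 hc.
have zN : zeta != 0 by rewrite invr_neq0 // expf_neq0.
have nz : 0 < normc zeta by rewrite normc_gt0.
have qm : q ^+ m = (normc zeta)%:C / zeta.
  rewrite /q expr_div_n exprMn omega_m mulr1 /zeta invrK normcV normcX mulrC.
  by rewrite fmorphV rmorphXn.
have -> : q ^+ m - 1 = ((normc zeta)%:C - zeta) / zeta by rewrite qm; field.
rewrite normc_div ler_pdivrMr //.
have h1 := normc_ReIm zeta; rewrite (gtr0_norm z0) in h1.
have h2 : Re zeta <= normc zeta by apply: le_trans (ler_norm _) (normc_Re _).
have h3 := normc_ReIm ((normc zeta)%:C - zeta).
rewrite ReD ImD ReN ImN /= sub0r normrN ger0_norm in h3; last lra.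
have h4 : T * Re zeta <= T * normc zeta by apply: ler_wpM2l => //; exact: ltW.
by move: hc; rewrite /cone; lra.
Qed.

(** The cone and sector conditions are homogeneous, so points of the smaller petal have a margin
    proportional to |u|. The discs on which Cauchy's estimates are applied have such radii. *)
Lemma petal_deep T1 T e1 e d1 d : 0 < T1 -> T1 < T -> 0 < e -> e1 < e -> 0 < d1 -> d1 < d ->
  exists2 k : R, 0 < k & forall u w, petal m omega T1 e1 d1 u ->
    normc (w - u) < k * normc u -> petal m omega T e d w.
Proof.
move=> T10 TT e0 ee d10 dd; have T0 : 0 < T by exact: lt_trans T10 TT.
have g1 := dwithin_inv_pow m.
have TT1 : 0 < (1 + T) * (1 + T) by apply: mulr_gt0; lra.
have tau0 : 0 < (T - T1) / ((1 + T) * (1 + T)) by rewrite divr_gt0 //; lra.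
have [k1 k10 hk1] := dwithin_cont g1 tau0.
have k20 : 0 < (e - e1) / (2 + e) by rewrite divr_gt0; lra.
have k30 : 0 < (d - d1) / d1 by rewrite divr_gt0; lra.
(* In order: the cone, the sector, the outer radius, and keeping w away from 0. *)
pose k := Num.min (Num.min k1 ((e - e1) / (2 + e))) (Num.min ((d - d1) / d1) 2^-1).
exists k; first by rewrite !lt_min k10 k20 k30 invr_gt0 ltr0n.
move=> u w [/andP[u0 ud] us uc] wu.
have uN : u != 0 by rewrite -normc_gt0.
pose s := (w - u) / u.
have wE : w = u * (1 + s) by rewrite /s; field.
have sk : normc s < k by rewrite /s normc_div ltr_pdivrMr.
move: (sk); rewrite /k !lt_min => /andP[/andP[s1 s2] /andP[s3 s4]].
have wu' : normc (w - u) = normc s * normc u by rewrite /s normc_div divfK // gt_eqF.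
have w1 : normc w <= (1 + normc s) * normc u.
  by have := normcD_le (w - u) u; rewrite subrK wu'; lra.
have w2 : (1 - normc s) * normc u <= normc w.
  by have := normc_rev u w; rewrite (normcB u) wu'; lra.
have sn := normc_ge0 s.
split.
- apply/andP; split.
    by apply: lt_le_trans w2; apply: mulr_gt0 => //; lra.
  apply: le_lt_trans w1 _; rewrite ltr_pdivlMr // in s3.
  have : (1 + normc s) * normc u <= (1 + normc s) * d1 by apply: ler_wpM2l; lra.
  lra.
- have -> : w - (normc w)%:C * omega = (w - u) + (u - (normc u)%:C * omega) +
     (normc u - normc w)%:C * omega by rewrite rmorphB; ring.
  apply: le_lt_trans (normcD_le _ _) _.
  apply: le_lt_trans (lerD (normcD_le _ _) (lexx _)) _.
  rewrite normcM normc_real normc_root1 mulr1 wu'.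
  have : `|normc u - normc w| <= normc s * normc u.
    by rewrite ler_norml; apply/andP; split; lra.
  rewrite ltr_pdivlMr in s2; last lra.
  have : normc s * (2 + e) * normc u < (e - e1) * normc u by rewrite ltr_pM2r.
  have : e * ((1 - normc s) * normc u) <= e * normc w by apply: ler_wpM2l => //; exact: ltW.
  move: us; move: (normc w) (normc s) (normc u) => a b c; lra.
have zE : (w ^+ m)^-1 - (u ^+ m)^-1 = (u ^+ m)^-1 * (((1 + s) ^+ m)^-1 - 1).
  by rewrite wE exprMn invfM; ring.
have := hk1 s I; rewrite !subr0 addr0 expr1n invr1 => /(_ s1) hs.
apply: cone_stable T10 TT uc _.
by rewrite zE normcM; apply: ler_wpM2l; [exact: normc_ge0|exact: ltW].
Qed.

Lemma petal_nbhs T e d u : 0 < T -> 0 < e -> petal m omega T e d u ->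
  exists2 r, 0 < r & forall w, normc (w - u) < r -> petal m omega T e d w.
Proof.
move=> T0 e0 [/andP[u0 ud] us uc].
have r0 := cone_Re_gt0 T0 uc.
set zeta := (u ^+ m)^-1 in uc r0.
(* Parameters halfway between the values attained at u and their bounds put u in a smaller petal. *)
pose T1 := (`|Im zeta| / Re zeta + T) / 2.
have t1 : `|Im zeta| / Re zeta < T by rewrite ltr_pdivrMr.
have t0 : 0 <= `|Im zeta| / Re zeta by rewrite divr_ge0 // ltW.
pose e1 := (normc (u - (normc u)%:C * omega) / normc u + e) / 2.
have s1 : normc (u - (normc u)%:C * omega) / normc u < e by rewrite ltr_pdivrMr.
have [k k0 hk] := @petal_deep T1 T e1 e ((normc u + d) / 2) d
   ltac:(rewrite /T1; lra) ltac:(rewrite /T1; lra) e0 ltac:(rewrite /e1; lra) ltac:(lra) ltac:(lra).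
exists (k * normc u); first exact: mulr_gt0.
move=> w hw; apply: hk hw; split.
- by rewrite u0; lra.
- by rewrite -ltr_pdivrMr // /e1; lra.
- by rewrite /cone -ltr_pdivrMr // -/zeta /T1; lra.
Qed.

(** The real part of u^(-m) gains 1 / 2 at each step, hence is at least n / 2 after n steps; this is
    the decay |u|^m = O(1 / n). *)
Lemma petal_growth G T eta d : (forall u, petal m omega T eta d u ->
    petal m omega T eta d (G u) /\ Re (u ^+ m)^-1 + 1 / 2 <= Re (G u ^+ m)^-1) ->
  0 < T -> forall n u, petal m omega T eta d u ->
  petal m omega T eta d (iter n G u) /\ normc (iter n G u) ^+ m * n%:R <= 2.
Proof.
move=> inv T0 n u hu.
have H k : petal m omega T eta d (iter k G u) /\ k%:R / 2 <= Re (iter k G u ^+ m)^-1.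
  elim: k => [|k [h1 h2]] /=.
    by split=> //; rewrite mul0r; case: hu => _ _ /(cone_Re_gt0 T0)/ltW.
  by have [h3 h4] := inv _ h1; split => //; rewrite -natr1; lra.
have [h1 h2] := H n; split => //; case: h1 => /andP[n0 _] _ _.
have := le_trans h2 (le_trans (ler_norm _) (normc_Re _)).
rewrite normcV normcX => h.
have p0 : 0 < normc (iter n G u) ^+ m by rewrite exprn_gt0.
have : n%:R / 2 * normc (iter n G u) ^+ m <= 1 by rewrite -ler_pdivlMr // div1r.
rewrite [X in X <= _]mulrC; lra.
Qed.

End FixedRoot.

(** The increment of u^(-m) is near 1, so it preserves the cone and increases |u^(-m)|, that is,
    shrinks |u|. For the sector, [sector_improve] leaves 4 T, two displacements add 2 T / 3, and 8 T
    <= eta absorbs the sum. The bound d0 is uniform in omega. *)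
Lemma petal_invariant m G T eta : (0 < m)%N -> parabolic_step m G -> 0 < eta -> eta <= (2 * m%:R)^-1 ->
  0 < T -> 8 * T <= eta -> exists2 d0, 0 < d0 & forall omega d, omega ^+ m = 1 -> d <= d0 -> forall u,
    petal m omega T eta d u -> petal m omega T eta d (G u) /\
    Re (u ^+ m)^-1 + 1 / 2 <= Re (G u ^+ m)^-1.
Proof.
move=> m0 hG eta0 eta1 T0 Teta.
have m1 : (1 : R) <= m%:R by rewrite ler1n.
have eta2 : eta <= 1 / 2.
  apply: le_trans eta1 _; rewrite div1r lef_pV2 ?posrE ?mulr_gt0 //; lra.
have T1 : T <= 1 by lra.
have e0 : 0 < T / 3 by lra.
have [d0 d00 hd] := hG _ e0.
exists d0 => // omega d omega_m dd0 u [/andP[u0 ud] us uc].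
have [|Gn Gu GW] := hd u; first by rewrite u0 (lt_le_trans ud).
have uN : u != 0 by rewrite -normc_gt0.
have gn : 0 < normc (G u) by rewrite normc_gt0.
set z := (u ^+ m)^-1 in uc GW *; set z' := (G u ^+ m)^-1 in GW *.
have c1 : cone T (z' - z) by apply: cone_near1.
have c2 : cone T z' by rewrite -[z'](subrK z) addrC; exact: coneD.
have gr : normc z < normc z' by rewrite -[z'](subrK z) addrC; exact: cone_grow T0 T1 uc c1.
have sz : normc (G u) < normc u.
  rewrite -(@ltr_pXn2r _ m) ?nnegrE ?normc_ge0 //.
  by move: gr; rewrite /z /z' !normcV !normcX ltf_pV2 ?posrE ?exprn_gt0.
split; last first.
  have := le_trans (normc_Re (z' - z - 1)) GW.
  have -> : z' - z - 1 = z' - z - (1 : R)%:C by rewrite rmorph1.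
  by rewrite !ReD !ReN /= ler_norml => /andP[h _]; lra.
split => //; first by rewrite gn (lt_trans sz).
have si := sector_improve m0 omega_m uN T0 eta1 (ltW us) uc.
have -> : G u - (normc (G u))%:C * omega = (G u - u) + (u - (normc u)%:C * omega) +
   (normc u - normc (G u))%:C * omega by rewrite rmorphB; ring.
apply: le_lt_trans (normcD_le _ _) _.
apply: le_lt_trans (lerD (normcD_le _ _) (lexx _)) _.
rewrite normcM normc_real (normc_root1 m0 omega_m) mulr1 gtr0_norm; last by rewrite subr_gt0.
have r1 := normc_rev u (G u); rewrite (normcB u) in r1.
have : (4 * T + 2 * (T / 3)) * normc u < eta * (1 - T / 3) * normc u.
  rewrite ltr_pM2r //; have : eta * (T / 3) <= 1 / 2 * (T / 3) by apply: ler_wpM2r; lra.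
  lra.
have : eta * ((1 - T / 3) * normc u) <= eta * normc (G u).
  by apply: ler_wpM2l; [exact: ltW|lra].
move: Gu si r1; move: (normc (G u - u)) (normc (G u)) (normc (u - _)) => a1 a2 a3.
move: (normc u) => a4; lra.
Qed.

End Petals.

(** * Entry into petals and direction of convergence *)

Section PetalOrbits.
Context {R : realType}.
Implicit Types (u w z q zeta omega : R[i]) (T eta d e : R) (G : R[i] -> R[i]).

Lemma nat_gt (x : R) : exists N, forall n, (N <= n)%N -> x < n%:R.
Proof.
exists (Num.bound `|x|) => n hn.
apply: le_lt_trans (ler_norm x) _; apply: lt_le_trans (archi_boundP (normr_ge0 x)) _.
by rewrite ler_nat.
Qed.

Lemma cone_unit m u T : u != 0 -> 0 < T -> cone T (u ^+ m)^-1 ->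
  normc ((u / (normc u)%:C) ^+ m - 1) <= 2 * T.
Proof.
move=> u0 T0 hc; have n0 : 0 < normc u by rewrite normc_gt0.
set zeta := (u ^+ m)^-1 in hc.
have z0 := cone_Re_gt0 T0 hc.
have zN : zeta != 0 by rewrite invr_neq0 // expf_neq0.
have nz : 0 < normc zeta by rewrite normc_gt0.
have -> : (u / (normc u)%:C) ^+ m = (normc zeta)%:C / zeta.
  by rewrite expr_div_n /zeta invrK normcV normcX mulrC fmorphV rmorphXn.
have -> : (normc zeta)%:C / zeta - 1 = ((normc zeta)%:C - zeta) / zeta by field.
rewrite normc_div ler_pdivrMr //.
have h1 := normc_ReIm zeta; rewrite (gtr0_norm z0) in h1.
have h2 : Re zeta <= normc zeta by apply: le_trans (ler_norm _) (normc_Re _).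
have h3 := normc_ReIm ((normc zeta)%:C - zeta).
rewrite ReD ImD ReN ImN /= sub0r normrN ger0_norm in h3; last lra.
have h4 : T * Re zeta <= T * normc zeta by apply: ler_wpM2l => //; exact: ltW.
by move: hc; rewrite /cone; lra.
Qed.

(** Factor X^m - 1: if q were at distance at least eta from every root, the product of the distances
    would be at least eta^m. *)
Lemma near_root1 m q (eta : R) : (0 < m)%N -> 0 < eta -> normc (q ^+ m - 1) < eta ^+ m ->
  exists2 omega, omega ^+ m = 1 & normc (q - omega) < eta.
Proof.
move=> m0 eta0 hq; apply: contrapT => no.
pose P : {poly R[i]} := 'X^m - 1%:P.
have lc : lead_coef P = 1 by apply/monicP; exact: monicXnsubC.
have [rs PE] := closed_field_poly_normal P; rewrite lc scale1r in PE.
have sz : size rs = m.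
  have : size P = m.+1 by rewrite /P size_XnsubC.
  by rewrite PE size_prod_XsubC => -[].
have hr r : r \in rs -> eta <= normc (q - r).
  move=> rin; rewrite leNgt; apply/negP => lt; apply: no; exists r => //.
  have : root P r by rewrite PE root_prod_XsubC.
  by rewrite /root /P !hornerE subr_eq0 => /eqP.
have : eta ^+ m <= normc (P.[q]).
  rewrite PE -sz; elim: (rs) hr => [|r rs' IH] hr.
    by rewrite big_nil hornerC normc1 expr0.
  rewrite big_cons hornerM normcM exprS hornerXsubC; apply: ler_pM.
  - exact: ltW.
  - by rewrite exprn_ge0 // ltW.
  - by apply: hr; rewrite mem_head.
  - by apply: IH => r' h; apply: hr; rewrite in_cons h orbT.
by rewrite /P !hornerE leNgt hq.
Qed.

(** In the coordinate u^(-m) each step is nearly 1, so the real part outgrows the imaginary part and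
    the orbit reaches the cone; the direction of u is then close to an m-th root of unity, which is
    the omega found. *)
Lemma petal_entry m G (u : nat -> R[i]) T eta d : (0 < m)%N -> parabolic_step m G ->
  (forall n, u n.+1 = G (u n)) -> (forall n, u n != 0) ->
  (forall e, 0 < e -> exists N, forall n, (N <= n)%N -> normc (u n) < e) ->
  0 < T -> 0 < eta -> 0 < d ->
  exists N omega, omega ^+ m = 1 /\ petal m omega T eta d (u N).
Proof.
move=> m0 hG uS uN u_lim T0 eta0 d0.
(* [cone_unit] puts the m-th power of u / |u| within 2 T' of 1, which has to be less than eta^m for
   [near_root1]. *)
pose T' := Num.min (Num.min T 1) (eta ^+ m / 4).
have em : 0 < eta ^+ m by rewrite exprn_gt0.
have T'0 : 0 < T' by rewrite !lt_min T0 ltr01 divr_gt0.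
have T'1 : T' <= 1 by rewrite /T' !ge_min lexx ?orbT.
have T'T : T' <= T by rewrite /T' !ge_min lexx ?orbT.
have T'e : T' <= eta ^+ m / 4 by rewrite /T' !ge_min lexx ?orbT.
have e0 : 0 < T' / 4 by lra.
have [d1 d10 h1] := hG _ e0.
have dd : 0 < Num.min d d1 by rewrite lt_min d0.
have [N1 hN1] := u_lim _ dd.
pose W n := (u n ^+ m)^-1.
have step n : (N1 <= n)%N -> normc (W n.+1 - W n - 1) <= T' / 4.
  move=> /hN1; rewrite lt_min => /andP[_ n1].
  by rewrite /W uS; case: (h1 (u n)); rewrite ?normc_gt0 ?uN.
have bnd k : Re (W N1) + k%:R * (1 - T' / 4) <= Re (W (N1 + k)%N) /\
    `|Im (W (N1 + k)%N)| <= `|Im (W N1)| + k%:R * (T' / 4).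
  elim: k => [|k [I1 I2]]; first by rewrite addn0 !mul0r !addr0.
  have := step (N1 + k)%N (leq_addr _ _); rewrite addnS => s.
  have := le_trans (normc_Re _) s; have := le_trans (normc_Im _) s.
  rewrite -[1]/((1 : R)%:C) !ReD !ImD !ReN !ImN /= subr0 -[k.+1%:R]natr1 !mulrDl !mul1r.
  move=> s1; rewrite ler_norml => /andP[s2 _]; split; first lra.
  have -> : Im (W (N1 + k).+1) = Im (W (N1 + k)%N) + (Im (W (N1 + k).+1) - Im (W (N1 + k)%N)) by ring.
  by apply: le_trans (ler_normD _ _) _; lra.
have [K hK] := nat_gt ((`|Im (W N1)| - T' * Re (W N1)) * 2 / T').
have hc : cone T' (W (N1 + K)%N).
  have [I1 I2] := bnd K; have := hK K (leqnn _); rewrite ltr_pdivrMr // => hk.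
  rewrite /cone; apply: le_lt_trans I2 _.
  have : T' * (Re (W N1) + K%:R * (1 - T' / 4)) <= T' * Re (W (N1 + K)%N).
    by apply: ler_wpM2l => //; exact: ltW.
  have : K%:R * (T' * T') <= K%:R * (T' * 1).
    by apply: ler_wpM2l => //; apply: ler_wpM2l => //; exact: ltW.
  rewrite mulr1 => A B; move: A B hk.
  have -> : T' * (Re (W N1) + K%:R * (1 - T' / 4)) =
     T' * Re (W N1) + K%:R * T' - K%:R * (T' * T') / 4 by field.
  have -> : K%:R * (T' / 4) = K%:R * T' / 4 by ring.
  move: (K%:R * (T' * T')) (K%:R * T') (T' * Re (W N1)) => x1 x2 x3; lra.
set n := (N1 + K)%N in hc.
have un0 : 0 < normc (u n) by rewrite normc_gt0.
have hq := cone_unit (uN n) T'0 hc.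
have hq' : normc ((u n / (normc (u n))%:C) ^+ m - 1) < eta ^+ m by lra.
have [omega om hom] := near_root1 m0 eta0 hq'.
exists n, omega; split => //; split.
- rewrite un0 /=; have := hN1 n (leq_addr _ _).
  by rewrite lt_min => /andP[].
- have nC : (normc (u n))%:C != 0 :> R[i].
    by rewrite -normc_gt0 normc_real normr_gt0 gt_eqF.
  have -> : u n - (normc (u n))%:C * omega = (normc (u n))%:C * (u n / (normc (u n))%:C - omega).
    by move: ((normc (u n))%:C) nC => c cN; field.
  by rewrite normcM normc_real gtr0_norm // mulrC ltr_pM2r.
- by apply: (lt_le_trans hc); rewrite ler_pM2r // (cone_Re_gt0 T'0 hc).
Qed.

Lemma pow_dist_ge m (t : R) : (0 < m)%N -> 0 <= t -> `|t - 1| <= `|t ^+ m - 1|.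
Proof.
move=> m0 t0; rewrite subrX1 normrM -[X in X <= _]mulr1.
apply: ler_wpM2l; first exact: normr_ge0.
case: m m0 => // m _; rewrite big_ord_recl expr0.
have h : 0 <= \sum_(i < m) t ^+ lift ord0 i by apply: sumr_ge0 => i _; rewrite exprn_ge0.
by rewrite ger0_norm; lra.
Qed.

Lemma root_nat m n : (0 < m)%N -> exists s : R, [/\ (m.-root (n%:R : R[i])) = s%:C,
  0 <= s & s ^+ m = n%:R].
Proof.
move=> m0; have h : 0 <= m.-root (n%:R : R[i]) by rewrite rootC_ge0 // ler0n.
exists (normc (m.-root (n%:R : R[i]))); split.
- by rewrite -normC_normc ger0_norm.
- exact: normc_ge0.
- by rewrite -normcX rootCK // normc_nat.
Qed.

Lemma pow_lt_small m (x e : R) : (0 < m)%N -> 0 <= x -> 0 < e -> x ^+ m < e ^+ m -> x < e.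
Proof. by move=> m0 x0 e0; rewrite ltr_pXn2r ?nnegrE // ltW. Qed.

(** Modulus and direction are treated apart: |s u| is near 1 because its m-th power is, and
    [sector_improve] bounds the deviation of u from the ray of omega. *)
Lemma sector_asymptotic m omega eta t (s : R) n u : (0 < m)%N -> omega ^+ m = 1 ->
  eta <= (2 * m%:R)^-1 -> (0 < n)%N -> 0 < normc u ->
  normc (u - (normc u)%:C * omega) <= eta * normc u -> 0 < t -> t <= 8^-1 ->
  0 <= s -> s ^+ m = n%:R -> normc ((u ^+ m)^-1 - n%:R) <= t / 4 * n%:R ->
  normc (s%:C * u - omega) <= 7 * t.
Proof.
move=> m0 om eta1 n1 un0 us t0 t8 s0 sm; set W := (u ^+ m)^-1 => hW.
have o1 := normc_root1 m0 om.
have n0 : (0:R) < n%:R by rewrite ltr0n.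
have uN : u != 0 by rewrite -normc_gt0.
have nC : (n%:R : R[i]) != 0 by rewrite pnatr_eq0 -lt0n.
have t30 : 0 < t * 3 / 4 by rewrite divr_gt0 // mulr_gt0.
have cW : cone (t * 3 / 4) W.
  have E : W = (n%:R : R)%:C * (W / n%:R) by rewrite rmorph_nat; field.
  rewrite E cone_scale //; apply: cone_near1; try lra.
  have -> : W / n%:R - 1 = (W - n%:R) / n%:R by field.
  by rewrite normc_div normc_nat ler_pdivrMr //; lra.
have si := sector_improve m0 om uN t30 eta1 us cW.
set y := s%:C * u.
have ny : normc y = s * normc u by rewrite normcM normc_real ger0_norm.
have ym : y ^+ m = n%:R / W by rewrite exprMn -rmorphXn sm rmorph_nat /W invrK.
have WN : W != 0 by rewrite invr_neq0 // expf_neq0.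
have Wn0 : 0 < normc W by rewrite normc_gt0.
have Wn : n%:R / 2 <= normc W.
  have := normc_rev n%:R W; rewrite (normcB n%:R) normc_nat => h.
  have : t / 4 * n%:R <= 2^-1 * n%:R by rewrite ler_pM2r //; lra.
  by move: h hW; lra.
have y1 : `|normc y - 1| <= t / 2.
  apply: le_trans (pow_dist_ge m0 (normc_ge0 y)) _; rewrite -normcX.
  apply: (@le_trans _ _ (normc (y ^+ m - 1))).
    rewrite ler_norml; apply/andP; split; last by rewrite -normc1 normc_rev.
    by rewrite lerNl opprB -normc1 normcB normc_rev.
  have -> : y ^+ m - 1 = (n%:R - W) / W by rewrite ym; field.
  rewrite normc_div ler_pdivrMr // normcB; apply: le_trans hW _.
  by apply: le_trans (_ : t / 2 * (n%:R / 2) <= _); [lra|rewrite ler_pM2l // divr_gt0].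
have y2 : normc y <= 2.
  by have := le_trans (ler_norm _) y1; lra.
have -> : y - omega = (y - (normc y)%:C * omega) + (normc y - 1)%:C * omega.
  by rewrite rmorphB rmorph1; ring.
apply: le_trans (normcD_le _ _) _.
rewrite [normc (_ * omega)]normcM normc_real o1 mulr1.
have -> : y - (normc y)%:C * omega = s%:C * (u - (normc u)%:C * omega).
  by rewrite ny /y rmorphM; ring.
rewrite normcM normc_real ger0_norm //.
have H1 : s * normc (u - (normc u)%:C * omega) <= 3 * t * normc y.
  have -> : 3 * t * normc y = s * (4 * (t * 3 / 4) * normc u) by rewrite ny; field.
  exact: ler_wpM2l.
have H2 : 3 * t * normc y <= 3 * t * 2 by rewrite ler_pM2l // mulr_gt0.
by move: H1 H2 y1; lra.
Qed.

(** Forwards, summing steps 1 + o(1) gives u_n^(-m) = n (1 + o(1)), and membership in the petal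
    selects the root omega. Backwards, the asymptotics yield each of the three conditions of
    [petal]. This is the absorption property demanded of attracting petals. *)
Lemma petal_direction m G omega T eta d (u : nat -> R[i]) : (0 < m)%N ->
  omega ^+ m = 1 -> parabolic_step m G ->
  0 < eta -> eta <= (2 * m%:R)^-1 -> 0 < T -> T <= 1 -> 0 < d ->
  (forall w, petal m omega T eta d w ->
    petal m omega T eta d (G w) /\ Re (w ^+ m)^-1 + 1 / 2 <= Re (G w ^+ m)^-1) ->
  (forall n, u n.+1 = G (u n)) ->
  (exists N, forall n, (N <= n)%N -> petal m omega T eta d (u n)) <->
  (forall e, 0 < e -> exists N, forall n, (N <= n)%N ->
     normc (m.-root (n%:R : R[i]) * u n - omega) < e).
Proof.
move=> m0 om hG eta0 eta1 T0 T1 d0 inv uS.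
have o1 := normc_root1 m0 om.
have m1 : (1 : R) <= m%:R by rewrite ler1n.
have eta2 : eta <= 1 / 2.
  by apply: le_trans eta1 _; rewrite div1r lef_pV2 ?posrE ?mulr_gt0 //; lra.
split=> [[N0 hN0] e e0|h].
  pose t := Num.min (e / 16) 8^-1.
  have t0 : 0 < t by rewrite lt_min divr_gt0 // invr_gt0 ltr0n.
  have te : t <= e / 16 by rewrite ge_min lexx.
  have t8 : t <= 8^-1 by rewrite ge_min lexx orbT.
  pose W n := (u n ^+ m)^-1.
  have [N hN] : exists N, forall n, (N <= n)%N -> normc (W n - n%:R) <= t / 4 * n%:R.
    have t80 : 0 < t / 8 by lra.
    have [d1 d10 h1] := hG _ t80.
    have dm : 0 < d1 ^+ m by rewrite exprn_gt0.
    have [N1 hN1] := nat_gt (2 / d1 ^+ m).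
    have orb k : u (N0 + k)%N = iter k G (u N0).
      by elim: k => [|k IH]; [rewrite addn0|rewrite addnS uS IH].
    have small k : (N1 <= k)%N -> normc (u (N0 + k)%N) < d1.
      move=> kN1; apply: (pow_lt_small m0) => //; first exact: normc_ge0.
      have [_] := petal_growth inv T0 k (hN0 N0 (leqnn _)); rewrite -orb => g.
      have := hN1 k kN1; rewrite ltr_pdivrMr // => l.
      have k0 : (0:R) < k%:R.
        rewrite lt_def ler0n andbT; apply/eqP => E; move: l; rewrite E mul0r; lra.
      by rewrite -(ltr_pM2r k0) [d1 ^+ m * _]mulrC; apply: le_lt_trans l.
    pose N2 := (N0 + N1)%N.
    have step k : normc (W (N2 + k)%N.+1 - W (N2 + k)%N - 1) <= t / 8.
      have pu : petal m omega T eta d (u (N2 + k)%N).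
        by apply: hN0; rewrite /N2 -addnA leq_addr.
      have [/andP[pu0 _] _ _] := pu.
      rewrite /W uS; case: (h1 (u (N2 + k)%N)) => //.
      by rewrite pu0 /= /N2 -addnA small // leq_addr.
    have bnd k : normc (W (N2 + k)%N - (N2 + k)%:R) <= normc (W N2 - N2%:R) + k%:R * (t / 8).
      elim: k => [|k IH]; first by rewrite addn0 mul0r addr0.
      have -> : W (N2 + k.+1)%N - (N2 + k.+1)%:R = (W (N2 + k)%N.+1 - W (N2 + k)%N - 1) +
         (W (N2 + k)%N - (N2 + k)%:R) by rewrite addnS -[(N2 + k).+1%:R]natr1; ring.
      apply: le_trans (normcD_le _ _) _; have := step k; rewrite -[k.+1%:R]natr1 mulrDl mul1r; lra.
    have [N3 hN3] := nat_gt (normc (W N2 - N2%:R) / (t / 8)).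
    exists (N2 + N3)%N => n hn.
    have n2 : (N2 <= n)%N by apply: leq_trans hn; exact: leq_addr.
    have := bnd (n - N2)%N; rewrite subnKC // => b.
    have := hN3 n (leq_trans (leq_addl _ _) hn); rewrite ltr_pdivrMr // => l.
    have : ((n - N2)%N%:R : R) * (t / 8) <= n%:R * (t / 8).
      by apply: ler_wpM2r; [exact: ltW|rewrite ler_nat leq_subr].
    lra.
  exists (maxn (maxn N N0) 1) => n; rewrite !geq_max => /andP[/andP[Nn N0n] n1].
  have [s [-> s0 sm]] := root_nat n m0.
  have [/andP[un0 _] us _] := hN0 n N0n.
  apply: le_lt_trans (sector_asymptotic m0 om eta1 n1 un0 (ltW us) t0 t8 s0 sm (hN n Nn)) _.
  by move: te e0; lra.
have T30 : 0 < T / 3 by rewrite divr_gt0.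
have [k k0 hk] := dwithin_cont (dwithin_inv_pow m) T30.
pose e := Num.min (k / 2) (eta / 8).
have e0 : 0 < e by rewrite lt_min !divr_gt0.
have ek : e < k by apply: (@le_lt_trans _ _ (k / 2)); [rewrite ge_min lexx|lra].
have ee : e <= eta / 8 by rewrite ge_min lexx orbT.
have [N hN] := h e e0.
have dm : 0 < d ^+ m by rewrite exprn_gt0.
have [N1 hN1] := nat_gt (2 ^+ m / d ^+ m).
exists (maxn (maxn N N1) 1) => n; rewrite !geq_max => /andP[/andP[Nn N1n] n1].
have n0 : (0:R) < n%:R by rewrite ltr0n.
have := hN n Nn; have [s [-> s0 sm]] := root_nat n m0.
have sp : 0 < s.
  rewrite lt_def s0 andbT; apply/eqP => E; move: sm; rewrite E expr0n (gtn_eqF m0) /=.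
  by move=> E'; move: n0; rewrite -E' ltxx.
set y := s%:C * u n => hy.
have ny : normc y = s * normc (u n) by rewrite normcM normc_real ger0_norm.
have y1 : normc y <= 1 + e by have := normc_rev y omega; rewrite o1; lra.
have y2 : 1 - e <= normc y by have := normc_rev omega y; rewrite o1 normcB; lra.
have un0 : 0 < normc (u n).
  by rewrite -(pmulr_rgt0 _ sp) -ny; lra.
split.
- rewrite un0 /=; apply: (pow_lt_small m0) => //; first exact: normc_ge0.
  have := hN1 n N1n; rewrite ltr_pdivrMr // => l.
  rewrite -(ltr_pM2l n0); apply: le_lt_trans l.
  rewrite -sm -exprMn -ny; apply: lerXn2r; rewrite ?nnegrE ?normc_ge0 //; lra.
- rewrite -(ltr_pM2l sp).
  have -> : s * (eta * normc (u n)) = eta * normc y by rewrite ny; ring.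
  have -> : s * normc (u n - (normc (u n))%:C * omega) = normc (y - (normc y)%:C * omega).
    have -> : y - (normc y)%:C * omega = s%:C * (u n - (normc (u n))%:C * omega).
      by rewrite ny /y rmorphM; ring.
    by rewrite normcM normc_real ger0_norm.
  have -> : y - (normc y)%:C * omega = (y - omega) + (1 - normc y)%:C * omega.
    by rewrite rmorphB rmorph1; ring.
  apply: le_lt_trans (normcD_le _ _) _.
  rewrite [normc (_ * omega)]normcM normc_real o1 mulr1.
  have : `|1 - normc y| <= e by rewrite ler_norml; apply/andP; split; lra.
  have : eta * (1 - e) <= eta * normc y by apply: ler_wpM2l => //; exact: ltW.
  have : eta * e <= 1 / 2 * e by apply: ler_wpM2r => //; exact: ltW.
  lra.
- have oN : omega != 0 by rewrite -normc_gt0 o1.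
  have -> : (u n ^+ m)^-1 = (n%:R : R)%:C * (y ^+ m)^-1.
    have uN : u n != 0 by rewrite -normc_gt0.
    have nC : (n%:R : R[i]) != 0 by rewrite pnatr_eq0 -lt0n.
    rewrite exprMn -rmorphXn sm rmorph_nat; field.
    by rewrite nC expf_neq0.
  rewrite cone_scale //; apply: cone_near1 => //.
  have := hk ((y - omega) / omega) I; rewrite subr0 normc_div o1 divr1 => /(_ _).
  have -> : 1 + (y - omega) / omega = y / omega by field.
  rewrite expr_div_n om divr1 addr0 expr1n invr1 => H; apply: ltW; apply: H; lra.
Qed.

End PetalOrbits.

(** * Bounds for the derivative of an Abel function *)

Section AbelLowerBound.
Context {R : realType}.
Implicit Types (u w z b : R[i]) (phi g : R[i] -> R[i]) (r s h M X : R).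

(* By Bloch's theorem the image of the disc under phi covers a disc of radius
   comparable to s |phi'(w)|; if that exceeded 1, the value phi(z) + 1 = phi(g z)
   would be attained both in the disc and at g z, outside of it. *)
Lemma translation_derivative_le (P : set R[i]) phi g w s : 0 < s -> cball w s `<=` P ->
  (forall u, P u -> cdiff phi u) ->
  (forall z u, P z -> P u -> phi z = phi u -> z = u) ->
  (forall u, P u -> P (g u) /\ phi (g u) = phi u + 1) ->
  (forall z, cball w s z -> 2 * s < normc (g z - z)) ->
  normc (cd phi w) * s <= 512.
Proof.
move=> s0 inP hphi inj eqn far.
have [->|ne] := eqVneq (cd phi w) 0; first by rewrite normc0 mul0r.
have hol1 : hol phi w s by move=> u /inP; exact: hphi.
have [z0 hz0 cover] := bloch s0 hol1 ne.
have [e1 e2] := eqn z0 (inP z0 hz0).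
rewrite leNgt; apply/negP => big.
have [|z1 hz1 z1E] := cover (phi z0 + 1).
  by rewrite addrAC subrr add0r normc1 ltr_pdivlMr // mul1r.
have E : z1 = g z0 by apply: (inj _ _ (inP _ hz1) e1); rewrite e2.
have := far z0 hz0; rewrite -E ltNge => /negP; apply.
apply: le_trans (normc_dist z1 w z0) _; rewrite mulr_natl mulr2n; apply: lerD.
  exact: ltW hz1.
by rewrite normcB; exact: ltW hz0.
Qed.

(** Cauchy's estimate bounds phi'' by 4 M / r within h of w, so the increment 1 equals (w1 - w)
    phi'(w) up to 4 M h^2 / r, which is at most 1 / 2. *)
Lemma unit_increment_derivative_ge phi w w1 r h M : hol phi w r ->
  (forall u, cball w r u -> normc (cd phi u) <= M) -> phi w1 = phi w + 1 ->
  normc (w1 - w) < h -> h <= r / 2 -> 8 * M * h ^+ 2 <= r ->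
  1 / 2 <= normc (w1 - w) * normc (cd phi w).
Proof.
move=> hol1 bM eqn w1h hr hM.
have h0 : 0 < h := le_lt_trans (normc_ge0 _) w1h.
have r0 : 0 < r by lra.
have r20 : 0 < r / 2 by lra.
have hol2 := cdiff_cd_hol hol1.
have sub u : cball w h u -> cball u (r / 2) `<=` cball w r.
  by move=> hu; apply: cball_le; move: (ltW hu); lra.
have subh u : cball w h u -> cball w r u.
  by move=> hu; apply: (sub u hu); exact: cball_center.
have E2 u : cball w h u -> normc (cd (cd phi) u - 0) <= 2 * M / (r / 2).
  move=> hu; rewrite subr0; apply: cdiff_estimate => // v /(sub u hu) hv.
    exact: hol2.
  exact: bM.
have M0 : 0 <= M by apply: le_trans (bM w (cball_center w r0)); exact: normc_ge0.
have E1 u : cball w h u -> normc (cd phi u - cd phi w) <= 2 * M / (r / 2) * h.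
  move=> hu; have hol2h : hol (cd phi) w h by move=> v /subh; exact: hol2.
  have := hol_increment hol2h E2 (cball_center w h0) hu.
  rewrite mulr0 subr0 => /le_trans; apply; apply: ler_wpM2l; last exact: ltW.
  by rewrite divr_ge0 ?(ltW r20) // mulr_ge0.
have holh : hol phi w h by move=> v /subh; exact: hol1.
have := hol_increment holh E1 (cball_center w h0) w1h.
rewrite eqn [phi w + 1]addrC addrK => H.
have B : 2 * M / (r / 2) * h * normc (w1 - w) <= 1 / 2.
  apply: (@le_trans _ _ (2 * M / (r / 2) * h * h)).
    apply: ler_wpM2l; last exact: ltW.
    by rewrite mulr_ge0 ?(ltW h0) // divr_ge0 ?(ltW r20) // mulr_ge0.
  have -> : 2 * M / (r / 2) * h * h = 8 * M * h ^+ 2 / r / 2.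
    by field; rewrite gt_eqF.
  by rewrite ler_pM2r ?invr_gt0 // ler_pdivrMr // mul1r.
have := normc_rev 1 ((w1 - w) * cd phi w); rewrite normc1 normcM.
by move: H B; move: (_ * _ * _ * _) => B0; lra.
Qed.

Section TranslationNearFixedPoint.
Context (P : set R[i]) (phi g : R[i] -> R[i]) (b : R[i]) (m : nat) (a1 a2 kap : R).
Context (m0 : (0 < m)%N) (a10 : 0 < a1) (a12 : a1 <= a2) (kap0 : 0 < kap) (kap1 : kap <= 1 / 2).
Context (hphi : forall w, P w -> cdiff phi w).
Context (inj : forall z w, P z -> P w -> phi z = phi w -> z = w).
Context (eqn : forall w, P w -> P (g w) /\ phi (g w) = phi w + 1).
Context (bnd : forall w, P w ->
  a1 * normc (w - b) ^+ m.+1 <= normc (g w - w) <= a2 * normc (w - b) ^+ m.+1).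

Lemma abel_derivative_le w w' X : X = normc (w - b) -> 0 < X -> X <= 1 -> X * a1 <= kap ->
  cball w (kap * X) `<=` P -> cball w (kap * X / 2) w' ->
  normc (cd phi w') <= 512 * 2 ^+ m.+3 / a1 / X ^+ m.+1.
Proof.
move=> XE X0 X1 X2 hw hw'.
have Xm : X ^+ m <= X.
  by rewrite -(prednK m0) exprS ler_piMr ?(ltW X0) // exprn_ile1 // ltW.
have XS0 : 0 < X ^+ m.+1 by rewrite exprn_gt0.
have p2 : 0 < (2 : R) ^+ m.+3 by rewrite exprn_gt0.
(* On the disc |z - b| >= X / 2, so g moves z by at least a1 (X / 2)^(m+1) = 4 s, more than the 2 s
   that the covering argument needs. *)
pose s := a1 * X ^+ m.+1 / 2 ^+ m.+3.
have s0 : 0 < s by rewrite divr_gt0 // mulr_gt0.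
have sk : s <= kap * X / 2.
  have h1 : a1 * X ^+ m.+1 <= kap * X.
    rewrite exprSr mulrA; apply: ler_wpM2r; first exact: ltW.
    by apply: le_trans X2; rewrite mulrC; apply: ler_wpM2r => //; exact: ltW.
  have h2 : (2 : R) <= 2 ^+ m.+3.
    by rewrite exprS ler_peMr // exprn_ege1 // ler1n.
  apply: ler_pM => //; first by rewrite mulr_ge0 ?(ltW a10) ?(ltW XS0).
    by rewrite invr_ge0 ltW.
  by rewrite lef_pV2 ?posrE.
have sub : cball w' s `<=` cball w (kap * X).
  by apply: cball_le; move: (ltW hw') sk; lra.
have far z : cball w' s z -> 2 * s < normc (g z - z).
  move=> /sub hz; have /andP[b1 _] := bnd (hw z hz); apply: lt_le_trans b1.
  have z1 : X / 2 <= normc (z - b).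
    have k2 : kap * X <= 1 / 2 * X by apply: ler_wpM2r => //; exact: ltW.
    have := normc_dist w z b; rewrite -XE (normcB w z).
    by move: (ltW hz) k2; rewrite /cball /=; lra.
  apply: (@lt_le_trans _ _ (a1 * (X / 2) ^+ m.+1)); last first.
    apply: ler_wpM2l; first exact: ltW.
    by apply: lerXn2r; rewrite ?nnegrE ?normc_ge0 ?divr_ge0 ?(ltW X0).
  have -> : a1 * (X / 2) ^+ m.+1 = 2 * s * 2.
    by rewrite /s expr_div_n [2 ^+ m.+3]exprS [2 ^+ m.+2]exprS; field; rewrite gt_eqF // exprn_gt0.
  by move: (s) s0 => s1 s10; lra.
have := translation_derivative_le s0 (fun u hu => hw u (sub u hu)) hphi inj eqn far.
rewrite -ler_pdivlMr // => /le_trans; apply.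
by rewrite le_eqVlt; apply/orP; left; apply/eqP; rewrite /s; field; rewrite !gt_eqF.
Qed.

Lemma abel_lower_bound : exists2 d : R, 0 < d & forall w, 0 < normc (w - b) < d ->
  cball w (kap * normc (w - b)) `<=` P ->
  cd phi w != 0 /\ normc (cd phi w)^-1 <= 2 * a2 * normc (w - b) ^+ m.+1.
Proof.
have a20 : 0 < a2 by exact: lt_le_trans a12.
pose C := 512 * 2 ^+ m.+3 / a1.
have C0 : 0 < C by rewrite divr_gt0 // mulr_gt0 // exprn_gt0.
(* [unit_increment_derivative_ge] is used with M = C / X^(m+1), h = 2 a2 X^(m+1) and r = kap X / 2,
   and then 8 M h^2 = E X^(m+1) / 2. The sum D collects the smallness conditions on X: for the bound
   M, for h <= r / 2, and for 8 M h^2 <= r. *)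
have [E EE] : exists E, E = 64 * C * a2 ^+ 2 by eexists; reflexivity.
have E0 : 0 < E by rewrite EE; apply: mulr_gt0; [exact: mulr_gt0|exact: exprn_gt0].
pose D := a1 + 8 * a2 + E.
have D0 : 0 < D by rewrite !addr_gt0 // mulr_gt0.
exists (Num.min 1 (kap / D)); first by rewrite lt_min ltr01 divr_gt0.
move=> w; have [X XE] : exists X, X = normc (w - b) by eexists; reflexivity.
rewrite -XE lt_min ltr_pdivlMr // => /andP[X0 /andP[X1 XD]] hw.
have XS0 : 0 < X ^+ m.+1 by rewrite exprn_gt0.
have [K1 K2 K3] : [/\ X * a1 <= kap, X * (8 * a2) <= kap & X * E <= kap].
  have le_kap t : t <= D -> X * t <= kap.
    by move=> tD; apply: le_trans (ltW XD); rewrite ler_pM2l.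
  have a80 : 0 <= 8 * a2 by rewrite mulr_ge0 // ltW.
  split; apply: le_kap; rewrite /D.
  - by rewrite -addrA lerDl addr_ge0 // ltW.
  - by rewrite addrAC lerDr addr_ge0 // ltW.
  - by rewrite lerDr addr_ge0 // ltW.
have Xm : X ^+ m.+1 <= X * X.
  rewrite exprS; apply: ler_wpM2l; first exact: ltW.
  by rewrite -(prednK m0) exprS ler_piMr ?(ltW X0) // exprn_ile1 // ltW.
have Pw : P w by apply: hw; apply: cball_center; exact: mulr_gt0.
have [_ e2] := eqn Pw.
have /andP[_ b2] := bnd Pw; rewrite -XE in b2.
have aX0 : 0 < a2 * X ^+ m.+1 by rewrite mulr_gt0.
have XX t : 0 < t -> X * t <= kap -> t * X ^+ m.+1 <= kap * X.
  move=> t0 tX; apply: (@le_trans _ _ (t * (X * X))); first by rewrite ler_pM2l.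
  by rewrite mulrCA mulrC [t * X]mulrC; apply: ler_wpM2r => //; exact: ltW.
have L2 : 8 * a2 * X ^+ m.+1 <= kap * X by apply: XX => //; exact: mulr_gt0.
have L3 : E * X ^+ m.+1 <= kap * X by exact: XX.
have hol1 : hol phi w (kap * X / 2).
  move=> u hu; apply: hphi; apply: hw; apply: lt_le_trans hu _.
  by rewrite ler_pdivrMr // ler_peMr ?ler1n // mulr_ge0 // ltW.
have bM u := @abel_derivative_le w u X XE X0 (ltW X1) K1 hw.
have hb : normc (g w - w) < 2 * (a2 * X ^+ m.+1).
  by apply: le_lt_trans b2 _; rewrite ltr_pMl // ltr1n.
have H : 1 / 2 <= normc (g w - w) * normc (cd phi w).
  apply: (unit_increment_derivative_ge hol1 bM e2 hb).
    by move: L2; lra.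
  have -> : 8 * (512 * 2 ^+ m.+3 / a1 / X ^+ m.+1) * (2 * (a2 * X ^+ m.+1)) ^+ 2 =
      E * X ^+ m.+1 / 2.
    by rewrite EE /C; field; rewrite !gt_eqF.
  by rewrite ler_pM2r ?invr_gt0.
have ne : cd phi w != 0.
  by apply: contraTneq H => ->; rewrite normc0 mulr0 -ltNge divr_gt0.
split=> //; rewrite normcV -div1r ler_pdivrMr ?normc_gt0 //.
have : normc (g w - w) * normc (cd phi w) <= a2 * X ^+ m.+1 * normc (cd phi w).
  by apply: ler_wpM2r => //; exact: normc_ge0.
by move: H; lra.
Qed.

End TranslationNearFixedPoint.
End AbelLowerBound.

(** * Attracting petals at a parabolic fixed point *)

Section ParabolicPoint.
Context {R : realType}.
Implicit Types (u w z y omega : R[i]) (T eta d e : R).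

Context (f : R[i] -> sphere R) (p : nat) (b : R[i]).
Context (m : nat) (m0 : (0 < m)%N) (c : R[i] -> R[i]) (v0 : R[i]) (r : R) (r0 : 0 < r).
Context (g_fin : forall w, cball b r w -> fiter f p w <> None).
Context (g_hol : hol (fiterc f p) b r).
Context (c_hol : hol c b r) (cb : c b != 0).
Context (gE : forall w, fiterc f p w = w + (w - b) ^+ m.+1 * c w).
Context (v0E : m%:R * c b * v0 ^+ m = -1).

(** Dividing by one attraction vector v0 normalizes f^p to u (1 - u^m (1 + o(1)) / m); the vectors
    v0 omega correspond to the m-th roots of unity omega. *)
Definition chart w := (w - b) / v0.

Definition chart_step u := chart (fiterc f p (b + v0 * u)).

Lemma chart_neq0 : v0 != 0.
Proof.
apply/eqP => E; move: v0E; rewrite E expr0n (gtn_eqF m0) mulr0 => /eqP.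
by rewrite eq_sym oppr_eq0 oner_eq0.
Qed.
Let v0N := chart_neq0.

Let v0gt0 : 0 < normc v0.
Proof. by rewrite normc_gt0. Qed.

Lemma chartK w : b + v0 * chart w = w.
Proof. by rewrite /chart; field. Qed.

Lemma normc_chart w : normc (w - b) = normc v0 * normc (chart w).
Proof. by rewrite -normcM /chart mulrC divfK. Qed.

Lemma chart_stepE w : chart_step (chart w) = chart (fiterc f p w).
Proof. by rewrite /chart_step chartK. Qed.

Lemma chart_parabolic : parabolic_step m chart_step.
Proof.
apply: (@parabolic_stepP _ m _ (fun u => c (b + v0 * u) / c b) 1 m0 ltr01) => [e e0|u _].
  have cb0 : 0 < e * normc (c b) by rewrite mulr_gt0 // normc_gt0.
  have [d d0 hd] := cdiff_cont (c_hol (cball_center b r0)) cb0.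
  exists (d / normc v0); first by rewrite divr_gt0.
  move=> u; rewrite ltr_pdivlMr // => hu.
  have -> : c (b + v0 * u) / c b - 1 = (c (b + v0 * u) - c b) / c b by field.
  rewrite normc_div ler_pdivrMr ?normc_gt0 //; apply: ltW; apply: hd.
  by rewrite addrAC subrr add0r normcM mulrC.
have mC : (m%:R : R[i]) != 0 by rewrite pnatr_eq0 -lt0n.
have vm : v0 ^+ m = - (m%:R * c b)^-1.
  have mcb : m%:R * c b != 0 by rewrite mulf_neq0.
  by apply: (mulfI mcb); rewrite v0E mulrN mulfV.
rewrite /chart_step /chart gE.
have -> : (b + v0 * u + (b + v0 * u - b) ^+ m.+1 * c (b + v0 * u) - b) / v0 =
  u + v0 ^+ m * u ^+ m.+1 * c (b + v0 * u).
  have -> : b + v0 * u - b = v0 * u by ring.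
  by rewrite exprMn [v0 ^+ m.+1]exprS; field.
by rewrite vm exprS; field; rewrite mC cb.
Qed.

Definition wpetal omega T eta d : set R[i] := [set w | petal m omega T eta d (chart w)].

Lemma parabolic_vector omega : omega ^+ m = 1 ->
  attraction_vector (fiterc f p) b m (v0 * omega).
Proof.
move=> om; split=> //; exists (c b); last by rewrite exprMn om mulr1.
apply/cvg_normcP => e e0; apply/dnbhs_normcP.
have [d d0 hd] := cdiff_cont (c_hol (cball_center b r0)) e0.
exists d => // w wb /hd; congr (normc (_ - _) < _).
by rewrite gE addrAC subrr add0r mulrC mulKf // expf_neq0 // subr_eq0.
Qed.

Lemma parabolic_univalent : exists2 s : R, 0 < s <= r & univalent_on f p (cball b s).
Proof.
have h2 : (0 : R) < 1 / 2 by rewrite divr_gt0.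
have [d d0 hd] := cdiff_cont (cdiff_cd_hol g_hol (cball_center b r0)) h2.
have g1 : cd (fiterc f p) b = 1.
  have h := dwithinD (dwithin_id setT b)
     (dwithinM (dwithinX m.+1 (dwithin_subc setT b b)) (c_hol (cball_center b r0))).
  have [] := cdiff_cd h; rewrite (_ : (fun w => _) = fiterc f p); last first.
    by apply: funext => w; rewrite gE.
  by move=> _ ->; rewrite subrr expr0n (gtn_eqF m0) /= expr0n mulr0 !mul0r !addr0.
pose s := Num.min r d.
have sr : s <= r by rewrite ge_min lexx.
have sd : s <= d by rewrite ge_min lexx orbT.
have s0 : 0 < s by rewrite lt_min r0.
exists s; first by rewrite s0.
have hs : hol (fiterc f p) b s by move=> w hw; apply: g_hol; exact: lt_le_trans sr.
split.
- by move=> w hw; apply: g_fin; exact: lt_le_trans sr.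
- by move=> w /hs/cdiffP.
move=> z w hz hw E.
have H u : cball b s u -> normc (cd (fiterc f p) u - 1) <= 1 / 2.
  by move=> hu; rewrite -g1; apply: ltW; apply: hd; exact: lt_le_trans sd.
have := hol_increment hs H hw hz; rewrite E subrr sub0r normcN mulr1 => h.
apply/eqP; rewrite -subr_eq0 -normc_eq0 eq_le normc_ge0 andbT; lra.
Qed.

Lemma parabolic_displacement : exists2 d : R, 0 < d & forall w, cball b d w ->
  normc (c b) / 2 * normc (w - b) ^+ m.+1 <= normc (fiterc f p w - w)
    <= 2 * normc (c b) * normc (w - b) ^+ m.+1.
Proof.
have nc2 : 0 < normc (c b) / 2 by rewrite divr_gt0 // normc_gt0.
have [d d0 hd] := cdiff_cont (c_hol (cball_center b r0)) nc2.
exists d => // w hw; rewrite gE addrAC subrr add0r normcM normcX [_ * normc (c w)]mulrC.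
have := hd w hw; have := normc_rev (c w) (c b); have := normc_rev (c b) (c w).
rewrite (normcB (c b)) => c1 c2 c3.
have pX : 0 <= normc (w - b) ^+ m.+1 by rewrite exprn_ge0 // normc_ge0.
by apply/andP; split; apply: ler_wpM2r => //; lra.
Qed.

Definition invariant_petal omega T eta d := forall u, petal m omega T eta d u ->
  petal m omega T eta d (chart_step u) /\
  Re (u ^+ m)^-1 + 1 / 2 <= Re (chart_step u ^+ m)^-1.

(** Sizes and openings are fixed before omega, since the direction is known only once the orbit has
    entered. The outer petal takes eta = 1 / (2 m), the largest value [sector_improve] admits, and T
    = eta / 8; halving both gives the inner petal, with the margin K of [petal_deep]. *)
Lemma nested_petals (D : R) : 0 < D -> exists T eta d T1 eta1 d1 : R,
  [/\ [/\ 0 < T, T <= 1, 0 < eta & eta <= (2 * m%:R)^-1], 0 < d /\ normc v0 * d <= D,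
   [/\ 0 < T1, 0 < eta1, 0 < d1 & normc v0 * d1 <= D] &
   forall omega, omega ^+ m = 1 -> [/\ invariant_petal omega T eta d,
     invariant_petal omega T1 eta1 d1 &
     exists2 K : R, 0 < K <= 1 / 2 & forall w, wpetal omega T1 eta1 d1 w ->
       cball w (K * normc (w - b)) `<=` wpetal omega T eta d]].
Proof.
have hG := chart_parabolic.
have m1 : (1 : R) <= m%:R by rewrite ler1n.
move=> D0; pose eta : R := (2 * m%:R)^-1.
have eta0 : 0 < eta by rewrite invr_gt0 mulr_gt0 //; lra.
have eta1 : eta <= 1 by rewrite /eta invf_le1; [lra|rewrite mulr_gt0 //; lra].
have [E0 E1 E2] : [/\ 0 < eta / 8, 0 < eta / 16 & 0 < eta / 2] by split; lra.
have [E3 E4 E5] : [/\ eta / 16 < eta / 8, eta / 8 <= 1 & eta / 2 < eta] by split; lra.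
have [E6 E7] : 8 * (eta / 8) <= eta /\ 8 * (eta / 16) <= eta / 2 by split; lra.
have [dA dA0 hA] := petal_invariant m0 hG eta0 (lexx _) E0 E6.
have [dB dB0 hB] := petal_invariant m0 hG E2 (ltW E5) E1 E7.
have [d [d0 dd dv]] : exists d : R, [/\ 0 < d, d <= dA & normc v0 * d <= D].
  exists (Num.min dA (D / normc v0)); split.
  - by rewrite lt_min dA0 divr_gt0.
  - by rewrite ge_min lexx.
  - by rewrite mulrC -ler_pdivlMr // ge_min lexx orbT.
have [d1 [d10 dd1 d1B]] : exists d1 : R, [/\ 0 < d1, d1 < d & d1 <= dB].
  exists (Num.min (d / 2) dB); split.
  - by rewrite lt_min dB0 divr_gt0.
  - by rewrite gt_min ltr_pdivrMr // ltr_pMr // ltr1n.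
  - by rewrite ge_min lexx orbT.
exists (eta / 8), eta, d, (eta / 16), (eta / 2), d1; split => //.
  by split=> //; apply: le_trans dv; apply: ler_wpM2l; exact: ltW.
move=> omega om; split; [exact: hA|exact: hB|].
have [k k0 hk] := petal_deep m0 om E1 E3 eta0 E5 d10 dd1.
exists (Num.min k (1 / 2)); first by rewrite lt_min k0 divr_gt0 //= ge_min lexx orbT.
move=> w hw y; rewrite /cball /= => hy; apply: (hk _ _ hw).
have -> : chart y - chart w = (y - w) / v0 by rewrite /chart; field.
rewrite normc_div ltr_pdivrMr //; apply: lt_le_trans hy _.
rewrite normc_chart -mulrA [normc (chart w) * _]mulrC; apply: ler_wpM2r.
  by rewrite mulr_ge0 ?normc_ge0.
by rewrite ge_min lexx.
Qed.

Section InvariantPetal.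
Context (omega : R[i]) (om : omega ^+ m = 1) (T eta d : R).
Context (T0 : 0 < T) (eta0 : 0 < eta) (d0 : 0 < d) (dr : normc v0 * d <= r).
Context (inv : invariant_petal omega T eta d).

Lemma wpetal_cball w : wpetal omega T eta d w -> cball b (normc v0 * d) w.
Proof. by case=> /andP[_ h] _ _; rewrite /cball /= normc_chart ltr_pM2l. Qed.

Lemma wpetal_fin w : wpetal omega T eta d w -> fiter f p w <> None.
Proof. by move=> /wpetal_cball hw; apply: g_fin; exact: lt_le_trans dr. Qed.

Lemma wpetal_open : open (wpetal omega T eta d).
Proof.
apply/openP_cball => w hw; have [s s0 hs] := petal_nbhs m0 om T0 eta0 hw.
exists (normc v0 * s); first by rewrite mulr_gt0.
move=> y; rewrite /cball /= => hy; apply: hs.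
have -> : chart y - chart w = (y - w) / v0 by rewrite /chart; field.
by rewrite normc_div ltr_pdivrMr // mulrC.
Qed.

Lemma wpetal_step w : wpetal omega T eta d w ->
  exists2 y, fiter f p w = Some y & wpetal omega T eta d y.
Proof.
move=> hw; exists (fiterc f p w); first by apply: fiter_Some; exact: wpetal_fin.
by rewrite /wpetal /= -chart_stepE; exact: (inv hw).1.
Qed.

Lemma wpetal_iter n w : wpetal omega T eta d w ->
  [/\ wpetal omega T eta d (fiterc f (p * n) w), fiter f (p * n) w <> None &
  normc (fiterc f (p * n) w - b) ^+ m * n%:R <= 2 * normc v0 ^+ m].
Proof.
move=> hw.
have [h1 h2 h3] : [/\ wpetal omega T eta d (fiterc f (p * n) w), fiter f (p * n) w <> None
    & chart (fiterc f (p * n) w) = iter n chart_step (chart w)].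
  elim: n => [|n [I1 I2 I3]]; first by rewrite muln0.
  have [y fy hy] := wpetal_step I1.
  have E : fiter f (p * n.+1) w = Some y by rewrite mulnS fiter_addc.
  rewrite E (fitercE E); split => //.
  by rewrite iterS -I3 chart_stepE (fitercE fy).
split => //; rewrite normc_chart h3 exprMn.
have [_ h] := petal_growth inv T0 n hw.
have : normc v0 ^+ m * (normc (iter n chart_step (chart w)) ^+ m * n%:R) <= normc v0 ^+ m * 2.
  by apply: ler_wpM2l => //; rewrite exprn_ge0 // ltW.
lra.
Qed.

Lemma wpetal_attracted : attracted f p b (wpetal omega T eta d).
Proof.
split; [exact: wpetal_open|exact: wpetal_step|move=> e e0].
have em : 0 < e ^+ m by rewrite exprn_gt0.
have [N hN] := nat_gt (2 * normc v0 ^+ m / e ^+ m).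
exists N => n z Nn hz; apply: (pow_lt_small m0) => //; first exact: normc_ge0.
have [_ _ h] := wpetal_iter n hz.
have := hN n Nn; rewrite ltr_pdivrMr // => h1.
have n0 : (0 : R) < n%:R.
  rewrite -(pmulr_lgt0 _ em); apply: le_lt_trans h1.
  by rewrite mulr_ge0 // exprn_ge0 // ltW.
by rewrite -(ltr_pM2r n0) [e ^+ m * _]mulrC; apply: le_lt_trans h1.
Qed.

(** The bridge to the Abel equation, whose injectivity clause speaks of attracting petals in this
    exact sense. *)
Lemma wpetal_attracting (s : R) : eta <= (2 * m%:R)^-1 -> T <= 1 ->
  univalent_on f p (cball b s) -> normc v0 * d <= s ->
  attracting_petal f p b (v0 * omega) (wpetal omega T eta d).
Proof.
move=> eta1 T1 us ds; exists m; first exact: parabolic_vector.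
split.
- exact: wpetal_open.
- have s0 : 0 < s by apply: lt_le_trans ds; exact: mulr_gt0.
  exists (cball b s); split=> //.
  + apply/openP_cball => w hw; exists (s - normc (w - b)).
      by move: hw; rewrite /cball /=; lra.
    by apply: cball_le; rewrite addrC subrK.
  + exact: cball_center.
  + by move=> w /wpetal_cball hw; exact: lt_le_trans ds.
- exact: wpetal_step.
move=> z hz.
have uS n : chart (z n.+1) = chart_step (chart (z n)).
  by rewrite chart_stepE (fitercE (hz n)).
have [D1 D2] := petal_direction m0 om chart_parabolic eta0 eta1 T0 T1 d0 inv uS.
have E n : normc (m.-root (n%:R : R[i]) * (z n - b) - v0 * omega) =
    normc v0 * normc (m.-root (n%:R : R[i]) * chart (z n) - omega).
  by rewrite -normcM /chart; congr normc; field.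
split.
  move=> /near_inftyP/D1 h; apply/cvg_normcP => e e0; apply/near_inftyP.
  have [|N hN] := h (e / normc v0); first by rewrite divr_gt0.
  by exists N => n /hN; rewrite E ltr_pdivlMr // mulrC.
move=> /cvg_normcP h; apply/near_inftyP; apply: D2 => e e0.
have /near_inftyP[N hN] := h (normc v0 * e) (mulr_gt0 v0gt0 e0).
by exists N => n /hN; rewrite E ltr_pM2l.
Qed.

End InvariantPetal.
End ParabolicPoint.

(** * The parabolic basin *)

Section ParabolicBasin.
Context {R : realType}.
Implicit Types (u w z y b omega : R[i]) (T eta d e rho B C : R).

Context (f : R[i] -> sphere R) (p : nat) (a : R[i]) (Phi : R[i] -> R[i]).
Context (mf : meromorphic f) (af : admissible f) (p0 : (0 < p)%N)
  (fa : fiter f p a = Some a).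
Context (Phi_hol : forall z, basin f p a z -> cdiff Phi z).
Context (Phi_eq : forall z, basin f p a z -> Phi (finval (f z)) = Phi z + p%:R^-1).

Lemma abel_period z : basin f p a z -> Phi (fiterc f p z) = Phi z + 1.
Proof.
move=> bz; have H n : Phi (fiterc f n z) = Phi z + n%:R / p%:R.
  elim: n => [|n IH]; first by rewrite mul0r addr0.
  rewrite /fiterc fiterS fiter_Some /=; last by apply: fatou_fin; case/basinP: bz.
  rewrite Phi_eq; last exact: basin_iter.
  by rewrite IH -natr1 mulrDl mul1r addrA.
by rewrite H divff // pnatr_eq0 -lt0n.
Qed.

(** At such a point the Abel equation would read Phi z = Phi z + 1. It follows that f^p is not the
    identity near the cycle and that orbits in the basin never land on it. *)
Lemma periodic_notin_basin z : fiter f p z = Some z -> ~ basin f p a z.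
Proof.
move=> fz /abel_period; rewrite (fitercE fz) => /eqP.
by rewrite -subr_eq0 opprD addrA subrr add0r oppr_eq0 oner_eq0.
Qed.

(** f^p is not the identity near b, because points of the basin accumulate there and are not fixed
    by f^p. Order 0 of f^p - id at b would contradict that b is fixed, order 1 that the multiplier
    is 1. *)
Lemma parabolic_order b : fiter f p b = Some b -> cd (fiterc f p) b = 1 ->
  (forall e, 0 < e -> exists2 y, cball b e y & basin f p a y) ->
  exists m c r, [/\ (0 < m)%N /\ 0 < r,
    forall w, cball b r w -> fiter f p w <> None, hol (fiterc f p) b r,
    hol c b r /\ c b != 0 & forall w, fiterc f p w = w + (w - b) ^+ m.+1 * c w].
Proof.
move=> fb g1 acc; have fbN : fiter f p b <> None by rewrite fb.
have [r r0 [fin hg]] := fiter_near mf fbN.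
have hid w : cdiff (fun z : R[i] => z) w /\ cd (fun z : R[i] => z) w = 1.
  exact: cdiff_cd (dwithin_id setT w).
have hh : hol (fun w => fiterc f p w - w) b r.
  by move=> w hw; case: (cdiffB (hg w hw) (hid w).1).
have [[s s0 hs]|[n [c [hc cb hE]]]] := hol_order r0 hh.
  have m0 : 0 < Num.min r s by rewrite lt_min r0.
  have [y] := acc _ m0; rewrite /cball /= lt_min => /andP[yr ys] by_.
  exfalso; apply: (periodic_notin_basin _ by_).
  rewrite (fiter_Some (fin y yr)); congr Some.
  by apply/eqP; rewrite -subr_eq0; apply/eqP; exact: hs.
have gE w : fiterc f p w = w + (w - b) ^+ n * c w by rewrite -hE addrC subrK.
case: n gE {hE} => [|[|m]] gE.
- have := gE b; rewrite (fitercE fb) expr0 mul1r => /eqP.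
  by rewrite addrC -subr_eq subrr eq_sym (negbTE cb).
- have h := dwithinD (dwithin_id setT b)
     (dwithinM (dwithin_subc setT b b) (hc b (cball_center b r0))).
  have [] := cdiff_cd h; rewrite (_ : (fun w => _) = fiterc f p); last first.
    by apply: funext => w; rewrite gE expr1.
  rewrite g1 subrr mul0r mul1r addr0 => _ /eqP.
  by rewrite addrC -subr_eq subrr eq_sym (negbTE cb).
by exists m.+1, c, r; split.
Qed.

Lemma petal_controlled (U : set R[i]) b m z0 k s L1 (K A Q d : R) :
  (0 < m)%N -> 0 < s -> 0 < K <= 1 / 2 -> 0 <= A -> 0 <= Q -> 0 < d ->
  cball z0 s `<=` basin f p a -> U `<=` basin f p a ->
  (forall l z, (L1 <= l)%N -> cball z0 s z -> let w := fiterc f (p * l + k) z in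
    [/\ 0 < normc (w - b), normc (w - b) ^+ m * (l - L1)%:R <= Q &
        cball w (K * normc (w - b)) `<=` U]) ->
  (forall y, 0 < normc (y - b) < d -> cball y (K / 2 * normc (y - b)) `<=` U ->
    cd Phi y != 0 /\ normc (cd Phi y)^-1 <= A * normc (y - b) ^+ m.+1) ->
  controlled f p a 1 Phi z0 k (fun n => n%:R^-1).
Proof.
move=> m0 s0 /andP[K0 K1] A0 Q0 d0 hs UB orb bnd.
(* Beyond 2 L1, the time l - L1 since entry is comparable to n = p l + k, so decay in the former is
   decay in n. *)
have num l : (L1.*2.+1 <= l)%N -> [/\ (L1 <= l)%N, (0 < p * l + k)%N, (l <= p * l + k)%N &
    (p * l + k <= (p + k) * ((l - L1) * 2))%N].
  move=> h; have lp : (l <= p * l)%N by rewrite leq_pmull.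
  by move: h lp; rewrite -addnn => h lp; split; nia.
pose Q1 := 2 * Q * (p + k)%:R.
pose E := 4 * A * 2 ^+ m.+1 / K.
have E0 : 0 <= E by rewrite divr_ge0 ?(ltW K0) // !mulr_ge0 ?exprn_ge0.
have [N2 hN2] := nat_gt (E * Q1).
have dm : 0 < (d / 2) ^+ m by rewrite exprn_gt0 // divr_gt0.
have [N3 hN3] := nat_gt (Q1 / (d / 2) ^+ m).
exists (E * Q1), s, (maxn (L1.*2.+1) (maxn N2 N3)); split => //.
move=> l z; rewrite !geq_max => /and3P[/num[lL1 n0 ln nl] l2 l3] hz.
have {orb} [X0 Xl subU] := orb l z lL1 hz.
move: (p * l + k)%N n0 ln nl X0 Xl subU => n n0 ln nl.
rewrite -(ltr0n R) in n0.
move: (fiterc f n z) => w; have [X XE] : exists X, X = normc (w - b) by eexists; reflexivity.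
rewrite -XE => X0 Xl subU.
have Xn : X ^+ m * n%:R <= Q1.
  apply: (@le_trans _ _ (X ^+ m * ((p + k) * ((l - L1) * 2))%:R)).
    by apply: ler_wpM2l; [rewrite exprn_ge0 // ltW|rewrite ler_nat].
  have -> : X ^+ m * ((p + k) * ((l - L1) * 2))%:R = 2 * (X ^+ m * (l - L1)%:R) * (p + k)%:R.
    by rewrite !natrM; ring.
  by apply: ler_wpM2r => //; apply: ler_wpM2l.
have Xd : X < d / 2.
  apply: (pow_lt_small m0); [exact: ltW|by rewrite divr_gt0|].
  rewrite -(ltr_pM2r n0); apply: le_lt_trans Xn _.
  rewrite mulrC -ltr_pdivrMr //; apply: lt_le_trans (hN3 l l3) _.
  by rewrite ler_nat.
have EXn : E * X ^+ m <= E * Q1 * n%:R^-1.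
  by rewrite ler_pdivlMr // -mulrA ler_wpM2l.
have KX : 0 < K * X by rewrite mulr_gt0.
have KX2 : K * X <= 1 / 2 * X by apply: ler_wpM2r => //; exact: ltW.
have KKX : K * (K * X) <= 1 / 2 * (K * X) by apply: ler_wpM2r => //; exact: ltW.
have BE : A * (2 * X) ^+ m.+1 / (K / 4 * X) = E * X ^+ m.
  by rewrite /E exprMn [X ^+ m.+1]exprS; field; rewrite !gt_eqF.
have EX1 : E * X ^+ m <= 1.
  apply: le_trans EXn _; rewrite ler_pdivrMr // mul1r; apply: ltW.
  by apply: lt_le_trans (hN2 l l2) _; rewrite ler_nat.
(* For y within K X / 4 of w one has |y - b| <= 2 X, and the disc of radius (K / 2) |y - b| about y
   stays within K X of w, hence in U: this is why [bnd] is stated with K / 2. The quotient B / rho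
   is E X^m. *)
exists (K / 4 * X), (A * (2 * X) ^+ m.+1); rewrite BE; clear - A0 K0 X0 XE Xd subU UB bnd KX KX2 KKX EX1 EXn.
split => //.
- by rewrite mulr_gt0 // divr_gt0.
- move=> y hy; apply: UB; apply: subU; apply: lt_le_trans hy _; lra.
move=> y hy; rewrite expr1n.
have y1 := normc_dist y w b; have y2 := normc_dist w y b.
rewrite (normcB w y) -XE in y2; rewrite -XE in y1; rewrite /cball /= in hy.
have [||ne h] := bnd y; first by apply/andP; split; lra.
  move=> t ht; apply: subU; move: ht; rewrite /cball /= => ht.
  have := normc_dist t y w.
  have : K / 2 * normc (y - b) <= K / 2 * (X + K / 4 * X) by apply: ler_wpM2l; lra.
  lra.
split => //; rewrite div1r; apply: le_trans h _.
apply: ler_wpM2l => //.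
by apply: lerXn2r; rewrite ?nnegrE ?normc_ge0 //; lra.
Qed.

Lemma parabolic_controlled z0 k : cd (fiterc f p) a = 1 ->
  (forall j v P, (j < p)%N -> attracting_petal f p (fiterc f j a) v P ->
     forall z w, P z -> P w -> Phi z = Phi w -> z = w) ->
  basin f p a z0 -> controlled f p a 1 Phi z0 k (fun n => n%:R^-1).
Proof.
move=> l1 Pinj bz0.
have K2 (K : R) : 0 < K <= 1 / 2 -> 0 < K / 2 /\ K / 2 <= 1 / 2.
  by case/andP => k0 k1; split; lra.
have [i ip lim] := residue_limit k mf p0 fa bz0.
have fb := periodic_orbit fa (ltnW ip).
have lb : cd (fiterc f p) (fiterc f i a) = 1.
  by rewrite (multiplier_orbit mf fa (ltnW ip)) // l1 oner_neq0.
have pet_inj v P := Pinj i v P ip.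
have aB U := @attracted_basin _ f p a i U mf p0 fa (ltnW ip).
have entry U m := @basin_entry _ f p a i U z0 m mf p0 fa (ltnW ip).
move: (fiterc f i a) lim fb lb pet_inj aB entry => b lim fb lb pet_inj aB entry.
have [m [c [r [[m0 r0] g_fin g_hol [c_hol cb] gE]]]] : exists m c r, [/\ (0 < m)%N /\ 0 < r,
    forall w, cball b r w -> fiter f p w <> None, hol (fiterc f p) b r,
    hol c b r /\ c b != 0 & forall w, fiterc f p w = w + (w - b) ^+ m.+1 * c w].
  apply: parabolic_order => // e /lim[L hL]; exists (fiterc f (p * L + k) z0).
    exact: hL.
  exact: basin_iter.
have mC : (m%:R : R[i]) != 0 by rewrite pnatr_eq0 -lt0n.
have [v0 v0E] : exists v0, m%:R * c b * v0 ^+ m = -1.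
  exists (m.-root (- (m%:R * c b)^-1)).
  by rewrite rootCK // mulrN mulfV // mulf_neq0.
have v0N := chart_neq0 m0 v0E.
have nv : 0 < normc v0 by rewrite normc_gt0.
have hG := chart_parabolic m0 r0 c_hol cb gE v0E.
have [s0 /andP[s00 s0r] us] := parabolic_univalent m0 r0 g_fin g_hol c_hol gE.
have nc : 0 < normc (c b) by rewrite normc_gt0.
have ca : 0 < normc (c b) / 2 /\ normc (c b) / 2 <= 2 * normc (c b) by split; lra.
have [d2 d20 bnd] := parabolic_displacement r0 c_hol cb gE.
have sd : 0 < Num.min s0 d2 by rewrite lt_min s00.
have [T [eta [d [T1 [eta1 [d1 [[T0 T_1 eta0 etam] [d0 dv] [T10 eta10 d10 dv1] nest]]]]]]] :=
  nested_petals m0 r0 c_hol cb gE v0E sd.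
rewrite !le_min in dv dv1; case/andP: dv => dv dv2; case/andP: dv1 => dv1 _.
have dr : normc v0 * d <= r by exact: le_trans s0r.
have d1r : normc v0 * d1 <= r by exact: le_trans s0r.
have fz0 : fatou f z0 by case/basinP: bz0.
pose u l := chart b v0 (fiterc f (p * l + k) z0).
have uS l : u l.+1 = chart_step f p b v0 (u l).
  by rewrite /u (@chart_stepE _ f p b m m0 c v0 v0E) mulnS -addnA fiterc_addc //; exact: fatou_fin.
(* The orbit never meets b, which is periodic and so outside the basin. *)
have uN l : u l != 0.
  rewrite /u /chart mulf_neq0 ?invr_eq0 // subr_eq0; apply/eqP => E.
  by apply: (periodic_notin_basin fb); rewrite -E; exact: basin_iter.
have u_lim e : 0 < e -> exists N, forall n, (N <= n)%N -> normc (u n) < e.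
  move=> e0; have [N hN] := lim _ (mulr_gt0 e0 nv); exists N => n /hN.
  by rewrite /u /chart normc_div ltr_pdivrMr.
have [L1 [omega [om hL1]]] := petal_entry m0 hG uS uN u_lim T10 eta10 d10.
have [inv inv1 [K K01 subU]] := nest omega om.
(* The larger petal provides inclusion in the basin and injectivity of Phi; the smaller one, [aU1],
   is where the orbit lives. *)
have aU := wpetal_attracted m0 g_fin v0E om T0 eta0 dr inv.
have aU1 := wpetal_attracted m0 g_fin v0E om T10 eta10 d1r inv1.
have [s ss0 hs] := entry _ _ aU1 fz0 hL1.
have UB := aB _ aU.
have inj := pet_inj _ _ (wpetal_attracting m0 r0 g_fin c_hol cb gE v0E om T0 eta0 d0 dr inv
  etam T_1 us dv).
have eqn w : wpetal b m v0 omega T eta d w ->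
    wpetal b m v0 omega T eta d (fiterc f p w) /\ Phi (fiterc f p w) = Phi w + 1.
  move=> Uw; split; last by apply: abel_period; exact: UB.
  by have [y /fitercE -> Uy] := wpetal_step m0 g_fin v0E dr inv Uw.
have bndU w (Uw : wpetal b m v0 omega T eta d w) :=
  bnd w (lt_le_trans (wpetal_cball m0 v0E Uw) dv2).
have [K20 K21] := K2 K K01.
have [d' d'0 hd'] := abel_lower_bound m0 ca.1 ca.2 K20 K21
  (fun w Uw => Phi_hol (UB w Uw)) inj eqn bndU.
have A0 : 0 <= 2 * (2 * normc (c b)) by rewrite !mulr_ge0 // ltW.
have Q0 : 0 <= 2 * normc v0 ^+ m by rewrite mulr_ge0 // exprn_ge0 // ltW.
apply: (petal_controlled (L1 := L1) m0 ss0 K01 A0 Q0 d'0 _ UB _ hd'); first by move=> w /hs[].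
move=> l z hl hz /=; have [bz Uz _] := hs z hz.
have fz : fatou f z by case/basinP: bz.
have [U1w _ Xl] := wpetal_iter m0 g_fin v0E T10 d1r inv1 (l - L1)%N Uz.
rewrite -(fiterc_addc _ (fatou_fin fz)) addnA -mulnDr subnK // in U1w Xl.
split => //; last exact: subU.
rewrite (@normc_chart _ b m m0 c v0 v0E) mulr_gt0 //.
by case: U1w => /andP[].
Qed.

End ParabolicBasin.

(** * Assembling the two cases *)

Lemma loc_unif_bigO_ball (R : realType) (D : set R[i]) (e : nat -> R[i] -> R[i])
    (rate : nat -> R) (r : nat -> R[i]) : (forall n, r n = (rate n)%:C) ->
  (forall z0, D z0 -> exists M s N, 0 < s /\ forall n z, (N <= n)%N -> cball z0 s z ->
     normc (e n z) <= M * rate n) ->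
  loc_unif_bigO D e r.
Proof.
move=> rE h z0 /h[M [s [N [s0 hM]]]]; exists M.
exists ([set z | cball z0 s z], [set n | (N <= n)%N]).
  split=> /=; last by apply/near_inftyP; exists N.
  by apply/nbhs_normcP; exists s.
move=> [z n] /= [hz hn] _.
by rewrite normC_normc rE -rmorphM lecR; exact: hM.
Qed.

Theorem theorem2 (R : realType) (f : R[i] -> sphere R) (p : nat)
    (a lambda mu : R[i]) (Phi : R[i] -> R[i])
    (f_mero : meromorphic f) (f_adm : admissible f)
    (p_gt0 : (0 < p)%N) (a_fix : fiter f p a = Some a)
    (lambdaE : lambda = derive1 (fiterc f p) a)
    (lambda_dom : (0 < `|lambda| /\ `|lambda| < 1) \/ lambda = 1)
    (muE : mu ^+ p = lambda) (mu1 : lambda = 1 -> mu = 1)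
    (Phi_hol : holomorphic_on (basin f p a) Phi)
    (Phi_surj : Phi @` basin f p a = setT)
    (Phi_schroder : `|lambda| < 1 -> schroder_solution f p a mu Phi)
    (Phi_abel : lambda = 1 -> abel_solution f p a Phi) :
  forall t : nat, (1 < t)%N ->
    let D := [set z | basin f p a z /\ derive1 Phi z != 0] in
    let e := fun (n : nat) (z : R[i]) =>
      derive1n t (fiterc f n) z / derive1 (fiterc f n) z
      - derive1n t Phi z / derive1 Phi z in
    (`|lambda| < 1 -> loc_unif_bigO D e (fun n => p.-root (`|lambda| ^+ n))) /\
    (lambda = 1 -> loc_unif_bigO D e (fun n => n%:R^-1)).
Proof.
case=> [//|t] _ D e.
have hPhi z : basin f p a z -> cdiff Phi z by move=> /Phi_hol/cdiffP.
have lE : lambda = cd (fiterc f p) a by rewrite cdE.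
have eE n z : e n z = cdn t.+1 (fiterc f n) z / cd (fiterc f n) z - cdn t.+1 Phi z / cd Phi z.
  by rewrite /e !cdnE cdE.
have DE z : D z -> basin f p a z /\ cd Phi z != 0 by rewrite /D cdE.
(* The two cases differ only in mu, kappa, the rate, and the proof of [controlled]. *)
have bigO rate r : mu != 0 -> (forall n, r n = (rate n)%:C) -> (forall n, 0 <= rate n) ->
    forall kappa, (forall z, basin f p a z -> Phi (finval (f z)) = mu * Phi z + kappa) ->
    (forall z k, basin f p a z -> controlled f p a mu Phi z k rate) ->
    loc_unif_bigO D e r.
  move=> mu0 rE rate0 kappa Phi_eq ctrl; apply: (loc_unif_bigO_ball rE) => z0 /DE[bz0 dz0].
  have [M [s [N [s0 h]]]] := controlled_all f_mero f_adm p_gt0 hPhi Phi_eq t mu0 rate0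
    (fun k _ => ctrl z0 k bz0) dz0.
  by exists M, s, N; split=> // n z Nn hz; rewrite eE; exact: h.
split=> lam.
  have [Phi_eq dPhi] := Phi_schroder lam; rewrite -cdE in dPhi.
  have l0 : 0 < `|lambda| by case: lambda_dom lam => [[]//|->]; rewrite normr1 ltxx.
  apply: (bigO (fun n => normc mu ^+ n)) 0 _ _.
  - by apply: contraTneq l0 => m0; rewrite -muE m0 expr0n (gtn_eqF p_gt0) normr0 ltxx.
  (* |lambda| = |mu|^p, so the p-th root of |lambda|^n is |mu|^n. *)
  - by move=> n; rewrite -muE normrX -exprM mulnC exprM exprCK ?exprn_ge0 // normC_normc rmorphXn.
  - by move=> n; rewrite exprn_ge0 // normc_ge0.
  - by move=> z bz; rewrite addr0; exact: Phi_eq.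
  move=> z k bz; apply: hyperbolic_controlled => //; rewrite -?lE //.
  - by rewrite normc_gt0 -normr_gt0.
  - by rewrite -ltcR -normC_normc.
have [Phi_eq inj] := Phi_abel lam.
have muE1 := mu1 lam; rewrite muE1 in bigO.
apply: (bigO (fun n => n%:R^-1)) p%:R^-1 _ _ => [|n|n|z bz|z k bz].
- exact: oner_neq0.
- by rewrite fmorphV rmorph_nat.
- by rewrite invr_ge0.
- by rewrite mul1r; exact: Phi_eq.
- by apply: parabolic_controlled => //; rewrite -lE.
Qed.
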